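(* Let $m\ge 1$ be an integer. Let $\varphi\in C^0([0,\infty))\cap C^1((0,\infty))$ with $\varphi(0)=0$ and $\varphi'>0$ on $(0,\infty)$. Let $f\in C^0([0,\infty))$ be strictly increasing on $[0,\infty)$ with $f>0$ on $(0,\infty)$. Let $l\in C^0([0,\infty))$ with $l>0$ on $(0,\infty)$, and suppose that $l$ is $C$-monotone non-decreasing for some $C\ge 1$, i.e. $\sup_{s\in[0,t]} l(s)\le C\,l(t)$ for all $t\ge 0$. Suppose that $$\frac{t\varphi'(t)}{l(t)}\in L^1(0^+)\setminus L^1(+\infty),\qquad \frac{\varphi(t)}{l(t)}=o(1)\ \text{ as } t\to 0^+ .$$ Suppose further that there are constants $D,\Lambda>0$ and $\tau\ge 0$ such that $$s\varphi'(st)\le D s^{\tau}\varphi'(t)\quad \forall\, s\in(0,1],\ t\in(0,\infty),\qquad s^{1+\tau}l(t)\le \Lambda\, l(st)\quad\forall\, s\in[0,1],\ t\in[0,\infty).$$ Set $K(t)=\int_0^t \frac{s\varphi'(s)}{l(s)}\,ds$ and $F(t)=\int_0^t f(s)\,ds$ for $t\ge 0$, and assume the generalized Keller-Osserman condition $$\frac{1}{K^{-1}(F(t))}\in L^1(+\infty).$$ Then every weak solution $u\in C^1(H^m)$, $u\ge 0$, of $$\Delta^\varphi_{H^m}u\ \ge\ f(u)\,l(|\nabla_{H^m}u|_{H^m})\qquad\text{on } H^m$$ is constant. Moreover, if $l(0)>0$, then $u\equiv 0$.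
   Context: $H^m$ is the Heisenberg group: the manifold $\mathbb{R}^{2m+1}$ with points $q=(z,t)=(x_1,\dots,x_m,y_1,\dots,y_m,t)$ and group law $q\circ q'=\left(z+z',\,t+t'+2\sum_{i=1}^m (y_ix_i'-x_iy_i')\right)$. Its horizontal left-invariant vector fields are $X_j=\frac{\partial}{\partial x_j}+2y_j\frac{\partial}{\partial t}$, $Y_j=\frac{\partial}{\partial y_j}-2x_j\frac{\partial}{\partial t}$, $j=1,\dots,m$. For $C^1$ functions $u,v$: $\nabla_{H^m}u=\sum_j (X_ju)X_j+(Y_ju)Y_j$, $\nabla_{H^m}u\cdot\nabla_{H^m}v=\sum_j (X_ju)(X_jv)+(Y_ju)(Y_jv)$, and $|\nabla_{H^m}u|_{H^m}^2=\nabla_{H^m}u\cdot\nabla_{H^m}u$. The $\varphi$-Laplacian is $\Delta^\varphi_{H^m}u=\sum_{j}\left[X_j\left(|\nabla_{H^m}u|_{H^m}^{-1}\varphi(|\nabla_{H^m}u|_{H^m})X_ju\right)+Y_j\left(|\nabla_{H^m}u|_{H^m}^{-1}\varphi(|\nabla_{H^m}u|_{H^m})Y_ju\right)\right]$. The differential inequality is understood weakly: $u\in C^1(H^m)$ and, for all $\zeta\in C_0^\infty(H^m)$ with $\zeta\ge 0$, $$-\int_{\mathbb{R}^{2m+1}}|\nabla_{H^m}u|_{H^m}^{-1}\varphi(|\nabla_{H^m}u|_{H^m})\,\nabla_{H^m}u\cdot\nabla_{H^m}\zeta\ \ge\ \int_{\mathbb{R}^{2m+1}}f(u)\,l(|\nabla_{H^m}u|_{H^m})\,\zeta$$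 (Lebesgue measure; the integrand on the left is $0$ where $\nabla_{H^m}u=0$). $L^1(0^+)$, resp. $L^1(+\infty)$, means integrable in a right neighbourhood of $0$, resp. in a neighbourhood of $+\infty$. Under the hypotheses $K$ is an increasing bijection of $[0,\infty)$ onto itself, with inverse $K^{-1}$. *)

(* Defs.v *)
From HB Require Import structures.
From mathcomp Require Import all_boot all_order all_algebra.
From mathcomp Require Import all_classical all_reals all_analysis.

Set Implicit Arguments.
Unset Strict Implicit.
Unset Printing Implicit Defensive.

Import Order.TTheory GRing.Theory Num.Theory.
Import numFieldNormedType.Exports.

Local Open Scope classical_set_scope.
Local Open Scope ring_scope.

(* The product (= Borel) sigma-algebra on R^n. *)
Section measurable_rV.
Context {R : realType} {n : nat}.

Definition rV_coord (i : 'I_n) (q : 'rV[R]_n) : R := q ord0 i.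

Let rV_set0 : g_sigma_preimage rV_coord set0.
Proof. exact: sigma_algebra0. Qed.

Let rV_setC A : g_sigma_preimage rV_coord A -> g_sigma_preimage rV_coord (~` A).
Proof. exact: sigma_algebraC. Qed.

Let rV_bigcup (F : _^nat) : (forall i, g_sigma_preimage rV_coord (F i)) ->
  g_sigma_preimage rV_coord (\bigcup_i (F i)).
Proof. exact: sigma_algebra_bigcup. Qed.

HB.instance Definition _ := @isMeasurable.Build default_measure_display
  'rV[R]_n (g_sigma_preimage rV_coord) rV_set0 rV_setC rV_bigcup.

End measurable_rV.

Lemma measurable_fun_rVP d (T : measurableType d) (R : realType) n
    (f : T -> 'rV[R]_n) :
  (forall i, measurable_fun setT (fun x => f x ord0 i)) ->
  measurable_fun setT f.
Proof.
move=> mf.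
suff: g_sigma_preimage (fun i x => rV_coord i (f x)) `<=` measurable.
  move=> h _ A mA; apply: h.
  rewrite [X in X _](g_sigma_preimage_comp (@rV_coord R n) f).
  by exists A.
apply: smallest_sub; first exact: sigma_algebra_measurable.
case: n => [|n] in f mf *; first by rewrite big_ord0.
rewrite -bigcup_mkord_ord; apply: bigcup_sub => i Ii.
by move=> A [B mB <-]; exact: mf.
Qed.

Lemma measurable_rV_coord (R : realType) n (i : 'I_n) :
  measurable_fun setT (@rV_coord R n i).
Proof.
move=> _ Y mY; rewrite setTI; apply: sub_sigma_algebra => /=.
rewrite -bigcup_seq/=; exists i => /=; first by rewrite mem_index_enum.
by exists Y => //; rewrite setTI.
Qed.

Section lebesgue_rV_step.
Context {R : realType}.

Definition rV_cons n (p : measurableTypeR R * 'rV[R]_n) : 'rV[R]_n.+1 :=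
  \row_i if unlift ord0 i is Some j then p.2 ord0 j else p.1.

Lemma measurable_rV_cons n : measurable_fun setT (@rV_cons n).
Proof.
apply: measurable_fun_rVP => i.
case: (unliftP ord0 i) => [j|] ->.
- rewrite (_ : (fun _ => _) = @rV_coord R n j \o snd); last first.
    by apply/funext => p /=; rewrite mxE liftK.
  by apply: measurableT_comp => //; exact: measurable_rV_coord.
- rewrite (_ : (fun _ => _) = fst); last first.
    by apply/funext => p /=; rewrite mxE unlift_none.
  exact: measurable_fst.
Qed.

Context (n : nat) (mu : {sigma_finite_measure set 'rV[R]_n -> \bar R}).

Definition lebesgue_rV_step : set 'rV[R]_n.+1 -> \bar R :=
  pushforward (@lebesgue_measure R \x mu)%E (@rV_cons n).

Let nu : {measure set 'rV[R]_n.+1 -> \bar R} :=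
  measure_function_pushforward__canonical__measure_function_Measure
   (@lebesgue_measure R \x mu)%E (@measurable_rV_cons n).

Let step0 : lebesgue_rV_step set0 = 0%E. Proof. exact: (measure0 nu). Qed.
Let step_ge0 A : (0 <= lebesgue_rV_step A)%E.
Proof. exact: (measure_ge0 nu). Qed.
Let step_sa : semi_sigma_additive lebesgue_rV_step.
Proof. exact: (@measure_semi_sigma_additive _ _ _ nu). Qed.

HB.instance Definition _ := isMeasure.Build _ _ _ lebesgue_rV_step
  step0 step_ge0 step_sa.

Lemma rV_cons_inj : injective (@rV_cons n).
Proof.
move=> [a u] [b v] /rowP E; congr (_, _).
  by have := E ord0; rewrite !mxE !unlift_none.
by apply/rowP => j; have := E (lift ord0 j); rewrite !mxE !liftK.
Qed.

Lemma rV_cons_split (q : 'rV[R]_n.+1) :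
  rV_cons (q ord0 ord0, \row_j q ord0 (lift ord0 j)) = q.
Proof.
by apply/rowP => i; rewrite mxE; case: (unliftP ord0 i) => [j|] -> //=; rewrite mxE.
Qed.

Lemma measurable_rV_split : measurable_fun setT (fun q : 'rV[R]_n.+1 =>
  ((q ord0 ord0 : measurableTypeR R), (\row_j q ord0 (lift ord0 j) : 'rV[R]_n))).
Proof.
apply: measurable_fun_pair; first exact: (@measurable_rV_coord R n.+1).
apply: measurable_fun_rVP => j.
rewrite (_ : (fun _ => _) = @rV_coord R n.+1 (lift ord0 j)); last first.
  by apply/funext => q; rewrite /= mxE.
exact: measurable_rV_coord.
Qed.

Let step_sigma_finite : sigma_finite setT lebesgue_rV_step.
Proof.
have /sigma_finiteP[F [TF ndF Foo]] := sigma_finiteT (@lebesgue_measure R).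
have /sigma_finiteP[G [TG ndG Goo]] := sigma_finiteT mu.
pose g (q : 'rV[R]_n.+1) : measurableTypeR R * 'rV[R]_n :=
  (q ord0 ord0, \row_j q ord0 (lift ord0 j)).
exists (fun k => g @^-1` (F k `*` G k)).
  rewrite -preimage_bigcup (_ : \bigcup_k _ = setT) ?preimage_setT//.
  rewrite -setXTT TF TG predeqE => -[x y]; split.
    by move=> [n0 _ []/= ? ?]; split; exists n0.
  move=> [/= [i _ Fx] [k _ Gy]]; exists (maxn i k) => //; split.
  - by move: x Fx; exact/subsetPset/ndF/leq_maxl.
  - by move: y Gy; exact/subsetPset/ndG/leq_maxr.
move=> k; have [mF Fk] := Foo k; have [mG Gk] := Goo k; split.
  rewrite -[X in measurable X]setTI; apply: measurable_rV_split => //.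
  exact: measurableX.
rewrite /lebesgue_rV_step /pushforward.
rewrite -comp_preimage (_ : g \o _ = id) ?preimage_id; last first.
  by apply/funext => p; apply: rV_cons_inj; rewrite /g /= rV_cons_split.
by rewrite product_measure1E// lte_mul_pinfty// ge0_fin_numE.
Qed.

HB.instance Definition _ := Measure_isSigmaFinite.Build _ _ _ lebesgue_rV_step
  step_sigma_finite.

End lebesgue_rV_step.

(* Lebesgue measure on R^n, as the iterated product of the one on R;
   lebesgue_rV_box below characterizes it. *)
Fixpoint lebesgue_rV (R : realType) (n : nat) :
    {sigma_finite_measure set 'rV[R]_n -> \bar R} :=
  match n with
  | 0 => \d_(0 : 'rV[R]_0)
  | n'.+1 => lebesgue_rV_step (lebesgue_rV R n')
  end.
Arguments lebesgue_rV {R n}.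

Lemma lebesgue_rV_box (R : realType) n (A : 'I_n -> set R) :
  (forall i, measurable (A i)) ->
  lebesgue_rV [set q : 'rV[R]_n | forall i, A i (q ord0 i)] =
  (\prod_(i < n) lebesgue_measure (A i))%E.
Proof.
elim: n A => [|n IH] A mA.
  rewrite big_ord0 /= diracE (_ : _ \in _ = true)//.
  by apply/mem_set => -[].
rewrite big_ord_recl -IH; last by move=> i; exact: mA.
rewrite -product_measure1E; [|exact: mA|]; last first.
  rewrite (_ : mkset _ =
    \bigcap_(i in [set: 'I_n]) (rV_coord i @^-1` A (lift ord0 i))).
    apply: fin_bigcap_measurable; first exact: finite_finset.
    move=> i _; rewrite -[X in measurable X]setTI.
    by apply: measurable_rV_coord => //; exact: mA.
  apply/seteqP; split => q h i; first by move=> _; exact: h.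
  exact: h i Logic.I.
rewrite /= /lebesgue_rV_step /pushforward; congr (product_measure1 _ _ _).
apply/seteqP; split => -[x q] /= h.
  split; first by have := h ord0; rewrite mxE unlift_none.
  by move=> i; have := h (lift ord0 i); rewrite mxE liftK.
case: h => hx hq i; rewrite mxE; case: (unliftP ord0 i) => [j|] -> //=; exact: hq.
Qed.

Section heisenberg.
Context {R : realType} {m : nat}.
Local Notation H := 'rV[R]_(m + m + 1).

(* Coordinates are ordered as q = (x_1, ..., x_m, y_1, ..., y_m, t). *)
Definition idx_x (j : 'I_m) : 'I_(m + m + 1) := lshift 1 (lshift m j).
Definition idx_y (j : 'I_m) : 'I_(m + m + 1) := lshift 1 (rshift m j).
Definition idx_t : 'I_(m + m + 1) := rshift (m + m) ord0.

Definition partial n (k : 'I_n) (u : 'rV[R]_n -> R) (q : 'rV[R]_n) : R :=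
  'D_(delta_mx ord0 k) u q.

Fixpoint Ck n (k : nat) (u : 'rV[R]_n -> R) : Prop :=
  match k with
  | 0 => continuous u
  | k'.+1 => (forall q, differentiable u q) /\
             (forall i, Ck k' (partial i u))
  end.

Definition Xfield (j : 'I_m) (u : H -> R) (q : H) : R :=
  partial (idx_x j) u q + 2 * q ord0 (idx_y j) * partial idx_t u q.

Definition Yfield (j : 'I_m) (u : H -> R) (q : H) : R :=
  partial (idx_y j) u q - 2 * q ord0 (idx_x j) * partial idx_t u q.

Definition hgrad_dot (u v : H -> R) (q : H) : R :=
  \sum_(j < m) (Xfield j u q * Xfield j v q + Yfield j u q * Yfield j v q).

Definition hgrad_norm (u : H -> R) (q : H) : R :=
  Num.sqrt (hgrad_dot u u q).

Definition test_function (zeta : H -> R) : Prop :=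
  (forall k, Ck k zeta) /\ compact (closure [set q | zeta q != 0]).

(* Weak form of Delta^phi u >= f(u) l(|grad u|). Since 0^-1 = 0, the integrand
   on the left vanishes where grad u = 0. *)
Definition weak_solution (phi f l : R -> R) (u : H -> R) : Prop :=
  Ck 1 u /\
  forall zeta : H -> R, test_function zeta -> (forall q, 0 <= zeta q) ->
  (- (\int[lebesgue_rV]_q
        ((hgrad_norm u q)^-1 * phi (hgrad_norm u q) * hgrad_dot u zeta q)%:E)
   >= \int[lebesgue_rV]_q (f (u q) * l (hgrad_norm u q) * zeta q)%:E)%E.

End heisenberg.

Section one_variable.
Context {R : realType}.
Implicit Types g : R -> R.

Definition L1_0plus g : Prop :=
  exists2 d : R, 0 < d & lebesgue_measure.-integrable `]0, d[ (EFin \o g).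

Definition L1_pinfty g : Prop :=
  exists2 M : R, 0 < M & lebesgue_measure.-integrable `]M, +oo[ (EFin \o g).

Definition C_monotone (C : R) (l : R -> R) : Prop :=
  forall t, 0 <= t -> sup (l @` `[0, t]) <= C * l t.

(* The value of the integrand at s = 0, where phi need not be differentiable,
   is irrelevant. *)
Definition Kfun (phi l : R -> R) (t : R) : R :=
  \int[lebesgue_measure]_(s in `[0, t]) (s * derive1 phi s / l s).

(* A right inverse of K on K([0, +oo)) with values in [0, +oo); it is K^{-1}
   when K is a bijection of [0, +oo). *)
Definition Kinv (phi l : R -> R) : R -> R :=
  'pinv_(fun=> 0) `[0, +oo[ (Kfun phi l).

Definition Ffun (f : R -> R) (t : R) : R :=
  \int[lebesgue_measure]_(s in `[0, t]) f s.

End one_variable.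

(* Main.v *)
(** If [u] took two values [u p < u qb], the generalized Keller-Osserman condition
    would provide an increasing convex [al] on [(t0, T)] that is small near [t0], blows
    up at [T], and whose composition [v] with the Koranyi distance [rad p] to the centre
    [p] is a supersolution. It is compared strictly with [u] only off the vertical axis
    through [p], where the horizontal gradient of [rad p] does not vanish: there the
    weak inequality, tested with an increasing function of [u - v - c], excludes that
    all maximum points of [u - v] are off the axis. So for every centre near [p] the
    maximum of [u - v] is attained on the axis. At an axis point a horizontal translation
    of the centre by [h] changes [rad ^+ 4] by [h ^+ 4] only, whereas a vertical one
    changes it to first order; since four horizontal translations around a square of
    side [h] compose to a vertical one of size [4 * h ^+ 2], going round such a square
    would increase the maximum for the centre [p], which is absurd.

    The test functions that arise are only of class C^1; they are reached from smooth
    ones by multiplying Bernstein polynomials by a smooth bump. *)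

Require Import Defs.
From HB Require Import structures.
From mathcomp Require Import all_boot all_order all_algebra.
From mathcomp Require Import all_classical all_reals all_analysis.
From mathcomp Require Import measurable_realfun.
From mathcomp Require Import ring lra.

Set Implicit Arguments.
Unset Strict Implicit.
Unset Printing Implicit Defensive.

Import Order.TTheory GRing.Theory Num.Theory.
Import numFieldNormedType.Exports.

Local Open Scope classical_set_scope.
Local Open Scope ring_scope.

(** * Partial derivatives and C^1 functions *)

(** The barrier is [al = Y / sg], where [Y] solves [Y' = sg * G Y] and [G] is $K^{-1}\circ F$.
    Differentiating [K (G y) = F y] turns this into $\varphi'(al')\,al'' = sg\,f(Y)\,l(al')$, and
    the generalized Keller-Osserman condition is the finiteness of the blow-up time of this
    equation. A small [sg] leaves room for the first-order term of the radial operator, whose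
    coefficient $2m+1$ is the homogeneous dimension minus one, and for the constants [D], [Lambda],
    which pay for the fact that the horizontal gradient of [rad] has length [rho / rad] instead of
    1. Strictness comes from [f]: at a maximum of $u-v>0$ off the axis both horizontal gradients
    agree and are nonzero, so [l] is positive there and $f(u)>f(v)$ decides. On the axis the
    gradients vanish, [l 0] may be 0 and $\varphi'$ is not controlled at 0, so the sources cannot be
    compared. That case is therefore left to the geometry of the group, which needs little more than
    the location of the maximum points for all nearby centres. *)

Lemma is_derive_inv (R : realType) (x : R) : x != 0 ->
  is_derive x 1 (fun y : R => y^-1) (- x ^- 2).
Proof.
move=> x0; have x0' : id x != 0 by [].
split; first exact: (derivableV x0' (@derivable_id _ _ x 1)).
by rewrite (deriveV x0' (@derivable_id _ _ x 1)) derive_id scaler1.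
Qed.

Lemma is_derive_derive1 (R : realType) (f : R -> R) (x d : R) :
  is_derive x 1 f d -> derive1 f x = d.
Proof. by case=> _; rewrite derive1E. Qed.

Lemma near_eq_differentiable (R : numFieldType) (V W : normedModType R)
    (f g : V -> W) (a : V) :
  (\near a, f a = g a) -> differentiable g a -> differentiable f a.
Proof.
move=> e d2; have [c2 /eqaddoP l2] := (diff_locallyP _ _).1 d2.
have l1 : f \o shift a = cst (f a) + 'd g a +o_ (0 : V) id.
  apply/eqaddoP => eps eps0.
  have e' : \forall x \near (0 : V), f (x + a) = g (x + a).
    by have := e; rewrite (near_shift 0 a) /= subr0.
  near=> x.
  have H : `|g (x + a) - (g a + 'd g a x)| <= eps * `|x|.
    by near: x; exact: l2.
  have E : f (x + a) = g (x + a) by near: x.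
  by rewrite -E -(nbhs_singleton e) in H; exact: H.
apply/diff_locallyP.
by have dE := diff_unique c2 l1; split; rewrite dE.
Unshelve. all: by end_near. Qed.

Section partial_calculus.
Context {R : realType} {n : nat}.
Implicit Types (h : 'rV[R]_n -> R) (q : 'rV[R]_n) (i : 'I_n) (O : set 'rV[R]_n).

Lemma partialD i h1 h2 q : differentiable h1 q -> differentiable h2 q ->
  partial i (fun x => h1 x + h2 x) q = partial i h1 q + partial i h2 q.
Proof. by move=> d1 d2; apply: (deriveD (diff_derivable d1) (diff_derivable d2)). Qed.

Lemma partialN i h q : differentiable h q ->
  partial i (fun x => - h x) q = - partial i h q.
Proof. by move=> d1; apply: (deriveN (diff_derivable d1)). Qed.

Lemma partialM i h1 h2 q : differentiable h1 q -> differentiable h2 q ->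
  partial i (fun x => h1 x * h2 x) q = h1 q * partial i h2 q + h2 q * partial i h1 q.
Proof.
by move=> d1 d2; exact: (deriveM (diff_derivable d1) (diff_derivable d2)).
Qed.

Lemma partial_cst i c q : partial i (fun=> c) q = 0.
Proof. exact: derive_cst. Qed.

Lemma differentiable_sum_seq (I : Type) (r : seq I) (P : pred I)
    (h : I -> 'rV[R]_n -> R) q :
  (forall k, P k -> differentiable (h k) q) ->
  differentiable (fun x => \sum_(k <- r | P k) h k x) q.
Proof.
move=> dh; elim: r => [|k r IH].
  by rewrite (_ : (fun _ => _) = cst 0); [exact: differentiable_cst|
    apply/funext => x; rewrite big_nil].
under eq_fun do rewrite big_cons; case Pk: (P k) => //.
exact: (differentiableD (dh _ Pk) IH).
Qed.

Lemma partial_sum (I : Type) (r : seq I) (P : pred I) (h : I -> 'rV[R]_n -> R) i q :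
  (forall k, P k -> differentiable (h k) q) ->
  partial i (fun x => \sum_(k <- r | P k) h k x) q =
  \sum_(k <- r | P k) partial i (h k) q.
Proof.
move=> dh; elim: r => [|k r IH].
  by rewrite big_nil; under eq_fun do rewrite big_nil; exact: partial_cst.
rewrite big_cons; under eq_fun do rewrite big_cons; case Pk: (P k) => //.
by rewrite partialD ?IH//; [exact: dh|exact: differentiable_sum_seq].
Qed.

Lemma differentiable_coordinate i q : differentiable (fun x : 'rV[R]_n => x ord0 i) q.
Proof. exact: differentiable_coord. Qed.

Lemma partial_coord i j q :
  partial i (fun x : 'rV[R]_n => x ord0 j) q = (i == j)%:R.
Proof.
have @f : {linear 'rV[R]_n -> R}.
  by exists (fun N : 'rV[R]_n => N ord0 j); do 2![eexists]; do ?[constructor];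
     rewrite ?mxE// => ? *; rewrite ?mxE//; move=> ?; rewrite !mxE.
rewrite /partial deriveE; last exact: differentiable_coordinate.
have -> : (fun x : 'rV[R]_n => x ord0 j) = f by [].
by rewrite diff_lin; [rewrite /f /= mxE eqxx /= eq_sym|exact: coord_continuous].
Qed.

Lemma partial_comp i (g : R -> R) h q : derivable g (h q) 1 -> differentiable h q ->
  partial i (g \o h) q = derive1 g (h q) * partial i h q.
Proof.
move=> dg dh; have dg' : differentiable g (h q) by exact/derivable1_diffP.
rewrite /partial deriveE; last exact: differentiable_comp.
by rewrite diff_comp//= deriv1E// -deriveE//= mulrC.
Qed.

(** A local form of [Ck 1], needed because the barrier is C^1 only in a shell around the centre and
    its flux only off the axis. On the whole space the two notions agree ([C1onTP]). *)
Definition C1on O h := forall q, O q ->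
  differentiable h q /\ forall i, {for q, continuous (partial i h)}.

Lemma continuous_near_eq (T : topologicalType) (h1 h2 : T -> R) (q : T) :
  (\near q, h1 q = h2 q) -> {for q, continuous h2} -> {for q, continuous h1}.
Proof.
move=> e c; rewrite /prop_for/continuous_at (nbhs_singleton e).
by apply: cvg_trans c; apply: near_eq_cvg; near=> x; apply/esym; near: x.
Unshelve. all: by end_near. Qed.

Lemma C1on_eq O h1 h2 : open O -> (forall q, O q -> h1 q = h2 q) ->
  C1on O h2 -> C1on O h1.
Proof.
move=> oO e C2 q Oq; have [d2 c2] := C2 q Oq.
have nO q' : O q' -> \forall x \near q', O x.
  by move=> Oq'; apply: open_nbhs_nbhs (conj oO Oq').
have n0 q' : O q' -> \near q', h1 q' = h2 q'.
  by move=> Oq'; apply: filterS (nO _ Oq') => x; exact: e.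
split; first exact: near_eq_differentiable (n0 _ Oq) d2.
move=> i; apply: continuous_near_eq (c2 i); apply: filterS (nO _ Oq) => x Ox.
exact/near_eq_derive/n0.
Qed.

Lemma C1on_subset O O' h : O' `<=` O -> C1on O h -> C1on O' h.
Proof. by move=> s C1 q /s /C1. Qed.

Lemma C1on_continuous O h q : C1on O h -> O q -> {for q, continuous h}.
Proof. by move=> C1 Oq; exact/differentiable_continuous/(C1 q Oq).1. Qed.

Lemma C1on_setU O O' h : C1on O h -> C1on O' h -> C1on (O `|` O') h.
Proof. by move=> C1 C2 q [/C1|/C2]. Qed.

Lemma C1on_cst O c : C1on O (fun=> c).
Proof.
move=> q _; split=> [|i]; first exact: differentiable_cst.
rewrite (_ : partial i _ = cst 0); first exact: cst_continuous.
by apply/funext => x; exact: partial_cst.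
Qed.

Lemma C1on_coord O j : C1on O (fun x => x ord0 j).
Proof.
move=> q _; split=> [|i]; first exact: differentiable_coordinate.
rewrite (_ : partial i _ = cst (i == j)%:R); first exact: cst_continuous.
by apply/funext => x; exact: partial_coord.
Qed.

Lemma C1on_D O h1 h2 : open O -> C1on O h1 -> C1on O h2 ->
  C1on O (fun x => h1 x + h2 x).
Proof.
move=> oO C1 C2 q Oq; have [d1 c1] := C1 q Oq; have [d2 c2] := C2 q Oq.
split=> [|i]; first exact: differentiableD.
apply: (@continuous_near_eq _ _ (fun x => partial i h1 x + partial i h2 x)); last first.
  exact: (cvgD (c1 i) (c2 i)).
apply: filterS (open_nbhs_nbhs (conj oO Oq)) => x Ox.
by rewrite partialD//; [exact: (C1 x Ox).1|exact: (C2 x Ox).1].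
Qed.

Lemma C1on_M O h1 h2 : open O -> C1on O h1 -> C1on O h2 ->
  C1on O (fun x => h1 x * h2 x).
Proof.
move=> oO C1 C2 q Oq; have [d1 c1] := C1 q Oq; have [d2 c2] := C2 q Oq.
split=> [|i]; first exact: differentiableM.
apply: (@continuous_near_eq _ _
  (fun x => h1 x * partial i h2 x + h2 x * partial i h1 x)); last first.
  exact: (cvgD (cvgM (C1on_continuous C1 Oq) (c2 i))
               (cvgM (C1on_continuous C2 Oq) (c1 i))).
apply: filterS (open_nbhs_nbhs (conj oO Oq)) => x Ox.
by rewrite partialM//; [exact: (C1 x Ox).1|exact: (C2 x Ox).1].
Qed.

Lemma C1on_N O h : open O -> C1on O h -> C1on O (fun x => - h x).
Proof.
move=> oO C1; rewrite (_ : (fun _ => _) = fun x => -1 * h x).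
  exact: C1on_M (C1on_cst _) C1.
by apply/funext => x; rewrite mulN1r.
Qed.

Lemma C1on_B O h1 h2 : open O -> C1on O h1 -> C1on O h2 ->
  C1on O (fun x => h1 x - h2 x).
Proof. by move=> oO C1 C2; exact: (C1on_D oO C1 (C1on_N oO C2)). Qed.

Lemma C1on_sum O (I : Type) (r : seq I) (P : pred I) (h : I -> 'rV[R]_n -> R) :
  open O -> (forall k, P k -> C1on O (h k)) ->
  C1on O (fun x => \sum_(k <- r | P k) h k x).
Proof.
move=> oO dh; elim: r => [|k r IH].
  by under eq_fun do rewrite big_nil; exact: C1on_cst.
under eq_fun do rewrite big_cons; case Pk: (P k) => //.
exact: (C1on_D oO (dh _ Pk) IH).
Qed.

Lemma C1on_comp O (g : R -> R) h : open O -> C1on O h ->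
  (forall q, O q -> derivable g (h q) 1 /\ {for h q, continuous (derive1 g)}) ->
  C1on O (g \o h).
Proof.
move=> oO C1 Cg q Oq; have [d1 c1] := C1 q Oq; have [dg cg] := Cg q Oq.
split=> [|i].
  exact: (differentiable_comp d1 ((derivable1_diffP _ _).1 dg)).
apply: (@continuous_near_eq _ _
  (fun x => derive1 g (h x) * partial i h x)); last first.
  apply: (cvgM _ (c1 i)).
  exact: (continuous_comp (C1on_continuous C1 Oq) cg).
apply: filterS (open_nbhs_nbhs (conj oO Oq)) => x Ox.
exact: (partial_comp _ (Cg x Ox).1 (C1 x Ox).1).
Qed.

Lemma C1on_comp_der O (V : set R) (g g' : R -> R) h : open O -> open V ->
  C1on O h -> (forall q, O q -> V (h q)) ->
  (forall y : R, V y -> is_derive y 1 g (g' y)) ->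
  (forall y, V y -> {for y, continuous g'}) -> C1on O (fun q => g (h q)).
Proof.
move=> oO oV C1 OV dg cg; apply: (C1on_comp oO C1) => q Oq.
have Vq := OV q Oq; split; first by case: (dg _ Vq).
apply: (@continuous_near_eq _ _ g'); last exact: cg.
by apply: filterS (open_nbhs_nbhs (conj oV Vq)) => y Vy; exact/is_derive_derive1/dg.
Qed.

Lemma C1on_inv O h : open O -> C1on O h -> (forall q, O q -> 0 < h q) ->
  C1on O (fun q => (h q)^-1).
Proof.
move=> oO C1 h0; apply: (@C1on_comp_der O [set x | 0 < x] (fun x => x^-1) (fun x => - x ^- 2)
  h oO (@open_gt R 0) C1 h0).
- by move=> y y0; apply: is_derive_inv; rewrite gt_eqF.
- move=> y y0; apply: cvgN; apply: cvgV; first by rewrite expf_neq0// gt_eqF.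
  exact: exprn_continuous.
Qed.

Lemma C1onTP h : C1on setT h <-> Ck 1 h.
Proof.
split=> [C1|[d c] q _]; last by split=> [|i]; [exact: d|exact: (c i q)].
by split=> [q|i q]; [exact: (C1 q Logic.I).1|exact: (C1 q Logic.I).2].
Qed.

(** The complement of [F] is open and [h] vanishes on it, so [O] and this complement form an open
    cover on each member of which [h] is C^1. Test functions built from the barrier are extended by
    zero in this way. *)
Lemma C1on_glue O F h : open O -> closed F -> F `<=` O ->
  (forall q, ~ F q -> h q = 0) -> C1on O h -> C1on setT h.
Proof.
move=> oO cF FO h0 C1.
have C2 : C1on (~` F) h.
  apply: (@C1on_eq _ _ (fun=> 0)); [exact: closed_openC|exact: h0|exact: C1on_cst].
apply: C1on_subset (C1on_setU C1 C2) => q _.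
by have [/FO|] := pselect (F q); [left|right].
Qed.

Lemma partial_eq0 (F : set 'rV[R]_n) h i q : closed F ->
  (forall q, ~ F q -> h q = 0) -> ~ F q -> partial i h q = 0.
Proof.
move=> cF h0 Fq; rewrite -[RHS](partial_cst i 0 q); apply: near_eq_derive.
apply: filterS (open_nbhs_nbhs (conj (closed_openC cF) Fq)) => x; exact: h0.
Qed.

End partial_calculus.

(** * Continuity, compactness and integration in R^n *)

Section rV_topology.
Context {R : realType}.

Lemma coord_le_norm n (q : 'rV[R]_n) i : `|q ord0 i| <= `|q|.
Proof.
by rewrite [leRHS]/Num.norm /= mx_normrE; apply/bigmax_geP; right; exists (ord0, i).
Qed.

Lemma norm_lt_coord n (q : 'rV[R]_n) e : 0 < e ->
  (forall i, `|q ord0 i| < e) -> `|q| < e.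
Proof.
move=> e0 h; rewrite /Num.norm /= mx_normrE; apply/bigmax_ltP; split => // -[i j] _ /=.
by rewrite ord1.
Qed.

Lemma continuous_rV (T : topologicalType) n (f : T -> 'rV[R]_n) (x : T) :
  (forall i, f y ord0 i @[y --> x] --> f x ord0 i) -> {for x, continuous f}.
Proof.
move=> h A [P nP sPA].
have : \forall y \near x, forall i, P ord0 i (f y ord0 i).
  by apply: filter_forall => i; exact: (h i (P ord0 i) (nP _ _)).
by apply: filterS => y Py; apply: sPA => i j; rewrite !ord1.
Qed.

Lemma continuous_rV_coord n i : continuous (fun q : 'rV[R]_n => q ord0 i).
Proof. by move=> q; exact: coord_continuous. Qed.

Definition cube n (B : R) : set 'rV[R]_n := [set q | forall i, `|q ord0 i| <= B].

Arguments cube n B : clear implicits.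

Lemma compact_cube n B : compact (cube n B).
Proof.
rewrite (_ : cube n B = [set q | forall i, `[(- B), B]%classic (q ord0 i)]).
  apply: (@rV_compact _ _ (fun=> `[(- B), B]%classic)) => i.
  exact: segment_compact.
by apply/seteqP; split => q h i; have := h i; rewrite /= in_itv/= ler_norml.
Qed.

Lemma closed_sublevel (T : topologicalType) (f : T -> R) c : continuous f ->
  closed [set x | f x <= c].
Proof.
move=> cf; apply: (@preimage_closed _ _ f [set x | x <= c]); last exact: closed_le.
by move=> x _; exact: cf.
Qed.

Lemma closed_superlevel (T : topologicalType) (f : T -> R) c : continuous f ->
  closed [set x | c <= f x].
Proof.
move=> cf; apply: (@preimage_closed _ _ f [set x | c <= x]); last exact: closed_ge.
by move=> x _; exact: cf.
Qed.

Lemma open_sublevel (T : topologicalType) (f : T -> R) c : continuous f ->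
  open [set x | f x < c].
Proof.
move=> cf; apply: (@open_comp _ _ f [set x | x < c]); last exact: open_lt.
by move=> x _; exact: cf.
Qed.

Lemma open_superlevel (T : topologicalType) (f : T -> R) c : continuous f ->
  open [set x | c < f x].
Proof.
move=> cf; apply: (@open_comp _ _ f [set x | c < x]); last exact: open_gt.
by move=> x _; exact: cf.
Qed.

Lemma closed_cube n B : closed (cube n B).
Proof.
rewrite (_ : cube n B = \bigcap_(i in setT) [set q : 'rV[R]_n | `|q ord0 i| <= B]).
  apply: closed_bigI => i _.
  apply: (@closed_sublevel _ (fun q : 'rV[R]_n => `|q ord0 i|)) => q.
  apply: (continuous_comp (@continuous_rV_coord n i q)).
  exact: norm_continuous.
by apply/seteqP; split => q h; [move=> i _; exact: h|move=> i; exact: (h i Logic.I)].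
Qed.

End rV_topology.
Arguments cube {R} n B.

Section rV_measure.
Context {R : realType}.

Lemma measurable_rV_rect n (A : 'I_n -> set R) : (forall i, measurable (A i)) ->
  measurable [set q : 'rV[R]_n | forall i, A i (q ord0 i)].
Proof.
move=> mA.
rewrite (_ : mkset _ = \bigcap_(i in [set: 'I_n]) (rV_coord i @^-1` A i)).
  apply: fin_bigcap_measurable; first exact: finite_finset.
  move=> i _; rewrite -[X in measurable X]setTI.
  by apply: measurable_rV_coord => //; exact: mA.
by apply/seteqP; split => q h i; [move=> _; exact: h|exact: h i Logic.I].
Qed.

(** The sigma-algebra is generated by the coordinates, so open sets need an argument: [U] is the
    union of the boxes contained in it that have a rational centre and a half-side of the form
    [1 / (k + 1)], a countable family. *)
Lemma measurable_rV_open n (U : set 'rV[R]_n) : open U -> measurable U.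
Proof.
move=> oU.
pose box (p : 'rV[rat]_n * nat) : set 'rV[R]_n :=
  [set q | forall i, `](ratr (p.1 ord0 i) - p.2.+1%:R^-1),
                      (ratr (p.1 ord0 i) + p.2.+1%:R^-1)[%classic (q ord0 i)].
pose D := [set p | box p `<=` U].
have -> : U = \bigcup_p (if p \in D then box p else set0).
  rewrite -bigcup_mkcond.
  apply/seteqP; split => [q Uq|q [p Dp]]; last exact: Dp.
  have := oU q Uq; rewrite /interior -nbhs_ballE => -[e /= e0 eU].
  have [k _ /(_ k (leqnn k))] := near_infty_natSinv_lt (PosNum (divr_gt0 e0 (ltr0Sn R 1))).
  move=> /= ke.
  have ex i : exists r : rat, `|q ord0 i - ratr r| < k.+1%:R^-1.
    have [|r] := @rat_in_itvoo R (q ord0 i - k.+1%:R^-1) (q ord0 i + k.+1%:R^-1).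
      by rewrite ltrBlDr -addrA ltrDl addr_gt0 ?invr_gt0.
    by rewrite in_itv/= -ltr_distl distrC; exists r.
  pose a : 'rV[rat]_n := \row_i (xchoose (ex i)).
  have aP i : `|q ord0 i - ratr (a ord0 i)| < k.+1%:R^-1.
    by rewrite mxE; exact: (xchooseP (ex i)).
  exists (a, k); last first.
    by move=> i /=; rewrite in_itv/= -ltr_distl.
  move=> x bx; apply: eU; rewrite -ball_normE /=; apply: norm_lt_coord => // i.
  have := bx i; rewrite /= in_itv/= -ltr_distl => h; rewrite !mxE.
  rewrite (_ : _ - _ = (q ord0 i - ratr (a ord0 i)) - (x ord0 i - ratr (a ord0 i))).
    apply: le_lt_trans (ler_normB _ _) _.
    by have := ltrD (lt_trans (aP i) ke) (lt_trans h ke); rewrite -splitr.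
  by ring.
apply: countable_bigcupT_measurable => [|p]; first exact: countableP.
case: ifPn => // _; apply: (@measurable_rV_rect _ (fun i =>
  `](ratr (p.1 ord0 i) - p.2.+1%:R^-1), (ratr (p.1 ord0 i) + p.2.+1%:R^-1)[%classic)).
by move=> i; exact: measurable_itv.
Qed.

Lemma measurable_rV_continuous n (h : 'rV[R]_n -> R) : continuous h ->
  measurable_fun setT h.
Proof.
move=> /continuousP ch; apply: (measurability _ (RGenOpens.measurableE R)).
move=> _ [_ [a [b ->] <-]]; rewrite setTI; apply: measurable_rV_open.
exact/ch/interval_open.
Qed.

(** Vanishing already on the faces of the cube makes the boundary terms of integrations by parts
    zero, and the condition passes to slices with one coordinate frozen. *)
Definition box_supported n (B : R) (h : 'rV[R]_n -> R) :=
  forall (q : 'rV[R]_n) i, B <= `|q ord0 i| -> h q = 0.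

Lemma measurable_cube n (B : R) : measurable (cube n B).
Proof.
have := measurableC (measurable_rV_open (closed_openC (@closed_cube R n B))).
by rewrite setCK.
Qed.

Lemma lebesgue_cube n (B : R) : (lebesgue_rV (cube n B) < +oo)%E.
Proof.
rewrite (_ : cube n B = [set q | forall i, `[(- B), B]%classic (q ord0 i)]).
  rewrite (@lebesgue_rV_box R n (fun=> `[(- B), B]%classic)) => [|i]; last exact: measurable_itv.
  rewrite ltey_eq; apply/orP; left; apply: (big_ind (fun x => x \is a fin_num)) => //.
    by move=> x y xf yf; rewrite fin_numM.
  by move=> i _; rewrite lebesgue_measure_itv/=; case: ifP.
by apply/seteqP; split => q h i; have := h i; rewrite /= in_itv/= ler_norml.
Qed.

Lemma box_supported_integrable n B (h : 'rV[R]_n -> R) : continuous h ->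
  box_supported B h -> lebesgue_rV.-integrable setT (EFin \o h).
Proof.
move=> ch sh.
have -> : EFin \o h = (EFin \o h) \_ (cube n B).
  apply/funext => q; rewrite patchE; case: ifPn => // /negP hq /=.
  have [[i hi]|ni] := pselect (exists i, B <= `|q ord0 i|); first by rewrite (sh _ _ hi).
  exfalso; apply: hq; rewrite inE => i.
  by rewrite leNgt; apply/negP => /ltW Bi; apply: ni; exists i.
apply: (integrable_mkcond _ (@measurable_cube n B)).1.
apply: measurable_bounded_integrable.
- exact: measurable_cube.
- exact: lebesgue_cube.
- by apply: measurable_funTS; exact: measurable_rV_continuous.
- have ck : compact (h @` cube n B).
    apply: continuous_compact; last exact: compact_cube.
    exact: continuous_subspaceT.
  have [M [Mr HM]] := compact_bounded ck.
  by exists M; split => // x Mx q Bq; apply: (HM x Mx); exists q.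
Qed.

(** By continuity [h] stays above half of [h q0] on an open box around [q0], whose positive measure
    is given by [lebesgue_rV_box]. *)
Lemma integral_gt0 n B (h : 'rV[R]_n -> R) q0 : continuous h ->
  box_supported B h -> (forall q, 0 <= h q) -> 0 < h q0 ->
  0 < \int[lebesgue_rV]_q h q.
Proof.
move=> ch sh h0 hq0.
have ih := box_supported_integrable ch sh.
have : \forall q \near q0, h q0 / 2 < h q.
  by apply: (cvgr_gt _ (ch q0)); rewrite ltr_pdivrMr// ltr_pMr// ltr1n.
move=> /nbhs_ballP[e /= e0 He].
pose A := [set q : 'rV[R]_n | forall i, `](q0 ord0 i - e), (q0 ord0 i + e)[%classic (q ord0 i)].
have mA : measurable A.
  apply: (@measurable_rV_rect _ (fun i => `](q0 ord0 i - e), (q0 ord0 i + e)[%classic)).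
  by move=> i; exact: measurable_itv.
have muA : lebesgue_rV A = ((e + e) ^+ n)%:E.
  rewrite (@lebesgue_rV_box R n (fun i => `](q0 ord0 i - e), (q0 ord0 i + e)[%classic)); last first.
    by move=> i; exact: measurable_itv.
  rewrite -[n in RHS]card_ord -prodr_const -prodEFin; apply: eq_bigr => i _.
  rewrite lebesgue_measure_itv/= lte_fin ltrBlDr -addrA ltrDl addr_gt0// -EFinB.
  by congr EFin; ring.
have hA q : A q -> h q0 / 2 <= h q.
  move=> Aq; apply/ltW/He; rewrite -ball_normE /=; apply: norm_lt_coord => // i.
  by have := Aq i; rewrite /= in_itv/= -ltr_distl !mxE distrC.
rewrite -lte_fin fineK; last exact: integrable_fin_num.
apply: (@lt_le_trans _ _ ((h q0 / 2)%:E * lebesgue_rV A)%E).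
  by rewrite muA -EFinM lte_fin mulr_gt0// ?divr_gt0// exprn_gt0// addr_gt0.
rewrite -integral_cst//.
apply: (@le_trans _ _ (\int[lebesgue_rV]_(q in A) (h q)%:E)%E).
  apply: ge0_le_integral => //.
  - by move=> q ?; rewrite lee_fin divr_ge0// ltW.
  - by apply/measurable_EFinP; apply: measurable_funTS; exact: measurable_rV_continuous.
apply: ge0_subset_integral => //.
  by apply/measurable_EFinP; exact: measurable_rV_continuous.
by move=> q ?; rewrite lee_fin.
Qed.

(** The difference quotients of [h \o g] along [v] are literally those of [h] along [w]. It serves
    for slices [rV_cons], for changes [upd] of one coordinate and for straight lines. *)
Lemma derivable_comp_affine (V W : normedModType R) (g : V -> W) (h : W -> R) (a v : V)
    (w : W) : (forall t : R, g (t *: v + a) = t *: w + g a) ->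
  derivable h (g a) w -> is_derive a v (h \o g) ('D_w h (g a)).
Proof.
move=> E dh; have X : (fun t : R => t^-1 *: ((h \o g \o shift a) (t *: v) - (h \o g) a)) =
  (fun t : R => t^-1 *: ((h \o shift (g a)) (t *: w) - h (g a))).
  by apply/funext => t /=; rewrite E.
by split; rewrite ?/derivable ?/derive X.
Qed.

(** Induction on the dimension with Fubini. A derivative in a later coordinate is treated slice by
    slice by the induction hypothesis; one in the first coordinate is integrated along lines, where
    the fundamental theorem leaves only boundary values, which vanish. *)
Lemma integral_partial_eq0 n (k : 'I_n) B (h : 'rV[R]_n -> R) :
  (forall q, derivable h q (delta_mx ord0 k)) -> continuous h ->
  continuous (partial k h) -> box_supported B h -> box_supported B (partial k h) ->
  (\int[lebesgue_rV]_q (partial k h q)%:E = 0)%E.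
Proof.
elim: n k h => [|n IH] k h dh ch cdh sh sdh; first by case: k dh cdh sdh => -[].
have cons_x (y : 'rV[R]_n) (x : R) : rV_cons (x, y) ord0 ord0 = x :> R.
  by rewrite mxE unlift_none.
have cons_y y (x : R) (j : 'I_n) : rV_cons (x, y) ord0 (lift ord0 j) = y ord0 j :> R.
  by rewrite mxE liftK.
have cc1 (y : 'rV[R]_n) : continuous (fun x : R => rV_cons (x, y)).
  move=> x; apply: continuous_rV => i; case: (unliftP ord0 i) => [j|] ->.
    by rewrite (funext (cons_y y ^~ j)) cons_y; exact: cvg_cst.
  by rewrite (funext (cons_x y)) cons_x; exact: cvg_id.
have cc2 (x : R) : continuous (fun y : 'rV[R]_n => rV_cons (x, y)).
  move=> y; apply: continuous_rV => i; case: (unliftP ord0 i) => [j|] ->.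
    rewrite (funext (fun y => cons_y y x j)) cons_y.
    exact: continuous_rV_coord.
  by rewrite (funext (cons_x ^~ x)) cons_x; exact: (@cst_continuous _ _ x y).
have ig := box_supported_integrable cdh sdh.
pose f := EFin \o partial k h.
have mf : measurable_fun setT f.
  by apply/measurable_EFinP; exact: measurable_rV_continuous.
pose P := (@lebesgue_measure R \x @lebesgue_rV R n)%E.
have intf : P.-integrable setT (f \o @rV_cons R n).
  apply/integrableP; split.
    exact: (measurableT_comp mf (@measurable_rV_cons R n)).
  have /integrableP[_] := ig; apply: le_lt_trans.
  rewrite [leRHS](ge0_integral_pushforward (@measurable_rV_cons R n))//.
  exact: measurableT_comp.
rewrite [LHS](integral_pushforward (@measurable_rV_cons R n) mf intf measurableT).
rewrite preimage_setT.
case: (unliftP ord0 k) => [j|] kE.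
  rewrite -(integral12_prod_meas1 intf); apply: integral0_eq => x _.
  have dE y : is_derive y (delta_mx ord0 j) (h \o (fun y => rV_cons (x, y)))
      (partial k h (rV_cons (x, y))).
    apply: derivable_comp_affine => [t|]; last exact: dh.
    apply/rowP => i; rewrite !mxE kE /=; case: (unliftP ord0 i) => [i'|] -> /=.
      by rewrite !mxE (inj_eq (@lift_inj _ _)).
    by rewrite mulr0 add0r.
  have E : partial j (h \o (fun y => rV_cons (x, y))) =
           partial k h \o (fun y => rV_cons (x, y)).
    by apply/funext => y; case: (dE y).
  rewrite /fubini_F -[RHS](IH j (h \o (fun y => rV_cons (x, y)))).
  - by rewrite E.
  - by move=> y; case: (dE y).
  - by move=> y; exact: (continuous_comp (cc2 x y) (ch _)).
  - by rewrite E => y; exact: (continuous_comp (cc2 x y) (cdh _)).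
  - by move=> y i By; apply: (sh _ (lift ord0 i)); rewrite cons_y.
  - by rewrite E => y i By; apply: (sdh _ (lift ord0 i)); rewrite cons_y.
rewrite -(integral21_prod_meas1 intf); apply: integral0_eq => y _.
have dE (x : R) : is_derive x (1:R) (h \o (fun x => rV_cons (x, y)))
    (partial k h (rV_cons (x, y))).
  apply: derivable_comp_affine => [t|]; last exact: dh.
  apply/rowP => i; rewrite !mxE kE /=; case: (unliftP ord0 i) => [i'|] -> /=.
    by rewrite mulr0 add0r.
  by [].
set g := h \o (fun x => rV_cons (x, y)).
have E : derive1 g = partial k h \o (fun x => rV_cons (x, y)).
  by apply/funext => x; rewrite derive1E; case: (dE x).
(* The maximum with 1 keeps the interval of integration nondegenerate when [B] is not positive. *)
pose M := Num.max B 1.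
have MM : - M < M by rewrite gtrN// lt_max ltr01 orbT.
have g0 x : M <= `|x| -> g x = 0 /\ derive1 g x = 0.
  move=> Mx; rewrite E /=; split; [apply: (sh _ ord0)|apply: (sdh _ ord0)];
    by rewrite cons_x (le_trans _ Mx)// le_max lexx.
have cg' : continuous (derive1 g).
  by rewrite E => x; exact: (continuous_comp (cc1 y x) (cdh _)).
have cg : continuous g by move=> x; exact: (continuous_comp (cc1 y x) (ch _)).
rewrite /fubini_G (_ : (fun x => _) = (EFin \o derive1 g) \_ `[(- M), M]); last first.
  apply/funext => x; rewrite patchE; case: ifPn => [_|/negP nx]; first by rewrite /= E.
  rewrite /f /= -[partial k h _]/((partial k h \o (fun x => rV_cons (x, y))) x) -E.
  rewrite (g0 x _).2//; rewrite leNgt; apply/negP => xM; apply: nx.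
  by rewrite inE /= in_itv/= -ler_norml ltW.
rewrite -integral_mkcond (@continuous_FTC2 R (derive1 g) g)//.
- rewrite (g0 M _).1 ?(g0 (- M) _).1 ?subee//; first by rewrite normrN ler_norm.
  by rewrite ler_norm.
- exact: continuous_subspaceT.
- split => [x _||]; first by case: (dE x).
  - by apply: cvg_at_right_filter; exact: cg.
  - by apply: cvg_at_left_filter; exact: cg.
Qed.

End rV_measure.

(** * Smooth functions *)

Section smooth.
Context {R : realType} {n : nat}.
Implicit Types (h : 'rV[R]_n -> R).

Lemma CkS k h : Ck k.+1 h -> Ck k h.
Proof.
elim: k h => [|k IH] h /= [dh ch]; first by move=> q; exact: differentiable_continuous.
by split => // i; exact: IH.
Qed.

Lemma Ck_cst k c : Ck k (fun _ : 'rV[R]_n => c).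
Proof.
elim: k c => [|k IH] c /=; first exact: cst_continuous.
split=> [q|i]; first exact: differentiable_cst.
by rewrite (funext (partial_cst i c)); exact: IH.
Qed.

Lemma Ck_coord k j : Ck k (fun q : 'rV[R]_n => q ord0 j).
Proof.
case: k => [|k] /=; first exact: continuous_rV_coord.
split=> [q|i]; first exact: differentiable_coordinate.
by rewrite (funext (partial_coord i j)); exact: Ck_cst.
Qed.

Lemma CkD k h1 h2 : Ck k h1 -> Ck k h2 -> Ck k (fun q => h1 q + h2 q).
Proof.
elim: k h1 h2 => [|k IH] h1 h2 /=; first by move=> c1 c2 q; exact: (cvgD (c1 q) (c2 q)).
move=> [d1 c1] [d2 c2]; split=> [q|i]; first exact: (differentiableD (d1 q) (d2 q)).
by rewrite (funext (fun q => partialD i (d1 q) (d2 q))); exact: IH.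
Qed.

Lemma CkM k h1 h2 : Ck k h1 -> Ck k h2 -> Ck k (fun q => h1 q * h2 q).
Proof.
elim: k h1 h2 => [|k IH] h1 h2; first by move=> c1 c2 q; exact: (cvgM (c1 q) (c2 q)).
move=> C1 C2; have [d1 c1] := C1; have [d2 c2] := C2.
split=> [q|i]; first exact: (differentiableM (d1 q) (d2 q)).
rewrite (funext (fun q => partialM i (d1 q) (d2 q))).
exact: (CkD (IH _ _ (CkS C1) (c2 i)) (IH _ _ (CkS C2) (c1 i))).
Qed.

Lemma Ck_prod k (I : Type) (r : seq I) (h : I -> 'rV[R]_n -> R) :
  (forall j, Ck k (h j)) -> Ck k (fun q => \prod_(j <- r) h j q).
Proof.
move=> Ch; elim: r => [|j r IH].
  by under eq_fun do rewrite big_nil; exact: Ck_cst.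
by under eq_fun do rewrite big_cons; exact: CkM.
Qed.

End smooth.

Section flat.
Context {R : realType}.
Implicit Types p : {poly R}.

(** The function $p(1/x)e^{-1/x}$ extended by zero. The whole family is introduced, and not only
    [p = 1], because it is stable under differentiation, which makes smoothness an induction. *)
Definition flat p (x : R) : R := if 0 < x then p.[x^-1] * expR (- x^-1) else 0.

(** Raising $1+z\le e^z$ with $z=y/(d+1)$ to the power $d+1$ gives $e^{-y}\le((d+1)/y)^{d+1}$, one
    power of $y$ better than the growth of [p]; here $y=1/x$. *)
Lemma flat_bound p : exists2 C, 0 <= C & forall x, 0 < x <= 1 -> `|flat p x| <= C * x.
Proof.
pose d := size p.
exists ((\sum_(i < size p) `|p`_i|) * (d.+1%:R ^+ d.+1)).
  by rewrite mulr_ge0// ?exprn_ge0// sumr_ge0.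
move=> x /andP[x0 x1]; rewrite /flat x0; set y := x^-1.
have y1 : 1 <= y by rewrite invf_ge1.
have y0 : 0 < y by rewrite invr_gt0.
have E : expR (- y) <= (d.+1%:R / y) ^+ d.+1.
  pose z := y / d.+1%:R; have z0 : 0 < z by rewrite divr_gt0.
  have -> : - y = - z * d.+1%:R by rewrite mulNr divfK.
  rewrite expRM_natr; apply: lerXn2r; rewrite ?nnegrE ?expR_ge0 ?divr_ge0 ?(ltW y0)//.
  rewrite expRN -[d.+1%:R / y]invf_div lef_pV2 ?posrE ?expR_gt0//.
  by apply: le_trans (expR_ge1Dx z); rewrite lerDr.
have F : `|p.[y]| <= (\sum_(i < size p) `|p`_i|) * y ^+ d.
  rewrite horner_coef (le_trans (ler_norm_sum _ _ _))// mulr_suml ler_sum// => i _.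
  rewrite normrM ler_wpM2l// normrX gtr0_norm//.
  by rewrite ler_weXn2l// ltnW.
rewrite normrM (gtr0_norm (expR_gt0 _)).
apply: le_trans (ler_pM _ _ F E) _; rewrite ?expR_ge0//.
rewrite expr_div_n -mulrA -[leRHS]mulrA ler_wpM2l ?sumr_ge0//.
rewrite mulrCA ler_wpM2l ?exprn_ge0// exprS invfM mulrCA mulfV ?mulr1.
  by rewrite /y invrK.
by rewrite expf_neq0// gt_eqF.
Qed.

(** For $x>0$ the derivative is $(p-p')(1/x)\,x^{-2}e^{-1/x}$. At 0 the right difference quotient
    belongs to the family again, with [p * 'X] in place of [p], and [flat_bound] sends it to 0. *)
Lemma is_derive_flat p (x : R) : is_derive x 1 (flat p) (flat ('X^2 * (p - p^`())) x).
Proof.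
have [x0|x0|x0] := ltgtP x 0.
- have -> : flat ('X^2 * (p - p^`())) x = 0 by rewrite /flat ifF// ltNge ltW.
  apply: (near_eq_is_derive (f := cst (0 : R))).
  near=> y; rewrite /flat ifF//; apply/negbTE; rewrite -leNgt ltW//.
  by near: y; exact: lt_nbhsl.
- have -> : flat ('X^2 * (p - p^`())) x = ('X^2 * (p - p^`())).[x^-1] * expR (- x^-1).
    by rewrite /flat x0.
  have dV := is_derive_inv (lt0r_neq0 x0).
  have d1 : is_derive x 1 (horner p \o (fun y : R => y^-1)) ((p^`()).[x^-1] * - x ^- 2).
    have dh : is_derive x^-1 1 (horner p) (p^`()).[x^-1].
      by split; [exact: derivable_horner|rewrite -derive1E -derivE].
    exact: is_derive1_comp dh dV.
  have d2 : is_derive x 1 (expR \o (fun y : R => - y^-1)) (expR (- x^-1) * (- - x ^- 2)).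
    exact: is_derive1_comp (is_derive_expR _) (is_deriveN dV).
  apply: (near_eq_is_derive _ (is_derive_eq (is_deriveM d1 d2) _)).
    near=> y; rewrite /flat ifT//.
    by near: y; exact: lt_nbhsr.
  rewrite /= !hornerE /= -exprVn /GRing.scale /=.
  by ring.
- have flat0 q : flat q 0 = 0 by rewrite /flat ltxx.
  rewrite x0 flat0.
  have H : (fun h : R => h^-1 *: ((flat p \o shift 0) (h *: (1 : R)) - flat p 0)) @ 0^' --> (0 : R).
    have [C C0 Cb] := flat_bound (p * 'X).
    apply/cvgr0Pnorm_le => e e0; near=> h.
    rewrite flat0 subr0 /= addr0 /GRing.scale /= mulr1.
    have [h0|h0] := leP h 0; first by rewrite /flat ifF ?mulr0 ?normr0 ?ltW// ltNge h0.
    have -> : h^-1 * flat p h = flat (p * 'X) h by rewrite /flat h0 hornerMX; ring.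
    have hh : `|h| < Num.min 1 (e / (C + 1)).
      by near: h; apply: dnbhs0_lt; rewrite lt_min ltr01 divr_gt0// (ltr_pwDr ltr01 C0).
    move: hh; rewrite gtr0_norm// lt_min => /andP[h1 he].
    apply: le_trans (Cb h _) _; first by rewrite h0 ltW.
    rewrite ltr_pdivlMr ?(ltr_pwDr ltr01 C0)// in he.
    by apply: le_trans (ltW he); rewrite mulrC ler_pM2l// lerDl.
  by split; [apply/cvg_ex; exists 0|exact: cvg_lim H].
Unshelve. all: by end_near. Qed.

End flat.

Section bump.
Context {R : realType} {n : nat}.

Lemma Ck_flat k (p : {poly R}) (a s : R) (i : 'I_n) :
  Ck k (fun q : 'rV[R]_n => flat p (a + s * q ord0 i)).
Proof.
have dl : forall q, differentiable (fun q : 'rV[R]_n => a + s * q ord0 i) q.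
  move=> q; apply: (differentiableD (differentiable_cst a q)).
  exact: (differentiableM (differentiable_cst s q) (differentiable_coordinate i q)).
have df q : differentiable (fun q : 'rV[R]_n => flat p (a + s * q ord0 i)) q.
  apply: (differentiable_comp (dl q)).
  by apply/derivable1_diffP; case: (is_derive_flat p (a + s * q ord0 i)).
elim: k p df => [|k IH] p df /=; first by move=> q; exact/differentiable_continuous.
split=> // j.
have -> : partial j (fun q : 'rV[R]_n => flat p (a + s * q ord0 i)) =
    (fun q => (s * (j == i)%:R) * flat ('X^2 * (p - p^`())) (a + s * q ord0 i)).
  apply/funext => q; have [d1 d2] := is_derive_flat p (a + s * q ord0 i).
  rewrite (partial_comp _ d1 (dl q)) derive1E d2 mulrC; congr (_ * _).
  rewrite (partialD _ (differentiable_cst a q)); last first.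
    exact: (differentiableM (differentiable_cst s q) (differentiable_coordinate i q)).
  rewrite partialM//; last exact: differentiable_coordinate.
  by rewrite !partial_cst partial_coord mulr0 addr0 add0r.
apply: CkM; first exact: Ck_cst.
apply: IH => q; apply: (differentiable_comp (dl q)).
by apply/derivable1_diffP; case: (is_derive_flat ('X^2 * (p - p^`())) (a + s * q ord0 i)).
Qed.

Definition bump (B : R) (q : 'rV[R]_n) : R :=
  \prod_(i < n) (flat 1 (B + q ord0 i) * flat 1 (B - q ord0 i)).

Lemma Ck_bump k B : Ck k (bump B).
Proof.
apply: Ck_prod => i; apply: CkM.
  rewrite (_ : (fun q : 'rV[R]_n => _) = fun q : 'rV[R]_n => flat 1 (B + 1 * q ord0 i)).
    exact: Ck_flat.
  by apply/funext => q; rewrite mul1r.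
rewrite (_ : (fun q : 'rV[R]_n => _) = fun q : 'rV[R]_n => flat 1 (B + -1 * q ord0 i)).
  exact: Ck_flat.
by apply/funext => q; rewrite mulN1r.
Qed.

Lemma flat1_ge0 (x : R) : 0 <= flat 1 x.
Proof. by rewrite /flat; case: ifP => // _; rewrite hornerC mul1r expR_ge0. Qed.

Lemma bump_ge0 B q : 0 <= bump B q.
Proof. by apply: prodr_ge0 => i _; rewrite mulr_ge0// flat1_ge0. Qed.

Lemma bump_gt0 B (q : 'rV[R]_n) : (forall i, `|q ord0 i| < B) -> 0 < bump B q.
Proof.
move=> h; apply: prodr_gt0 => i _; have := h i; rewrite ltr_norml => /andP[h1 h2].
rewrite /flat ifT; last by rewrite -ltrBlDl sub0r.
by rewrite ifT ?subr_gt0// !hornerC !mul1r mulr_gt0// expR_gt0.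
Qed.

Lemma bump_eq0 B (q : 'rV[R]_n) i : B <= `|q ord0 i| -> bump B q = 0.
Proof.
move=> h; rewrite /bump (bigD1 i)//=.
suff -> : flat 1 (B + q ord0 i) * flat 1 (B - q ord0 i) = 0 by rewrite mul0r.
have [q0|q0] := leP 0 (q ord0 i).
  by rewrite [flat 1 (B - _)]/flat ifF ?mulr0// subr_gt0 ltNge -(ger0_norm q0) h.
rewrite [flat 1 (B + _)]/flat ifF ?mul0r//; apply/negbTE.
by rewrite -leNgt -lerBrDr sub0r -(ltr0_norm q0).
Qed.

End bump.

(** * Bernstein polynomials in one variable *)

Section de_casteljau.
Context {R : realType}.
Implicit Types (a b : nat -> R).

(* The Bernstein polynomial \sum_k a_k 'C(N, k) x^k (1 - x)^(N - k), by de
   Casteljau's recursion, which makes each of its properties an easy induction. *)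
Fixpoint dc (N : nat) a (x : R) : R :=
  if N is N'.+1 then x * dc N' (fun k => a k.+1) x + (1 - x) * dc N' a x else a 0%N.

Lemma dcD N a b x : dc N (fun k => a k + b k) x = dc N a x + dc N b x.
Proof. by elim: N a b => [|N IH] a b //=; rewrite !IH; ring. Qed.

Lemma dcZ N c a x : dc N (fun k => c * a k) x = c * dc N a x.
Proof. by elim: N a => [|N IH] a //=; rewrite !IH; ring. Qed.

Lemma dcB N a b x : dc N (fun k => a k - b k) x = dc N a x - dc N b x.
Proof. by elim: N a b => [|N IH] a b //=; rewrite !IH; ring. Qed.

Lemma dc_cst N c x : dc N (fun=> c) x = c.
Proof. by elim: N => [|N IH] //=; rewrite !IH; ring. Qed.

Lemma dc_le N a b x : 0 <= x <= 1 -> (forall k, (k <= N)%N -> a k <= b k) ->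
  dc N a x <= dc N b x.
Proof.
move=> /andP[x0 x1]; elim: N a b => [|N IH] a b ab /=; first exact: ab.
rewrite lerD// ler_wpM2l ?subr_ge0//; apply: IH => k kN; apply: ab => //.
exact: leqW.
Qed.

(** [dc N a x] is the mean of [a] under the binomial law with parameters [N] and [x], and this is
    its second moment about [c]: squared bias plus variance. *)
Lemma dc_variance N c x :
  dc N (fun k => (k%:R - c) ^+ 2) x = (N%:R * x - c) ^+ 2 + N%:R * x * (1 - x).
Proof.
elim: N c => [|N IH] c /=; first by ring.
rewrite (_ : (fun k : nat => _) = fun k : nat => (k%:R - (c - 1)) ^+ 2).
  by rewrite !IH -[N.+1]addn1 natrD; ring.
by apply/funext => k; rewrite -[k.+1]addn1 natrD; congr (_ ^+ 2); ring.
Qed.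

(** The inductive step of the derivative formula [partial_dc]. For [N = 0] the truncated [N.-1] is
    multiplied by 0. *)
Lemma dc_diff_rec N a x :
  x * (N%:R * dc N.-1 (fun k => a k.+2 - a k.+1) x) + dc N (fun k => a k.+1) x +
  ((1 - x) * (N%:R * dc N.-1 (fun k => a k.+1 - a k) x) - dc N a x) =
  N.+1%:R * dc N (fun k => a k.+1 - a k) x.
Proof.
have D := dcB N (fun k => a k.+1) a x.
case: N D => [|N] D; first by rewrite /=; ring.
transitivity (N.+1%:R * dc N.+1 (fun k => a k.+1 - a k) x +
  dc N.+1 (fun k => a k.+1 - a k) x); last by rewrite /= -!natr1; ring.
by rewrite {2}D /=; ring.
Qed.

(** Chebyshev's argument: for every $k$ the distance of $a_k$ to $v$ is at most
    $e+M((k-Nx)/(dN))^2$, and the mean of $(k-Nx)^2$ is $Nx(1-x)\le N$. *)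
Lemma dc_approx N a x v e M d : (0 < N)%N -> 0 <= x <= 1 -> 0 <= M -> 0 < d -> 0 <= e ->
  (forall k, (k <= N)%N -> `|k%:R / N%:R - x| < d -> `|a k - v| <= e) ->
  (forall k, (k <= N)%N -> `|a k - v| <= M) ->
  `|dc N a x - v| <= e + M / (d ^+ 2 * N%:R).
Proof.
move=> N0 x01 M0 d0 e0 h1 h2.
have N0' : 0 < N%:R :> R by rewrite ltr0n.
pose w k : R := e + M / (d * N%:R) ^+ 2 * (k%:R - N%:R * x) ^+ 2.
have aw k : (k <= N)%N -> `|a k - v| <= w k.
  move=> kN; have [h|h] := ltP `|k%:R / N%:R - x| d.
    by rewrite (le_trans (h1 k kN h))// lerDl mulr_ge0 ?sqr_ge0// divr_ge0// sqr_ge0.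
  rewrite (le_trans (h2 k kN))// /w -[leLHS]add0r lerD// mulrAC ler_pdivlMr ?exprn_gt0 ?mulr_gt0//.
  rewrite ler_wpM2l// -[leRHS]real_normK ?num_real//; apply: lerXn2r.
  - by rewrite nnegrE mulr_ge0 ?(ltW d0) ?(ltW N0').
  - by rewrite nnegrE.
  have -> : k%:R - N%:R * x = (k%:R / N%:R - x) * N%:R.
    by rewrite mulrBl divfK ?gt_eqF// mulrC.
  by rewrite normrM (gtr0_norm N0') ler_pM2r.
have W : dc N w x <= e + M / (d ^+ 2 * N%:R).
  rewrite /w dcD dc_cst dcZ dc_variance subrr expr0n add0r lerD2l.
  have -> : M / (d * N%:R) ^+ 2 * (N%:R * x * (1 - x)) = M / (d ^+ 2 * N%:R) * (x * (1 - x)).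
    by field; rewrite !gt_eqF.
  apply: ler_piMr; first by rewrite divr_ge0// mulr_ge0// sqr_ge0.
  by case/andP: x01 => x0 x1; rewrite mulr_ile1// ?subr_ge0// lerBlDr lerDl.
have E : dc N a x - v = dc N (fun k => a k - v) x by rewrite dcB dc_cst.
rewrite E ler_norml; apply/andP; split.
  rewrite lerNl (le_trans _ W)// -mulN1r -dcZ; apply: dc_le => // k kN.
  by rewrite mulN1r (le_trans _ (aw k kN))// -normrN ler_norm.
rewrite (le_trans _ W)//; apply: dc_le => // k kN.
by rewrite (le_trans _ (aw k kN))// ler_norm.
Qed.

End de_casteljau.

(** * Bernstein approximation of C^1 functions *)

(** Heine-Cantor with only one of the two points in [A]: near each point of [A] half of a local
    radius works, and compactness turns the local moduli into a single [d]. *)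
Lemma compact_uniform_modulus (R : realType) (V : normedModType R) (A : set V) (g : V -> R) e :
  compact A -> continuous g -> 0 < e ->
  exists2 d, 0 < d & forall x y, A x -> `|x - y| < d -> `|g x - g y| <= e.
Proof.
move=> cA cg e0.
have /compact_near_coveringP/(_ R (0^'+) (fun d x => forall y, `|x - y| < d -> `|g x - g y| <= e)) := cA.
have H : forall x, A x -> \forall x' \near x & d \near 0^'+,
    forall y, `|x' - y| < d -> `|g x' - g y| <= e.
  move=> x Ax.
  have : \forall y \near x, `|g x - g y| < e / 2.
    by have := cg x => /cvgrPdist_lt; apply; rewrite divr_gt0.
  move=> /nbhs_ballP[r /= r0 Hr].
  exists (ball x (r / 2), [set d | d < r / 2]).
    split; first by apply: nbhsx_ballx; rewrite divr_gt0.
    by apply: nbhs_right_lt; rewrite divr_gt0.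
  move=> [x' d] /= [xx' dr] y x'y.
  have h1 : `|g x - g x'| < e / 2.
    by apply: Hr; apply: le_ball xx'; rewrite ler_pdivrMr// ler_pMr// ler1n.
  have h2 : `|g x - g y| < e / 2.
    apply: Hr; rewrite -ball_normE /= (splitr r).
    rewrite -ball_normE /= in xx'.
    rewrite (_ : x - y = (x - x') + (x' - y)); last by rewrite addrA subrK.
    by rewrite (le_lt_trans (ler_normD _ _))// ltrD// (lt_trans x'y).
  rewrite (_ : g x' - g y = (g x - g y) - (g x - g x')); last by ring.
  by rewrite (le_trans (ler_normB _ _))// (splitr e) ltW// ltrD.
move=> /(_ _ H) nd.
near (0 : R)^'+ => d.
exists d => // x y Ax xy.
by apply: (near nd d) => //; near: d; exact: nd.
Unshelve. all: by end_near. Qed.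

Section bernstein.
Context {R : realType} {n : nat}.
Implicit Types (q : 'rV[R]_n) (g : 'rV[R]_n -> R) (i j : 'I_n).

Definition upd q i (c : R) : 'rV[R]_n := \row_j (if j == i then c else q ord0 j).

Lemma upd_affine i j c t q :
  upd (t *: delta_mx ord0 j + q) i c = t *: (if j == i then 0 else delta_mx ord0 j) + upd q i c.
Proof.
apply/rowP => k; rewrite !mxE; have [->|ki] := eqVneq k i.
  have [_|ji] := eqVneq j i; first by rewrite mxE mulr0 add0r.
  by rewrite mxE eqxx /= eq_sym (negbTE ji) mulr0 add0r.
by have [ji|ji] := eqVneq j i; rewrite !mxE ?ji /= ?(negbTE ki).
Qed.

Lemma upd_affine_pt i t c q :
  upd q i (t *: (1 : R) + c) = t *: delta_mx ord0 i + upd q i c.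
Proof.
apply/rowP => k; rewrite !mxE; have [_|ki] := eqVneq k i; first by [].
by rewrite mulr0 add0r.
Qed.

Lemma differentiable_upd i c q : differentiable (fun q => upd q i c) q.
Proof.
rewrite (_ : (fun q => _) = (fun q => q + (c - q ord0 i) *: delta_mx ord0 i)).
  apply: differentiableD => //; apply: differentiableZl.
  exact: (differentiableB (differentiable_cst c q) (differentiable_coordinate i q)).
apply/funext => x; apply/rowP => k; rewrite !mxE eqxx /=.
by have [->|ki] := eqVneq k i; rewrite ?mulr1 ?mulr0 ?addr0// addrC subrK.
Qed.

Lemma partial_upd i j c g q : (forall q, differentiable g q) ->
  partial j (fun q => g (upd q i c)) q = if j == i then 0 else partial j g (upd q i c).
Proof.
move=> dg.
have [_] := @derivable_comp_affine R _ _ (fun q => upd q i c) g q (delta_mx ord0 j)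
  (if j == i then 0 else delta_mx ord0 j) (fun t => upd_affine i j c t q)
  (diff_derivable (dg _)).
by rewrite /partial => ->; case: ifP => // _; rewrite derive0.
Qed.

Lemma C1on_upd i c g : C1on setT g -> C1on setT (fun q => g (upd q i c)).
Proof.
move=> C1 q _; have dg q' := (C1 q' Logic.I).1.
split; first exact: (differentiable_comp (differentiable_upd i c q) (dg _)).
move=> j; rewrite (funext (fun q => partial_upd i j c q dg)).
case: (j == i); first exact: cst_continuous.
apply: (continuous_comp (differentiable_continuous (differentiable_upd i c q))).
exact: (C1 _ Logic.I).2.
Qed.

Lemma C1on_dc N (a : nat -> 'rV[R]_n -> R) (L : 'rV[R]_n -> R) :
  (forall k, C1on setT (a k)) -> C1on setT L ->
  C1on setT (fun q => dc N (a^~ q) (L q)).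
Proof.
move=> + CL; elim: N a => [|N IH] a Ca /=; first exact: Ca.
exact: (C1on_D openT (C1on_M openT CL (IH (fun k => a k.+1) (fun k => Ca k.+1)))
  (C1on_M openT (C1on_B openT (C1on_cst (1 : R)) CL) (IH a Ca))).
Qed.

(** The derivative of a Bernstein polynomial of degree [N] is [N] times the one of degree [N - 1] on
    the differences of the coefficients; here the coefficients depend on [q] too, which adds the
    first term. *)
Lemma partial_dc N j (a : nat -> 'rV[R]_n -> R) (L : 'rV[R]_n -> R) q :
  (forall k, differentiable (a k) q) -> differentiable L q ->
  differentiable (fun q => dc N (a^~ q) (L q)) q /\
  partial j (fun q => dc N (a^~ q) (L q)) q =
    dc N (fun k => partial j (a k) q) (L q) +
    partial j L q * (N%:R * dc N.-1 (fun k => a k.+1 q - a k q) (L q)).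
Proof.
move=> + dL; elim: N a => [|N IH] a da; first by split=> //=; rewrite mul0r mulr0 addr0.
have [d1 e1] := IH (fun k => a k.+1) (fun k => da k.+1).
have [d2 e2] := IH a da.
have d3 : differentiable (fun q => 1 - L q) q by exact: (differentiableB (differentiable_cst (1 : R) q) dL).
split; first exact: (differentiableD (differentiableM dL d1) (differentiableM d3 d2)).
rewrite (partialD _ (differentiableM dL d1) (differentiableM d3 d2)).
rewrite (partialM _ dL d1) (partialM _ d3 d2) e1 e2.
rewrite (partialD _ (differentiable_cst (1 : R) q) (differentiableN dL)) partial_cst partialN//.
rewrite /= -(dc_diff_rec N (a^~ q)) /=; ring.
Qed.

Variable B : R.
Hypothesis B0 : 0 < B.

Definition node N k : R := - B + 2 * B * (k%:R / N%:R).
Definition lam i q : R := (q ord0 i + B) / (2 * B).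
(** The Bernstein operator in the coordinate [i] alone, the others being frozen. Iterating it over
    the coordinates gives approximation in several variables, each step being a one-variable
    argument. *)
Definition bern N i g q := dc N (fun k => g (upd q i (node N k))) (lam i q).

Lemma node_bound N k : (k <= N)%N -> `|node N k| <= B.
Proof.
move=> kN; rewrite /node; case: N kN => [|N] kN.
  by rewrite invr0 !mulr0 addr0 normrN gtr0_norm.
have h0 : 0 <= k%:R / N.+1%:R :> R by rewrite divr_ge0.
have h1 : k%:R / N.+1%:R <= 1 :> R by rewrite ler_pdivrMr// mul1r ler_nat.
move: h0 h1; set t := _ / _ => h0 h1.
have h2 := mulr_ge0 (ltW B0) h0; have h3 := ler_piMr (ltW B0) h1.
by rewrite ler_norml; apply/andP; split; lra.
Qed.

Lemma lam_bound i q : cube n B q -> 0 <= lam i q <= 1.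
Proof.
move=> /(_ i); rewrite ler_norml => /andP[h1 h2]; rewrite /lam.
by rewrite divr_ge0 ?ler_pdivrMr ?mulr_gt0 ?mul1r//=; lra.
Qed.

Lemma cube_upd q i c : cube n B q -> `|c| <= B -> cube n B (upd q i c).
Proof. by move=> cq cB j; rewrite mxE; case: ifP => // _; exact: cq. Qed.

Lemma node_lam N k i q : node N k - q ord0 i = 2 * B * (k%:R / N%:R - lam i q).
Proof. by rewrite /node /lam; set t := k%:R / N%:R; field; rewrite gt_eqF. Qed.

Lemma upd_dist q i c d : `|q ord0 i - c| < d -> `|q - upd q i c| < d.
Proof.
move=> h; have d0 : 0 < d by exact: (le_lt_trans (normr_ge0 _) h).
apply: norm_lt_coord => // j; rewrite !mxE; case: eqP => [->//|_].
by rewrite subrr normr0.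
Qed.

Lemma C1on_lam i : C1on setT (lam i).
Proof.
exact: (C1on_M openT (C1on_D openT (C1on_coord i) (C1on_cst B)) (C1on_cst _)).
Qed.

Lemma partial_lam i j q : partial j (lam i) q = (j == i)%:R / (2 * B).
Proof.
have d : differentiable (fun q : 'rV[R]_n => q ord0 i + B) q.
  exact: (differentiableD (differentiable_coordinate i q) (differentiable_cst B q)).
rewrite (partialM _ d (differentiable_cst _ q)) partial_cst mulr0 add0r.
rewrite (partialD _ (differentiable_coordinate i q) (differentiable_cst B q)).
by rewrite partial_coord partial_cst addr0 mulrC.
Qed.

Lemma C1on_bern N i g : C1on setT g -> C1on setT (bern N i g).
Proof.
move=> C1; apply: (@C1on_dc N (fun k q => g (upd q i (node N k)))).
  by move=> k; exact: C1on_upd.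
exact: C1on_lam.
Qed.

Lemma partial_bern N i j g q : C1on setT g ->
  partial j (bern N i g) q = if j == i
    then (2 * B)^-1 * (N%:R * dc N.-1 (fun k => g (upd q i (node N k.+1)) -
                                           g (upd q i (node N k))) (lam i q))
    else bern N i (partial j g) q.
Proof.
move=> C1; have dg q' := (C1 q' Logic.I).1.
have [_ ->] := @partial_dc N j (fun k q => g (upd q i (node N k))) (lam i) q
  (fun k => (@C1on_upd i (node N k) g C1 q Logic.I).1) (@C1on_lam i q Logic.I).1.
rewrite partial_lam; under [X in dc N X]funext do rewrite partial_upd//.
case: ifP => ji; first by rewrite dc_cst add0r mul1r.
by rewrite mul0r mul0r addr0.
Qed.

Lemma bern_ge0 N i g q : (forall q, cube n B q -> 0 <= g q) -> cube n B q ->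
  0 <= bern N i g q.
Proof.
move=> g0 cq; rewrite -(dc_cst N 0 (lam i q)); apply: dc_le; first exact: lam_bound.
by move=> k kN; apply: g0; apply: cube_upd => //; exact: node_bound.
Qed.

Lemma cube_bounded g : continuous g -> exists2 M, 0 < M & forall q, cube n B q -> `|g q| <= M.
Proof.
move=> cg; have ck : compact (g @` cube n B).
  apply: continuous_compact; last exact: compact_cube.
  exact: continuous_subspaceT.
have [M [Mr HM]] := compact_bounded ck.
exists (Num.max 1 (M + 1)); first by rewrite lt_max ltr01.
move=> q cq; apply: (HM (Num.max 1 (M + 1))); last by exists q.
by rewrite lt_max ltrDl ltr01 orbT.
Qed.

Lemma bern_cvg i g e : continuous g -> 0 < e ->
  \forall N \near \oo, forall q, cube n B q -> `|bern N i g q - g q| <= e.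
Proof.
move=> cg e0; have [M M0 HM] := cube_bounded cg.
have e20 : 0 < e / 2 by rewrite divr_gt0.
have [d d0 Hd] := compact_uniform_modulus (@compact_cube R n B) cg e20.
have B20 : 0 < 2 * B by rewrite mulr_gt0.
pose d' := d / (2 * B); have d'0 : 0 < d' by rewrite divr_gt0.
near=> N.
have N0 : (0 < N)%N by near: N; exact: nbhs_infty_gt.
move=> q cq.
have := @dc_approx R N (fun k => g (upd q i (node N k))) (lam i q) (g q) (e / 2) (M + M) d' N0
  (lam_bound i cq) _ d'0 (ltW e20) _ _.
have NN : (M + M) / (d' ^+ 2 * (e / 2)) < N%:R.
  by near: N; exact: nbhs_infty_gtr.
have -> : `|bern N i g q - g q| <= e = (`|bern N i g q - g q| <= e / 2 + e / 2) by rewrite -splitr.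
move=> H; apply: le_trans (H _ _ _) _.
- by rewrite addr_ge0// ltW.
- move=> k kN kd; rewrite distrC; apply: Hd => //; apply: upd_dist.
  rewrite distrC node_lam normrM (gtr0_norm B20) -ltr_pdivlMl// [_^-1 * d]mulrC.
  exact: kd.
- move=> k kN; rewrite (le_trans (ler_normB _ _))// lerD ?HM//.
  by apply: cube_upd => //; exact: node_bound.
rewrite lerD2l ler_pdivrMr; last by apply: mulr_gt0; [exact: exprn_gt0|rewrite ltr0n].
move: NN; rewrite ltr_pdivrMr; last by apply: mulr_gt0 => //; exact: exprn_gt0.
move=> /ltW /le_trans; apply.
by rewrite le_eqVlt; apply/orP; left; apply/eqP; ring.
Unshelve. all: by end_near. Qed.

(** By the mean value theorem the scaled differences of [g] at neighbouring nodes are values of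
    [partial i g] at intermediate points. The derivative is thus a Bernstein sum of degree [N - 1]
    for [partial i g], sampled slightly off its nodes. *)
Lemma bern_partial_cvg i g e : C1on setT g -> 0 < e ->
  \forall N \near \oo, forall q, cube n B q ->
    `|partial i (bern N i g) q - partial i g q| <= e.
Proof.
move=> C1 e0; have cdg : continuous (partial i g) by move=> q; exact: (C1 q Logic.I).2.
have [M M0 HM] := cube_bounded cdg.
have e20 : 0 < e / 2 by rewrite divr_gt0.
have [d d0 Hd] := compact_uniform_modulus (@compact_cube R n B) cdg e20.
have B20 : 0 < 2 * B by rewrite mulr_gt0.
(* Half of [d] is spent on the distance from a node of degree [N - 1] to [q], the other half on the
   spacing of the nodes of degree [N]. *)
pose d' := d / (2 * (2 * B)); have d'0 : 0 < d' by rewrite divr_gt0// mulr_gt0.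
near=> N.
have N2 : (2 <= N)%N by near: N; exact: nbhs_infty_ge.
have NN : (M + M) / (d' ^+ 2 * (e / 2)) + 1 < N%:R.
  by near: N; exact: nbhs_infty_gtr.
have ND : 2 * (2 * B) / d < N%:R by near: N; exact: nbhs_infty_gtr.
have NE : N = N.-1.+1 by rewrite prednK// (leq_trans _ N2).
move: N2 NN ND; rewrite NE; move: N.-1 => N' N2 NN ND.
have N0 : (0 < N')%N by [].
move=> q cq; rewrite partial_bern// eqxx /=.
pose a k := (2 * B)^-1 * N'.+1%:R * (g (upd q i (node N'.+1 k.+1)) - g (upd q i (node N'.+1 k))).
have -> : forall x, (2 * B)^-1 * (N'.+1%:R * dc N' (fun k => g (upd q i (node N'.+1 k.+1)) -
    g (upd q i (node N'.+1 k))) x) = dc N' a x by move=> x; rewrite mulrA -dcZ.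
have aE k : (k <= N')%N -> exists2 c, node N'.+1 k < c < node N'.+1 k.+1 &
    a k = partial i g (upd q i c).
  move=> kN; have lt : node N'.+1 k < node N'.+1 k.+1.
    by rewrite /node ltrD2l ltr_pM2l// ltr_pM2r ?invr_gt0 ?ltr0n// ltr_nat.
  have dv c : is_derive c (1 : R) (fun c : R => g (upd q i c)) (partial i g (upd q i c)).
    apply: (@derivable_comp_affine R _ _ (fun c : R => upd q i c) g c (1 : R) (delta_mx ord0 i)).
      by move=> t; exact: upd_affine_pt.
    exact: diff_derivable (C1 _ Logic.I).1.
  have [|c cin E] := @MVT R (fun c : R => g (upd q i c)) (fun c => partial i g (upd q i c)) _ _ lt.
    by apply: derivable_within_continuous => x _; have [] := dv x.
  exists c; first by move: cin; rewrite in_itv.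
  rewrite /a E /node [X in _ * _ * (_ * X)](_ : _ = 2 * B / N'.+1%:R).
    by field; rewrite nat1r pnatr_eq0 (gt_eqF B0).
  by rewrite -[k.+1]addn1 natrD; ring.
have := @dc_approx R N' a (lam i q) (partial i g q) (e / 2) (M + M) d' N0
  (lam_bound i cq) _ d'0 (ltW e20) _ _.
rewrite {3}(splitr e).
move=> H; apply: le_trans (H _ _ _) _.
- by rewrite addr_ge0// ltW.
- move=> k kN kd; have [c /andP[c1 c2] ->] := aE k kN.
  rewrite distrC; apply: Hd => //; apply: upd_dist.
  have N'0 : 0 < N'%:R :> R by rewrite ltr0n.
  have N1 : 0 < N'.+1%:R :> R by rewrite ltr0n.
  have kN' : k%:R <= N'%:R :> R by rewrite ler_nat.
  (* The node [k] of degree [N'] lies between the nodes [k] and [k + 1] of degree [N' + 1], as does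
     [c]; hence the two are at most one spacing apart. *)
  have lo : node N'.+1 k <= node N' k.
    rewrite /node lerD2l ler_pM2l// ler_wpM2l// lef_pV2 ?posrE// ler_nat.
    exact: leqnSn.
  have hi : node N' k <= node N'.+1 k.+1.
    rewrite /node lerD2l ler_pM2l// ler_pdivrMr// mulrAC ler_pdivlMr//.
    by rewrite -!natr1; lra.
  have wid : node N'.+1 k.+1 - node N'.+1 k = 2 * B / N'.+1%:R.
    by rewrite /node -[k.+1]addn1 natrD; ring.
  have w2 : 2 * B / N'.+1%:R < d / 2.
    rewrite ltr_pdivrMr//; move: ND; rewrite ltr_pdivrMr//.
    by set t := N'.+1%:R => ND; lra.
  have kl := node_lam N' k i q.
  have kl2 : `|node N' k - q ord0 i| < d / 2.
    rewrite kl normrM (gtr0_norm B20) -ltr_pdivlMl//.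
    rewrite [X in _ < X](_ : _ = d'); first exact: kd.
    by rewrite /d' !invfM; ring.
  rewrite -wid in w2; move: kl2 c1 c2 lo hi w2; rewrite !ltr_norml => /andP[].
  move: (node _ _) (node _ _) (node _ _) (q ord0 i) => x1 x2 x3 x4 *.
  by apply/andP; split; lra.
- move=> k kN; have [c /andP[c1 c2] ->] := aE k kN.
  rewrite (le_trans (ler_normB _ _))// lerD ?HM//; apply: cube_upd => //.
  have := @node_bound N'.+1 k (leqW kN); have := @node_bound N'.+1 k.+1 kN.
  by rewrite !ler_norml => /andP[h1 h2] /andP[h3 h4]; apply/andP; split; lra.
rewrite lerD2l ler_pdivrMr; last by apply: mulr_gt0; [exact: exprn_gt0|rewrite ltr0n].
have := NN; rewrite -[N'.+1%:R]natr1 ltrD2r ltr_pdivrMr; last by apply: mulr_gt0 => //; exact: exprn_gt0.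
move=> /ltW /le_trans; apply.
by rewrite le_eqVlt; apply/orP; left; apply/eqP; ring.
Unshelve. all: by end_near. Qed.

End bernstein.

Section density.
Context {R : realType} {n : nat}.
Implicit Types (q : 'rV[R]_n) (f g h : 'rV[R]_n -> R) (i j : 'I_n).

(* Functions that are polynomial in the coordinates of A, with coefficients
   depending arbitrarily on the other coordinates. *)
Inductive poly_in (A : {set 'I_n}) : ('rV[R]_n -> R) -> Prop :=
| poly_in_coef c : (forall q i x, i \in A -> c (upd q i x) = c q) -> poly_in A c
| poly_inD f g : poly_in A f -> poly_in A g -> poly_in A (fun q => f q + g q)
| poly_inZ (a : R) f : poly_in A f -> poly_in A (fun q => a * f q)
| poly_inX i f : i \in A -> poly_in A f -> poly_in A (fun q => q ord0 i * f q).

Lemma upd_upd q i x y : upd (upd q i x) i y = upd q i y.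
Proof. by apply/rowP => k; rewrite !mxE; case: eqP. Qed.

Lemma updC q i j x y : i != j -> upd (upd q i x) j y = upd (upd q j y) i x.
Proof.
move=> ij; apply/rowP => k; rewrite !mxE; case: eqP => // ->.
by rewrite eq_sym (negbTE ij).
Qed.

Lemma poly_in_upd A f i c : poly_in A f -> poly_in (i |: A) (fun q => f (upd q i c)).
Proof.
elim=> {f} [f hf|f g _ IHf _ IHg|a f _ IHf|j f jA _ IHf].
- apply: poly_in_coef => q j x; rewrite !inE.
  have [->|ji] := eqVneq j i; first by rewrite upd_upd.
  by move=> /= jA; rewrite updC// hf.
- exact: poly_inD.
- exact: poly_inZ.
- have [->|ji] := eqVneq j i.
    rewrite (_ : (fun q => _) = (fun q => c * f (upd q i c))); first exact: poly_inZ.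
    by apply/funext => q; rewrite mxE eqxx.
  rewrite (_ : (fun q => _) = (fun q => q ord0 j * f (upd q i c))).
    by apply: poly_inX => //; rewrite !inE jA orbT.
  by apply/funext => q; rewrite mxE (negbTE ji).
Qed.

Lemma poly_in_bern B A N i f : 0 < B -> poly_in A f -> poly_in (i |: A) (bern B N i f).
Proof.
move=> B0 pf.
suff H M (a : nat -> 'rV[R]_n -> R) : (forall k, poly_in (i |: A) (a k)) ->
    poly_in (i |: A) (fun q => dc M (a^~ q) (lam B i q)).
  by apply: (H N (fun k q => f (upd q i (node B N k)))) => k; exact: poly_in_upd.
elim: M a => [|M IH] a pa /=; first exact: pa.
pose X q := dc M (fun k => a k.+1 q) (lam B i q).
pose Y q := dc M (a^~ q) (lam B i q).
have pX : poly_in (i |: A) X by exact: (IH (fun k => a k.+1)).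
have pY : poly_in (i |: A) Y by exact: IH.
rewrite (_ : (fun q => _) = (fun q => ((2 * B)^-1 * (q ord0 i * X q) + 2^-1 * X q) +
   (2^-1 * Y q + - (2 * B)^-1 * (q ord0 i * Y q)))).
  have iA : i \in i |: A by rewrite !inE eqxx.
  exact: (poly_inD (poly_inD (poly_inZ _ (poly_inX iA pX)) (poly_inZ _ pX))
                   (poly_inD (poly_inZ _ pY) (poly_inZ _ (poly_inX iA pY)))).
apply/funext => q; rewrite -/(X q) -/(Y q) /lam.
by field; rewrite gt_eqF.
Qed.

(** Once all coordinates are in the set, a coefficient is unaffected by changing any of them;
    setting them to 0 one after the other shows that it is constant. *)
Lemma poly_in_Ck f k : poly_in [set: 'I_n]%SET f -> Ck k f.
Proof.
elim=> {f} [f hf|f g _ IHf _ IHg|a f _ IHf|j f jA _ IHf].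
- rewrite (_ : f = fun=> f 0); first exact: Ck_cst.
  apply/funext => q.
  have H (s : seq 'I_n) : f (\row_j (if j \in s then 0 else q ord0 j)) = f q.
    elim: s => [|i s IH]; first by congr (f _); apply/rowP => j; rewrite mxE.
    rewrite -IH -[RHS](hf _ i 0 (finset.in_setT i)); congr (f _); apply/rowP => j; rewrite !mxE inE.
    by case: eqP.
  by rewrite -(H (enum 'I_n)); congr (f _); apply/rowP => j; rewrite !mxE mem_enum.
- exact: (CkD IHf IHg).
- exact: (CkM (Ck_cst k a) IHf).
- exact: (CkM (Ck_coord k j) IHf).
Qed.

(** Induction over the coordinates, spending half of the error at each: [bern] preserves
    nonnegativity on the cube, commutes with the derivatives in the other coordinates, and keeps the
    polynomial dependence on the coordinates already treated. *)
Lemma C1_poly_approx B (s : seq 'I_n) g e : 0 < B -> C1on setT g ->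
  (forall q, cube n B q -> 0 <= g q) -> 0 < e ->
  exists P, [/\ C1on setT P, poly_in [set i in s]%SET P,
    forall q, cube n B q -> 0 <= P q &
    forall q, cube n B q -> `|P q - g q| <= e /\
      forall j, `|partial j P q - partial j g q| <= e].
Proof.
move=> B0 Cg g0; elim: s e => [|i s IH] e e0.
  exists g; split => //.
    by apply: poly_in_coef => q i x; rewrite inE.
  by move=> q _; split=> [|j]; rewrite subrr normr0 ltW.
have e20 : 0 < e / 2 by rewrite divr_gt0.
have [P [CP pP P0 Pg]] := IH _ e20.
have cP : continuous P by move=> q; exact: C1on_continuous CP Logic.I.
have n1 := bern_cvg B0 i cP e20.
have n2 : \forall N \near \oo, forall j q, cube n B q ->
    `|partial j (bern B N i P) q - partial j P q| <= e / 2.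
  apply: filter_forall => j; have [->|ji] := eqVneq j i.
    exact: bern_partial_cvg.
  have cdP : continuous (partial j P) by move=> q; exact: (CP q Logic.I).2.
  apply: filterS (bern_cvg B0 i cdP e20) => N HN q cq.
  by rewrite partial_bern// (negbTE ji); exact: HN.
near \oo => N.
exists (bern B N i P); split.
- exact: C1on_bern.
- by rewrite set_cons; exact: poly_in_bern.
- by move=> q; exact: bern_ge0.
move=> q cq; split=> [|j].
  rewrite (_ : _ - _ = (bern B N i P q - P q) + (P q - g q)); last by rewrite addrA subrK.
  rewrite (le_trans (ler_normD _ _))// (splitr e) lerD//; last exact: (Pg q cq).1.
  by move: q cq; near: N.
rewrite (_ : _ - _ = (partial j (bern B N i P) q - partial j P q) +
    (partial j P q - partial j g q)); last by rewrite addrA subrK.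
rewrite (le_trans (ler_normD _ _))// (splitr e) lerD//; last exact: (Pg q cq).2.
by move: j q cq; near: N.
Unshelve. all: by end_near. Qed.

Lemma box_supported_off_cube B h q : box_supported B h -> ~ cube n B q -> h q = 0.
Proof.
move=> sh nq; have [[i hi]|ni] := pselect (exists i, B <= `|q ord0 i|); first exact: sh hi.
exfalso; apply: nq => i; rewrite leNgt; apply/negP => /ltW Bi; apply: ni; by exists i.
Qed.

Lemma box_supported_partial B h j q : box_supported B h -> ~ cube n B q ->
  partial j h q = 0.
Proof.
move=> sh; apply: partial_eq0; first exact: closed_cube.
by move=> x; exact: box_supported_off_cube.
Qed.

Lemma box_supported_compact B h : box_supported B h -> compact (closure [set q | h q != 0]).
Proof.
move=> sh; apply: subclosed_compact (@compact_cube R n B) _; first exact: closed_closure.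
rewrite [X in _ `<=` X]((closure_id _).1 (@closed_cube R n B)).
apply: closureS => q /= /eqP hq.
by apply: contrapT => nq; apply: hq; exact: box_supported_off_cube nq.
Qed.

(** Multiplication by the bump [b] must not distort [g], so the polynomial approximates the quotient
    [g / b], which is C^1 because [b] is positive on the cube supporting [g]. The polynomial is
    nonnegative only on the larger cube, but [b] vanishes outside it. *)
Lemma test_approx B g e : 0 < B -> C1on setT g -> (forall q, 0 <= g q) ->
  box_supported B g -> 0 < e ->
  exists h, [/\ forall k, Ck k h, forall q, 0 <= h q, box_supported (B + 1) h &
    forall q, `|h q - g q| <= e /\ forall j, `|partial j h q - partial j g q| <= e].
Proof.
move=> B0 Cg g0 sg e0; have B10 : 0 < B + 1 by rewrite addr_gt0.
pose b : 'rV[R]_n -> R := bump (B + 1).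
have Cb : C1on setT b by apply/C1onTP; exact: Ck_bump.
have cb : continuous b by exact: (@Ck_bump R n 0).
pose O := [set q | 0 < b q].
have oO : open O by exact: open_superlevel.
have FO : cube n B `<=` O.
  by move=> q cq; apply: bump_gt0 => i; rewrite (le_lt_trans (cq i))// ltrDl.
pose k q := g q * (b q)^-1.
have k0 q : ~ cube n B q -> k q = 0.
  by move=> nq; rewrite /k (box_supported_off_cube sg nq) mul0r.
have Ck1 : C1on setT k.
  apply: (C1on_glue oO (@closed_cube R n B)) => //.
  exact: (C1on_M oO (C1on_subset (@subsetT _ _) Cg)
    (C1on_inv oO (C1on_subset (@subsetT _ _) Cb) (fun q Oq => Oq))).
have kge0 q : 0 <= k q by rewrite mulr_ge0// invr_ge0 bump_ge0.
have [M M0 HM] := cube_bounded (B + 1) cb.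
have /choice [M' HM'] : forall j, exists M', forall q, cube n (B + 1) q -> `|partial j b q| <= M'.
  move=> j; have cj : continuous (partial j b) by move=> q; exact: (Cb q Logic.I).2.
  by have [M' _ H] := cube_bounded (B + 1) cj; exists M'.
(* [W] dominates the bound of [b] plus that of any one of its partial derivatives, so an error
   [e / W] for [k] becomes at most [e] after the Leibniz rule. *)
pose W := M + \sum_j `|M' j|.
have W0 : 0 < W by rewrite ltr_pwDl// sumr_ge0.
have WM' j : `|M' j| + M <= W.
  by rewrite /W addrC lerD2l (bigD1 j)//= lerDl sumr_ge0.
have eW : 0 < e / W by rewrite divr_gt0.
have [P [CP pP P0 HP]] := @C1_poly_approx (B + 1) (enum 'I_n) k _ B10 Ck1 (fun q _ => kge0 q) eW.
pose h q := b q * P q.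
have sh : box_supported (B + 1) h by move=> q i Bi; rewrite /h /b (bump_eq0 Bi) mul0r.
have gE q : g q = b q * k q.
  have [/FO Oq|nq] := pselect (cube n B q).
    by rewrite /k mulrCA mulfV ?mulr1// gt_eqF.
  by rewrite k0// mulr0 (box_supported_off_cube sg).
have sg' : box_supported (B + 1) g.
  by move=> q i Bi; apply: (sg q i); rewrite (le_trans _ Bi)// lerDl.
exists h; split => //.
- move=> l; apply: CkM; first exact: Ck_bump.
  apply: poly_in_Ck; rewrite (_ : [set: 'I_n]%SET = [set i in enum 'I_n]%SET)//.
  by apply/setP => i; rewrite !inE mem_enum.
- move=> q; have [cq|nq] := pselect (cube n (B + 1) q).
    by rewrite mulr_ge0// ?bump_ge0// P0.
  by rewrite (box_supported_off_cube sh nq).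
move=> q; have [cq|nq] := pselect (cube n (B + 1) q); last first.
  rewrite (box_supported_off_cube sh nq) (box_supported_off_cube sg' nq) subrr normr0.
  split; [exact: ltW|move=> j].
  by rewrite (box_supported_partial _ sh nq) (box_supported_partial _ sg' nq) subrr normr0 ltW.
have [h1 h2] := HP q cq; split.
  rewrite gE /h -mulrBr normrM (le_trans (ler_pM _ _ (HM q cq) h1))//.
  rewrite mulrCA; apply: ler_piMr; first exact: ltW.
  by rewrite ler_pdivrMr// mul1r lerDl sumr_ge0.
move=> j; rewrite (_ : g = fun q => b q * k q); last exact/funext.
rewrite /h (partialM _ (Cb q Logic.I).1 (CP q Logic.I).1).
rewrite (partialM _ (Cb q Logic.I).1 (Ck1 q Logic.I).1).
rewrite (_ : _ - _ = b q * (partial j P q - partial j k q) + (P q - k q) * partial j b q); last by ring.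
rewrite (le_trans (ler_normD _ _))// !normrM.
apply: (@le_trans _ _ (M * (e / W) + (e / W) * `|M' j|)).
  apply: lerD; apply: ler_pM => //; first exact: HM.
  by rewrite (le_trans (HM' j q cq))// ler_norm.
rewrite [M * _]mulrC -mulrDr mulrAC ler_pdivrMr//.
by apply: ler_wpM2l; [exact: ltW|rewrite addrC].
Qed.

End density.

(** * The weak inequality for C^1 test functions *)

Section weak_inequality.
Context {R : realType}.

Lemma continuous_sum (T : topologicalType) (I : Type) (r : seq I) (F : I -> T -> R) :
  (forall j, continuous (F j)) -> continuous (fun q => \sum_(j <- r) F j q).
Proof.
move=> cF; elim: r => [|j r IH] q.
  by under eq_fun do rewrite big_nil; exact: cst_continuous.
under eq_fun do rewrite big_cons.
exact: (cvgD (cF j q) (IH q)).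
Qed.

Lemma continuousM_fun (T : topologicalType) (f g : T -> R) :
  continuous f -> continuous g -> continuous (fun q => f q * g q).
Proof. by move=> cf cg q; exact: (cvgM (cf q) (cg q)). Qed.

Lemma continuousD_fun (T : topologicalType) (f g : T -> R) :
  continuous f -> continuous g -> continuous (fun q => f q + g q).
Proof. by move=> cf cg q; exact: (cvgD (cf q) (cg q)). Qed.

Lemma continuousN_fun (T : topologicalType) (f : T -> R) :
  continuous f -> continuous (fun q => - f q).
Proof. by move=> cf q; exact: (cvgN (cf q)). Qed.

Lemma continuous_norm_fun (T : topologicalType) (f : T -> R) :
  continuous f -> continuous (fun q => `|f q|).
Proof. by move=> cf q; exact: (cvg_norm (cf q)). Qed.

Lemma Rintegral_le_cube n B (h : 'rV[R]_n -> R) c : continuous h -> box_supported B h ->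
  0 <= c -> (forall q, cube n B q -> h q <= c) ->
  \int[lebesgue_rV]_q h q <= c * fine (lebesgue_rV (cube n B)).
Proof.
move=> ch sh c0 hc; have ih := box_supported_integrable ch sh.
have mc := @measurable_cube R n B; have lc := @lebesgue_cube R n B.
have hE : EFin \o h = (EFin \o h) \_ (cube n B).
  apply/funext => q; rewrite patchE; case: ifPn => // /negP hq /=.
  rewrite (box_supported_off_cube sh)// => cq; apply: hq; exact: mem_set.
have fc : lebesgue_rV (cube n B) \is a fin_num by rewrite ge0_fin_numE.
rewrite -lee_fin fineK; last exact: integrable_fin_num.
rewrite EFinM fineK// -integral_cst//.
rewrite [leLHS](_ : _ = (\int[lebesgue_rV]_(q in cube n B) (h q)%:E)%E); last first.
  by rewrite [RHS](integral_mkcond (cube n B) (EFin \o h)) -hE.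
apply: le_integral => //.
- exact: integrableS measurableT mc (@subsetT _ _) ih.
- apply: (measurable_bounded_integrable (f := fun=> c)) => //.
  by exists `|c|; split => // x cx q _ /=; exact: ltW.
by move=> q; rewrite inE => cq; rewrite lee_fin; exact: hc.
Qed.

Variable m : nat.
Local Notation H := 'rV[R]_(m + m + 1).
Implicit Types (zeta h : H -> R).

Lemma continuous_Xfield j h : C1on setT h -> continuous (Xfield j h).
Proof.
move=> C1; have cp i : continuous (partial i h) by move=> q; exact: (C1 q Logic.I).2.
apply: continuousD_fun; first exact: cp.
apply: continuousM_fun; last exact: cp.
by apply: continuousM_fun; [exact: cst_continuous|exact: continuous_rV_coord].
Qed.

Lemma continuous_Yfield j h : C1on setT h -> continuous (Yfield j h).
Proof.
move=> C1; have cp i : continuous (partial i h) by move=> q; exact: (C1 q Logic.I).2.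
apply: continuousD_fun; first exact: cp.
apply: continuousN_fun; apply: continuousM_fun; last exact: cp.
by apply: continuousM_fun; [exact: cst_continuous|exact: continuous_rV_coord].
Qed.

Lemma Xfield_off_cube B j h q : box_supported B h -> ~ cube _ B q -> Xfield j h q = 0.
Proof.
by move=> sh nq; rewrite /Xfield !(box_supported_partial _ sh nq) mulr0 addr0.
Qed.

Lemma Yfield_off_cube B j h q : box_supported B h -> ~ cube _ B q -> Yfield j h q = 0.
Proof.
by move=> sh nq; rewrite /Yfield !(box_supported_partial _ sh nq) mulr0 subr0.
Qed.

Lemma box_supportedS n B (h : 'rV[R]_n -> R) :
  (forall q, ~ cube n B q -> h q = 0) -> box_supported (B + 1) h.
Proof.
move=> h0 q i Bi; apply: h0 => /(_ i) /(le_trans Bi).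
by rewrite gerDl ler10.
Qed.

Section pairing.
Variables (Fx Fy : 'I_m -> H -> R) (w : H -> R).
Hypothesis cFx : forall j, continuous (Fx j).
Hypothesis cFy : forall j, continuous (Fy j).
Hypothesis cw : continuous w.

(** Both sides of the weak inequality gathered in one integrand, with abstract fluxes and source;
    for a solution the integral is nonpositive. *)
Definition pairing zeta (q : H) : R :=
  \sum_(j < m) (Fx j q * Xfield j zeta q + Fy j q * Yfield j zeta q) + w q * zeta q.

Lemma continuous_pairing zeta : C1on setT zeta -> continuous (pairing zeta).
Proof.
move=> C1; apply: continuousD_fun; last first.
  by apply: continuousM_fun => // q; exact: C1on_continuous C1 Logic.I.
apply: continuous_sum => j; apply: continuousD_fun; apply: continuousM_fun => //.
  exact: continuous_Xfield.
exact: continuous_Yfield.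
Qed.

Lemma pairing_off_cube B zeta q : box_supported B zeta -> ~ cube _ B q ->
  pairing zeta q = 0.
Proof.
move=> sz nq; rewrite /pairing (box_supported_off_cube sz nq) mulr0 addr0 big1// => j _.
by rewrite (Xfield_off_cube _ sz nq) (Yfield_off_cube _ sz nq) !mulr0 addr0.
Qed.

Lemma pairing_integrable B zeta : C1on setT zeta -> box_supported B zeta ->
  lebesgue_rV.-integrable setT (EFin \o pairing zeta).
Proof.
move=> C1 sz; apply: (@box_supported_integrable _ _ (B + 1)).
  exact: continuous_pairing.
by apply: box_supportedS => q; exact: pairing_off_cube.
Qed.

Lemma pairing_dist e zeta h q : 0 <= e ->
  `|zeta q - h q| <= e -> (forall j, `|partial j zeta q - partial j h q| <= e) ->
  `|pairing zeta q - pairing h q| <=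
    e * (\sum_(j < m) (`|Fx j q| * (1 + 2 * `|q ord0 (idx_y j)|) +
                       `|Fy j q| * (1 + 2 * `|q ord0 (idx_x j)|)) + `|w q|).
Proof.
move=> e0 h1 h2.
have XX j : `|Xfield j zeta q - Xfield j h q| <= e * (1 + 2 * `|q ord0 (idx_y j)|).
  rewrite /Xfield [X in `|X|](_ : _ = (partial (idx_x j) zeta q - partial (idx_x j) h q) +
    2 * q ord0 (idx_y j) * (partial idx_t zeta q - partial idx_t h q)); last by ring.
  have -> : e * (1 + 2 * `|q ord0 (idx_y j)|) = e + 2 * `|q ord0 (idx_y j)| * e by ring.
  rewrite (le_trans (ler_normD _ _))// lerD// !normrM normr_nat ler_wpM2l//.
have YY j : `|Yfield j zeta q - Yfield j h q| <= e * (1 + 2 * `|q ord0 (idx_x j)|).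
  rewrite /Yfield [X in `|X|](_ : _ = (partial (idx_y j) zeta q - partial (idx_y j) h q) -
    2 * q ord0 (idx_x j) * (partial idx_t zeta q - partial idx_t h q)); last by ring.
  have -> : e * (1 + 2 * `|q ord0 (idx_x j)|) = e + 2 * `|q ord0 (idx_x j)| * e by ring.
  rewrite (le_trans (ler_normB _ _))// lerD// !normrM normr_nat ler_wpM2l//.
rewrite /pairing [X in `|X|](_ : _ = \sum_(j < m) (Fx j q * (Xfield j zeta q - Xfield j h q) +
   Fy j q * (Yfield j zeta q - Yfield j h q)) + w q * (zeta q - h q)); last first.
  rewrite mulrBr opprD addrACA; congr (_ + _).
  rewrite -sumrB; apply: eq_bigr => j _; ring.
rewrite (le_trans (ler_normD _ _))// [leRHS]mulrDr lerD//; last first.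
  by rewrite normrM mulrC ler_wpM2r.
rewrite (le_trans (ler_norm_sum _ _ _))// mulr_sumr ler_sum// => j _.
rewrite (le_trans (ler_normD _ _))// !normrM [leRHS]mulrDr lerD//.
  by rewrite mulrCA ler_wpM2l.
by rewrite mulrCA ler_wpM2l.
Qed.

(** On a fixed cube the integral is continuous in [zeta] for the C^1 norm ([pairing_dist]), so
    [test_approx] carries the sign over from smooth test functions. *)
Lemma pairing_extend B zeta : 0 < B ->
  (forall h, test_function h -> (forall q, 0 <= h q) ->
    \int[lebesgue_rV]_q pairing h q <= 0) ->
  C1on setT zeta -> (forall q, 0 <= zeta q) -> box_supported B zeta ->
  \int[lebesgue_rV]_q pairing zeta q <= 0.
Proof.
move=> B0 Htest C1 z0 sz.
pose V (q : H) := \sum_(j < m) (`|Fx j q| * (1 + 2 * `|q ord0 (idx_y j)|) +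
                       `|Fy j q| * (1 + 2 * `|q ord0 (idx_x j)|)) + `|w q|.
have cV : continuous V.
  have c1 i : continuous (fun q : H => 1 + 2 * `|q ord0 i|).
    apply: continuousD_fun; first exact: cst_continuous.
    apply: continuousM_fun; first exact: cst_continuous.
    by apply: continuous_norm_fun; exact: continuous_rV_coord.
  apply: continuousD_fun; last exact: continuous_norm_fun.
  by apply: continuous_sum => j; apply: continuousD_fun; apply: continuousM_fun => //;
    exact: continuous_norm_fun.
(* One unit is the enlargement of the support in [test_approx]. The other is there because
   derivatives are only known to vanish outside the closed cube, whereas [box_supported] includes
   the faces. *)
have [M M0 HM] := cube_bounded (B + 1 + 1) cV.
pose K := fine (lebesgue_rV (cube (m + m + 1) (B + 1 + 1) : set H)).
have K0 : 0 <= K by rewrite fine_ge0.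
apply/ler_addgt0Pr => e e0; rewrite add0r.
pose e' := e / (M * (K + 1)).
have e'0 : 0 < e' by rewrite divr_gt0// mulr_gt0// ltr_wpDl.
have [h [Ch h0 sh Hh]] := test_approx B0 C1 z0 sz e'0.
have C1h : C1on setT h by apply/C1onTP; exact: (Ch 1%N).
have sz' : box_supported (B + 1) zeta.
  by apply: box_supportedS => q; exact: box_supported_off_cube.
have th : \int[lebesgue_rV]_q pairing h q <= 0.
  by apply: Htest => //; split => //; exact: box_supported_compact sh.
have ih := pairing_integrable C1h sh.
have iz := pairing_integrable C1 sz.
rewrite -[leLHS](subrK (\int[lebesgue_rV]_q pairing h q)).
rewrite -[leRHS]addr0 lerD// -RintegralB//.
apply: (@le_trans _ _ (e' * M * K)).
  apply: Rintegral_le_cube.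
  - move=> q; exact: (cvgB (@continuous_pairing zeta C1 q) (@continuous_pairing h C1h q)).
  - apply: box_supportedS => q nq.
    by rewrite (pairing_off_cube sz' nq) (pairing_off_cube sh nq) subrr.
  - by rewrite mulr_ge0// ltW.
  - move=> q cq; rewrite (le_trans (ler_norm _))//.
    apply: (le_trans (pairing_dist (ltW e'0) _ _)).
    - by rewrite distrC; exact: (Hh q).1.
    - by move=> j; rewrite distrC; exact: (Hh q).2.
    - rewrite -/(V q); apply: ler_wpM2l; first exact: ltW.
      by rewrite (le_trans (ler_norm _))// HM.
rewrite /e' -mulrA mulrAC ler_pdivrMr ?mulr_gt0 ?ltr_wpDl//.
by rewrite ler_wpM2l ?(ltW e0)// ler_wpM2l ?(ltW M0)// lerDl.
Qed.

End pairing.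

End weak_inequality.

(** * Primitives *)

Section primitive.
Context {R : realType}.
Variables (kap : R -> R) (a : R).
Hypothesis kap_gt0 : forall t, a < t -> 0 < kap t.
Hypothesis kap_cont : forall t, a < t -> {for t, continuous kap}.
Hypothesis kap_int : forall b, a < b ->
  lebesgue_measure.-integrable `[a, b] (EFin \o kap).

(** Used for [K], for [F] and for the travel time of the barrier. Continuity of the integrand is
    asked only beyond [a], because that of [K] may be singular at 0. *)
Definition prim (t : R) : R := \int[lebesgue_measure]_(s in `[a, t]) kap s.

Lemma prim_left : prim a = 0.
Proof. by rewrite /prim set_itv1 /Rintegral integral_set1. Qed.

Lemma is_derive_prim (t : R) : a < t -> is_derive t 1 prim (kap t).
Proof.
move=> at0; have tt1 : t < t + 1 by rewrite ltrDl.
have [] := continuous_FTC1_closed tt1 (kap_int (lt_trans at0 tt1)) at0 (kap_cont at0).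
by rewrite derive1E => d e; split.
Qed.

Lemma prim_within b : a < b -> {within `[a, b], continuous prim}.
Proof.
move=> ab; apply: parameterized_integral_continuous; first exact: ltW.
exact: kap_int.
Qed.

Lemma prim_continuous t : a < t -> {for t, continuous prim}.
Proof.
move=> at0; apply/differentiable_continuous/derivable1_diffP.
by have [] := is_derive_prim at0.
Qed.

Lemma prim_mvt s t : a <= s -> s < t ->
  exists2 c, s < c < t & prim t - prim s = kap c * (t - s).
Proof.
move=> as0 st; have [||c cin E] := @MVT R prim kap s t st.
- by move=> x; rewrite in_itv/= => /andP[sx _]; exact/is_derive_prim/(le_lt_trans as0).
- apply: continuous_subspaceW (prim_within (le_lt_trans as0 st)).
  by move=> x; rewrite /= !in_itv/= => /andP[sx ->]; rewrite (le_trans as0 sx).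
by exists c => //; move: cin; rewrite in_itv.
Qed.

Lemma prim_lt s t : a <= s -> s < t -> prim s < prim t.
Proof.
move=> as0 st; have [c /andP[sc _] E] := prim_mvt as0 st.
by rewrite -subr_gt0 E mulr_gt0 ?subr_gt0// kap_gt0// (le_lt_trans as0).
Qed.

Lemma prim_le s t : a <= s -> s <= t -> prim s <= prim t.
Proof.
move=> as0; rewrite le_eqVlt => /orP[/eqP->//|st].
exact/ltW/prim_lt.
Qed.

Lemma prim_inj : {in `[a, +oo[%classic &, injective prim}.
Proof.
move=> s t; rewrite !inE/= !in_itv/= !andbT => as0 at0 E.
by apply/eqP; rewrite eq_le !leNgt; apply/andP; split; apply/negP => h;
  [have := prim_lt at0 h|have := prim_lt as0 h]; rewrite E ltxx.
Qed.

Lemma prim_surj b y : a <= b -> 0 <= y <= prim b -> exists2 t, a <= t <= b & prim t = y.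
Proof.
rewrite le_eqVlt => /orP[/eqP <-|ab].
  rewrite prim_left -eq_le => /eqP <-; exists a; rewrite ?lexx//.
  exact: prim_left.
move=> yb; have [|c cin E] := @IVT R prim a b y (ltW ab) (prim_within ab).
  have := prim_lt (lexx a) ab; rewrite prim_left => pb.
  by rewrite min_l ?max_r ?(ltW pb).
by exists c => //; move: cin; rewrite in_itv.
Qed.

Hypothesis kap_left : 0 <= kap a.

Lemma kap_ge0 t : a <= t -> 0 <= kap t.
Proof. by rewrite le_eqVlt => /orP[/eqP <-//|/kap_gt0/ltW]. Qed.

Lemma prim_nondecreasing : nondecreasing_fun prim.
Proof.
have prim0 t : t < a -> prim t = 0.
  by move=> ta; rewrite /prim set_itv_ge ?bnd_simp -?ltNge// /Rintegral integral_set0.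
move=> s t st; have [as0|sa] := leP a s; first exact: prim_le.
rewrite prim0//; have [at0|ta] := leP a t; last by rewrite prim0.
by rewrite -prim_left prim_le.
Qed.

(** A bounded [prim] would converge, being monotone, and the improper fundamental theorem would then
    make [kap] integrable at infinity. *)
Lemma prim_unbounded b : a < b ->
  ~ lebesgue_measure.-integrable `]b, +oo[ (EFin \o kap) ->
  forall B, exists2 t, a < t & B < prim t.
Proof.
move=> ab nint B; apply: contrapT => nt; apply: nint.
have PB t : prim t <= B.
  have [at0|ta] := ltP a t.
    by rewrite leNgt; apply/negP => Bt; apply: nt; exists t.
  rewrite (le_trans (prim_nondecreasing ta))//.
  rewrite (le_trans (prim_nondecreasing (ltW ab)))// leNgt; apply/negP => Bt.
  by apply: nt; exists b.
have cv : prim r @[r --> +oo] --> sup (range prim).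
  apply: nondecreasing_cvgr; first exact: prim_nondecreasing.
  by exists B => _ [t _ <-].
have dp x : b < x -> is_derive x 1 prim (kap x).
  by move=> bx; apply: is_derive_prim; exact: lt_trans ab bx.
have cw : {within `[b, +oo[, continuous kap}.
  apply/continuous_within_itvcyP; split.
    by move=> x; rewrite in_itv/= andbT => bx; apply: kap_cont; exact: lt_trans ab bx.
  by apply: cvg_at_right_filter; exact: kap_cont.
have E := @ge0_continuous_FTC2y R kap prim b (sup (range prim))
  (fun x bx => kap_ge0 (le_trans (ltW ab) bx)) cw cv
  (fun x bx => @ex_derive _ _ _ _ _ _ _ (dp x bx))
  (cvg_at_right_filter (prim_continuous ab)) _.
have mk : measurable_fun `[b, +oo[%classic kap.
  by apply: subspace_continuous_measurable_fun => //; exact: measurable_itv.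
have I : lebesgue_measure.-integrable `[b, +oo[ (EFin \o kap); last first.
  by apply: integrableS I => //; apply: subset_itvr; rewrite bnd_simp.
apply/integrableP; split; first exact/measurable_EFinP.
under eq_integral => x.
  rewrite inE /= in_itv/= andbT => bx.
  rewrite ger0_norm; last by rewrite kap_ge0// (le_trans (ltW ab)).
  over.
rewrite E -?EFinB ?ltry// => x; rewrite in_itv/= andbT => bx.
exact/is_derive_derive1/dp.
Qed.

Lemma integrable_setU d (T : measurableType d) (mu : {measure set T -> \bar R})
    (A B : set T) (g : T -> \bar R) : measurable A -> measurable B ->
  mu.-integrable A g -> mu.-integrable B g -> mu.-integrable (A `|` B) g.
Proof.
move=> mA mB iA iB; have mAB := measurableU _ _ mA mB.
have mg : measurable_fun (A `|` B) g.
  apply/measurable_funU => //; split.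
    by case/integrableP : iA.
  by case/integrableP : iB.
apply/integrable_mkcond => //.
apply: (@le_integrable _ _ _ _ _ measurableT _
  (fun x => `|(g \_ A) x| + `|(g \_ B) x|)%E).
- exact/(measurable_restrictT g mAB).1.
- move=> x _; rewrite [leRHS]gee0_abs ?adde_ge0// !patchE in_setU.
  case: (x \in A); case: (x \in B);
    by rewrite /= ?normr0 ?adde0 ?add0e// ?leeDl.
- have iA' := (integrable_mkcond g mA).1 iA; have iB' := (integrable_mkcond g mB).1 iB.
  exact: (integrableD measurableT (integrable_abse iA') (integrable_abse iB')).
Qed.

Lemma prim_bounded M : a < M ->
  lebesgue_measure.-integrable `]M, +oo[ (EFin \o kap) ->
  exists S, forall t, prim t <= S.
Proof.
move=> aM iM.
pose U := (`[a, M] `|` `]M, +oo[)%classic : set R.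
have iU : lebesgue_measure.-integrable U (EFin \o kap).
  by apply: integrable_setU => //; exact: kap_int.
have mU : measurable U by apply: measurableU.
exists (\int[lebesgue_measure]_(s in U) kap s) => t.
rewrite (@le_trans _ _ (prim (Num.max t M)))//.
  by apply: prim_nondecreasing; rewrite le_max lexx.
have aM' : a < Num.max t M by rewrite lt_max aM orbT.
rewrite -lee_fin !fineK; [|exact: integrable_fin_num..|].
  apply: ge0_subset_integral => //.
  - by case/integrableP : iU.
  - move=> x Ux; rewrite lee_fin kap_ge0//; case: Ux; rewrite /= in_itv/=.
      by case/andP.
    by rewrite andbT => /ltW; apply: le_trans; exact: ltW.
  - move=> x; rewrite /= in_itv/= => /andP[ax _].
    by case: (leP x M) => xM; [left|right]; rewrite /= in_itv/= ?ax ?xM.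
by apply: integrable_fin_num => //; exact: kap_int.
Qed.

Variable inv : R -> R.
Hypothesis invK : forall t, a < t -> inv (prim t) = t.

Lemma is_derive_prim_inv t : a < t -> is_derive (prim t) 1 inv (kap t)^-1.
Proof.
move=> at0; have k0 : kap t != 0 by rewrite gt_eqF// kap_gt0.
apply: (is_derive_inverse _ _ (is_derive_prim at0) k0).
  by near=> x; apply: invK; near: x; exact: lt_nbhsr.
by near=> x; apply: prim_continuous; near: x; exact: lt_nbhsr.
Unshelve. all: by end_near. Qed.

End primitive.

(** * The Koranyi gauge *)

Section dfield.
Context {R : realType} {m : nat}.
Local Notation H := 'rV[R]_(m + m + 1).
Implicit Types (h g : H -> R) (q p : H) (j : 'I_m) (i : 'I_(m + m + 1)).

(* The common form of X_j and Y_j at a point. *)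
Definition dfield i (c : R) h q : R := partial i h q + c * partial idx_t h q.

Lemma XfieldE j h q : Xfield j h q = dfield (idx_x j) (2 * q ord0 (idx_y j)) h q.
Proof. by []. Qed.

Lemma YfieldE j h q : Yfield j h q = dfield (idx_y j) (- (2 * q ord0 (idx_x j))) h q.
Proof. by rewrite /Yfield /dfield mulNr. Qed.

Lemma dfieldD i c h g q : differentiable h q -> differentiable g q ->
  dfield i c (fun x => h x + g x) q = dfield i c h q + dfield i c g q.
Proof. by move=> dh dg; rewrite /dfield !partialD//; ring. Qed.

Lemma dfieldN i c h q : differentiable h q ->
  dfield i c (fun x => - h x) q = - dfield i c h q.
Proof. by move=> dh; rewrite /dfield !partialN//; ring. Qed.

Lemma dfieldM i c h g q : differentiable h q -> differentiable g q ->
  dfield i c (fun x => h x * g x) q = h q * dfield i c g q + g q * dfield i c h q.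
Proof. by move=> dh dg; rewrite /dfield !partialM//; ring. Qed.

Lemma dfield_cst i c a q : dfield i c (fun=> a) q = 0.
Proof. by rewrite /dfield !partial_cst mulr0 addr0. Qed.

Lemma dfield_comp i c (g : R -> R) h q : derivable g (h q) 1 -> differentiable h q ->
  dfield i c (fun x => g (h x)) q = derive1 g (h q) * dfield i c h q.
Proof. by move=> dg dh; rewrite /dfield !(partial_comp _ dg dh); ring. Qed.

Lemma dfield_sum i c (I : Type) (r : seq I) (P : pred I) (h : I -> H -> R) q :
  (forall k, P k -> differentiable (h k) q) ->
  dfield i c (fun x => \sum_(k <- r | P k) h k x) q = \sum_(k <- r | P k) dfield i c (h k) q.
Proof.
by move=> dh; rewrite /dfield !partial_sum// mulr_sumr -big_split.
Qed.

Lemma idx_xx j k : (idx_x j == idx_x k :> 'I_(m + m + 1)) = (j == k).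
Proof. by rewrite /idx_x (inj_eq (@lshift_inj _ _)) (inj_eq (@lshift_inj _ _)). Qed.

Lemma idx_yy j k : (idx_y j == idx_y k :> 'I_(m + m + 1)) = (j == k).
Proof. by rewrite /idx_y (inj_eq (@lshift_inj _ _)) (inj_eq (@rshift_inj _ _)). Qed.

Lemma idx_xy j k : (idx_x j == idx_y k :> 'I_(m + m + 1)) = false.
Proof. by rewrite /idx_x /idx_y (inj_eq (@lshift_inj _ _)) eq_lrshift. Qed.

Lemma idx_yx j k : (idx_y j == idx_x k :> 'I_(m + m + 1)) = false.
Proof. by rewrite eq_sym idx_xy. Qed.

Lemma idx_xt j : (idx_x j == idx_t :> 'I_(m + m + 1)) = false.
Proof. exact: eq_lrshift. Qed.

Lemma idx_yt j : (idx_y j == idx_t :> 'I_(m + m + 1)) = false.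
Proof. exact: eq_lrshift. Qed.

Lemma idx_tx j : (idx_t == idx_x j :> 'I_(m + m + 1)) = false.
Proof. by rewrite eq_sym idx_xt. Qed.

Lemma idx_ty j : (idx_t == idx_y j :> 'I_(m + m + 1)) = false.
Proof. by rewrite eq_sym idx_yt. Qed.

Lemma idx_cases (i : 'I_(m + m + 1)) :
  [\/ exists j, i = idx_x j, exists j, i = idx_y j | i = idx_t].
Proof.
rewrite -(fintype.splitK i); case: (fintype.split i) => [k|k] /=.
  rewrite -(fintype.splitK k); case: (fintype.split k) => j /=; first by apply: Or31; exists j.
  by apply: Or32; exists j.
by apply: Or33; rewrite /idx_t ord1.
Qed.

End dfield.

Section gauge.
Context {R : realType} {m : nat}.
Local Notation H := 'rV[R]_(m + m + 1).
Variable p : H.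
Implicit Types (q : H) (j : 'I_m).

(* Coordinates of p^-1 o q. *)
Definition zx j q : R := q ord0 (idx_x j) - p ord0 (idx_x j).
Definition zy j q : R := q ord0 (idx_y j) - p ord0 (idx_y j).
Definition zt q : R := q ord0 idx_t - p ord0 idx_t +
  2 * \sum_(j < m) (p ord0 (idx_x j) * q ord0 (idx_y j) - p ord0 (idx_y j) * q ord0 (idx_x j)).

Definition zsq q : R := \sum_(j < m) (zx j q * zx j q + zy j q * zy j q).
(** The fourth power of the Koranyi gauge of $p^{-1}\circ q$: a polynomial, hence C^1 everywhere,
    which its root is not. *)
Definition gauge4 q : R := zsq q * zsq q + zt q * zt q.

Lemma C1on_zx j : C1on setT (zx j).
Proof. exact: (C1on_B openT (C1on_coord _) (C1on_cst _)). Qed.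

Lemma C1on_zy j : C1on setT (zy j).
Proof. exact: (C1on_B openT (C1on_coord _) (C1on_cst _)). Qed.

Lemma C1on_zt : C1on setT zt.
Proof.
apply: (C1on_D openT (C1on_B openT (C1on_coord _) (C1on_cst _))).
apply: (C1on_M openT (C1on_cst _)).
apply: (@C1on_sum R _ setT 'I_m _ xpredT (fun j (q : H) => p ord0 (idx_x j) *
  q ord0 (idx_y j) - p ord0 (idx_y j) * q ord0 (idx_x j)) openT) => j _.
exact: (C1on_B openT (C1on_M openT (C1on_cst _) (C1on_coord _))
  (C1on_M openT (C1on_cst _) (C1on_coord _))).
Qed.

Lemma C1on_zsq : C1on setT zsq.
Proof.
apply: (@C1on_sum R _ setT 'I_m _ xpredT
  (fun j q => zx j q * zx j q + zy j q * zy j q) openT) => j _; have Cx := C1on_zx j; have Cy := C1on_zy j.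
exact: (C1on_D openT (C1on_M openT Cx Cx) (C1on_M openT Cy Cy)).
Qed.

Lemma C1on_gauge4 : C1on setT gauge4.
Proof.
exact: (C1on_D openT (C1on_M openT C1on_zsq C1on_zsq) (C1on_M openT C1on_zt C1on_zt)).
Qed.

Let dT (h : H -> R) q (C1 : C1on setT h) : differentiable h q := (C1 q Logic.I).1.

Lemma dfield_coord i k c q : dfield i c (fun x : H => x ord0 k) q =
  (i == k)%:R + c * (idx_t == k)%:R.
Proof. by rewrite /dfield !partial_coord. Qed.

Lemma dfield_zx i c j q : dfield i c (zx j) q =
  (i == idx_x j)%:R + c * (idx_t == idx_x j)%:R.
Proof.
rewrite /zx dfieldD ?dfield_cst ?dfield_coord ?addr0//.
exact: differentiable_coordinate.
Qed.

Lemma dfield_zy i c j q : dfield i c (zy j) q =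
  (i == idx_y j)%:R + c * (idx_t == idx_y j)%:R.
Proof.
rewrite /zy dfieldD ?dfield_cst ?dfield_coord ?addr0//.
exact: differentiable_coordinate.
Qed.

Lemma dfield_zt i c q : dfield i c zt q = (i == idx_t)%:R + c +
  2 * \sum_(j < m) (p ord0 (idx_x j) * (i == idx_y j)%:R - p ord0 (idx_y j) * (i == idx_x j)%:R).
Proof.
have C1 j : C1on setT (fun q : H => p ord0 (idx_x j) * q ord0 (idx_y j)).
  exact: (C1on_M openT (C1on_cst _) (C1on_coord _)).
have C2 j : C1on setT (fun q : H => p ord0 (idx_y j) * q ord0 (idx_x j)).
  exact: (C1on_M openT (C1on_cst _) (C1on_coord _)).
have C3 j := C1on_B openT (C1 j) (C2 j).
have C4 := C1on_sum (index_enum 'I_m) (P := xpredT) openT (fun j _ => C3 j).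
have C5 : C1on setT (fun q : H => q ord0 idx_t - p ord0 idx_t).
  exact: (C1on_B openT (C1on_coord _) (C1on_cst _)).
rewrite /zt dfieldD; [|exact: dT C5|exact: dT (C1on_M openT (C1on_cst _) C4)].
rewrite dfieldD; [|exact: differentiable_coordinate|exact: differentiable_cst].
rewrite dfield_cst dfield_coord eqxx addr0 mulr1; congr (_ + _).
rewrite dfieldM; [|exact: differentiable_cst|exact: dT C4].
rewrite dfield_cst mulr0 addr0 dfield_sum; last by move=> j _; exact: dT (C3 j).
congr (_ * _); apply: eq_bigr => j _.
rewrite dfieldD; [|exact: dT (C1 j)|exact: dT (C1on_N openT (C2 j))].
rewrite dfieldN; last exact: dT (C2 j).
rewrite !dfieldM; try exact: differentiable_cst; try exact: differentiable_coordinate.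
by rewrite !dfield_cst !dfield_coord idx_tx idx_ty !mulr0 !addr0.
Qed.

Lemma dfield_zsq i c q : dfield i c zsq q =
  \sum_(j < m) (2 * zx j q * dfield i c (zx j) q + 2 * zy j q * dfield i c (zy j) q).
Proof.
have Cx j := C1on_zx j; have Cy j := C1on_zy j.
have Cxx j := C1on_M openT (Cx j) (Cx j); have Cyy j := C1on_M openT (Cy j) (Cy j).
rewrite /zsq dfield_sum; last by move=> j _; exact: dT (C1on_D openT (Cxx j) (Cyy j)).
apply: eq_bigr => j _; rewrite dfieldD; [|exact: dT (Cxx j)|exact: dT (Cyy j)].
rewrite !dfieldM; [|exact: dT (Cy j)..|exact: dT (Cx j)|exact: dT (Cx j)].
by ring.
Qed.

Lemma dfield_gauge4 i c q : dfield i c gauge4 q =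
  2 * zsq q * dfield i c zsq q + 2 * zt q * dfield i c zt q.
Proof.
have CZ := C1on_zsq; have Ct := C1on_zt.
rewrite /gauge4 dfieldD; [|exact: dT (C1on_M openT CZ CZ)|exact: dT (C1on_M openT Ct Ct)].
rewrite !dfieldM; [|exact: dT Ct..|exact: dT CZ|exact: dT CZ].
by ring.
Qed.

Lemma sum_delta (a : 'I_m -> R) j : \sum_(k < m) a k * (j == k)%:R = a j.
Proof.
rewrite (bigD1 j)//= eqxx mulr1 big1 ?addr0// => k kj.
by rewrite eq_sym (negbTE kj) mulr0.
Qed.

Lemma X_zsq j q : Xfield j zsq q = 2 * zx j q.
Proof.
rewrite XfieldE dfield_zsq.
under eq_bigr do rewrite dfield_zx dfield_zy idx_tx idx_ty idx_xx idx_xy !mulr0 !addr0 mulr0 addr0.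
exact: (sum_delta (fun k => 2 * zx k q)).
Qed.

Lemma Y_zsq j q : Yfield j zsq q = 2 * zy j q.
Proof.
rewrite YfieldE dfield_zsq.
under eq_bigr do rewrite dfield_zx dfield_zy idx_tx idx_ty idx_yy idx_yx !mulr0 !addr0 mulr0 add0r.
exact: (sum_delta (fun k => 2 * zy k q)).
Qed.

(** Left invariance at work: the twist of [zt] contributes [- 2 p_j] in the [y] coordinates, which
    combines with the coefficient [2 y_j] of the field into [zy]. *)
Lemma X_zt j q : Xfield j zt q = 2 * zy j q.
Proof.
rewrite XfieldE dfield_zt idx_xt add0r.
under eq_bigr do rewrite idx_xx idx_xy mulr0 sub0r -mulNr.
by rewrite (sum_delta (fun k => - p ord0 (idx_y k))) /zy; ring.
Qed.

Lemma Y_zt j q : Yfield j zt q = - (2 * zx j q).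
Proof.
rewrite YfieldE dfield_zt idx_yt add0r.
under eq_bigr do rewrite idx_yy idx_yx mulr0 subr0.
by rewrite (sum_delta (fun k => p ord0 (idx_x k))) /zx; ring.
Qed.

Lemma X_gauge4 j q : Xfield j gauge4 q = 4 * (zsq q * zx j q + zt q * zy j q).
Proof. by rewrite XfieldE dfield_gauge4 -!XfieldE X_zsq X_zt; ring. Qed.

Lemma Y_gauge4 j q : Yfield j gauge4 q = 4 * (zsq q * zy j q - zt q * zx j q).
Proof. by rewrite YfieldE dfield_gauge4 -!YfieldE Y_zsq Y_zt; ring. Qed.

Lemma XX_gauge4 j q : Xfield j (Xfield j gauge4) q =
  8 * (zx j q * zx j q + zy j q * zy j q) + 4 * zsq q.
Proof.
rewrite (funext (X_gauge4 j)) XfieldE.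
have Cx := C1on_zx j; have Cy := C1on_zy j; have CZ := C1on_zsq; have Ct := C1on_zt.
have CA := C1on_M openT CZ Cx; have CB := C1on_M openT Ct Cy.
rewrite dfieldM; [|exact: differentiable_cst|exact: dT (C1on_D openT CA CB)].
rewrite dfield_cst dfieldD; [|exact: dT CA|exact: dT CB].
rewrite !dfieldM; [|exact: dT Ct|exact: dT Cy|exact: dT CZ|exact: dT Cx].
rewrite dfield_zx dfield_zy -!XfieldE X_zsq X_zt idx_tx idx_ty idx_xx idx_xy eqxx /=.
by ring.
Qed.

Lemma YY_gauge4 j q : Yfield j (Yfield j gauge4) q =
  8 * (zx j q * zx j q + zy j q * zy j q) + 4 * zsq q.
Proof.
rewrite (funext (Y_gauge4 j)) YfieldE.
have Cx := C1on_zx j; have Cy := C1on_zy j; have CZ := C1on_zsq; have Ct := C1on_zt.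
have CA := C1on_M openT CZ Cy; have CB := C1on_M openT Ct Cx.
rewrite dfieldM; [|exact: differentiable_cst|exact: dT (C1on_B openT CA CB)].
rewrite dfield_cst dfieldD; [|exact: dT CA|exact: dT (C1on_N openT CB)].
rewrite dfieldN; last exact: dT CB.
rewrite !dfieldM; [|exact: dT Ct|exact: dT Cx|exact: dT CZ|exact: dT Cy].
rewrite dfield_zx dfield_zy -!YfieldE Y_zsq Y_zt idx_tx idx_ty idx_yy idx_yx eqxx /=.
by ring.
Qed.

Lemma sum_zsq_gauge4 q : \sum_(j < m) (Xfield j zsq q * Xfield j gauge4 q +
  Yfield j zsq q * Yfield j gauge4 q) = 8 * zsq q * zsq q.
Proof.
rewrite [RHS](_ : _ = 8 * zsq q * \sum_(j < m) (zx j q * zx j q + zy j q * zy j q))//.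
rewrite mulr_sumr; apply: eq_bigr => j _.
by rewrite X_zsq Y_zsq X_gauge4 Y_gauge4; ring.
Qed.

(** Away from the centre this amounts to the length [rho / rad] for the horizontal gradient of the
    gauge, which therefore vanishes only on the vertical axis. *)
Lemma sum_gauge4_gauge4 q : \sum_(j < m) (Xfield j gauge4 q * Xfield j gauge4 q +
  Yfield j gauge4 q * Yfield j gauge4 q) = 16 * gauge4 q * zsq q.
Proof.
rewrite [in RHS]/zsq mulr_sumr; apply: eq_bigr => j _.
by rewrite X_gauge4 Y_gauge4 /gauge4; ring.
Qed.

Lemma sublaplacian_gauge4 q : \sum_(j < m) (Xfield j (Xfield j gauge4) q +
  Yfield j (Yfield j gauge4) q) = 8 * (m%:R + 2) * zsq q.
Proof.
under eq_bigr do rewrite XX_gauge4 YY_gauge4.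
rewrite (eq_bigr (fun j => 16 * (zx j q * zx j q + zy j q * zy j q) + 8 * zsq q)).
  rewrite big_split /= -mulr_sumr -/(zsq q) sumr_const card_ord -mulr_natr; ring.
by move=> j _; ring.
Qed.

End gauge.

Lemma is_derive_comp_dfield (R : realType) m i c (g : R -> R) (d : R)
    (h : 'rV[R]_(m + m + 1) -> R) q : is_derive (h q) 1 g d -> differentiable h q ->
  dfield i c (fun x => g (h x)) q = d * dfield i c h q.
Proof. by move=> [dg <-] dh; rewrite dfield_comp// derive1E. Qed.

Lemma dfieldZ (R : realType) m i c (a : R) (h : 'rV[R]_(m + m + 1) -> R) q :
  differentiable h q -> dfield i c (fun x => a * h x) q = a * dfield i c h q.
Proof.
by move=> dh; rewrite dfieldM// dfield_cst mulr0 addr0.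
Qed.

(** * The barrier composed with the gauge, and the divergence of its flux *)

Section radial.
Context {R : realType} {m : nat}.
Local Notation H := 'rV[R]_(m + m + 1).
Variable p : H.
Implicit Types (q : H) (j : 'I_m).

Local Notation Z := (zsq p).
Local Notation N := (gauge4 p).

Definition rad q : R := Num.sqrt (Num.sqrt (N q)).
Definition rho q : R := Num.sqrt (Z q).

Lemma zsq_ge0 q : 0 <= Z q.
Proof. by apply: sumr_ge0 => j _; rewrite addr_ge0// -expr2 sqr_ge0. Qed.

Lemma gauge4_ge0 q : 0 <= N q.
Proof. by rewrite addr_ge0// -expr2 sqr_ge0. Qed.

Lemma rad_ge0 q : 0 <= rad q. Proof. exact: sqrtr_ge0. Qed.

Lemma rad4 q : rad q ^+ 4 = N q.
Proof. by rewrite (exprM _ 2 2) !sqr_sqrtr// ?gauge4_ge0// sqrtr_ge0. Qed.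

Lemma rho2 q : rho q * rho q = Z q.
Proof. by rewrite -expr2 sqr_sqrtr// zsq_ge0. Qed.

Lemma rad_gt0E q : (0 < rad q) = (0 < N q).
Proof. by rewrite !sqrtr_gt0. Qed.

Lemma rho_le_rad q : rho q <= rad q.
Proof.
apply: ler_wsqrtr; rewrite -[leLHS]ger0_norm ?zsq_ge0// -sqrtr_sqr; apply: ler_wsqrtr.
by rewrite /gauge4 expr2 lerDl -expr2 sqr_ge0.
Qed.

Lemma continuous_gauge4 : continuous N.
Proof. by move=> q; exact: C1on_continuous (C1on_gauge4 p) Logic.I. Qed.

Lemma continuous_zsq : continuous Z.
Proof. by move=> q; exact: C1on_continuous (C1on_zsq p) Logic.I. Qed.

Lemma continuous_rad : continuous rad.
Proof.
move=> q; have c1 := continuous_comp (@continuous_gauge4 q) (@sqrt_continuous R (N q)).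
exact: (continuous_comp c1 (@sqrt_continuous R (Num.sqrt (N q)))).
Qed.

Lemma is_derive_sqrt (y : R) : 0 < y -> is_derive y 1 Num.sqrt (2 * Num.sqrt y)^-1.
Proof. exact: is_derive1_sqrt. Qed.

Lemma continuous_dsqrt (y : R) : 0 < y -> {for y, continuous (fun y => (2 * Num.sqrt y)^-1)}.
Proof.
move=> y0; apply: cvgV; first by rewrite mulf_neq0// gt_eqF// sqrtr_gt0.
by apply: cvgM; [exact: cvg_cst|exact: sqrt_continuous].
Qed.

Lemma open_zsq_gt0 : open [set q | 0 < Z q].
Proof. by apply: open_superlevel; exact: continuous_zsq. Qed.

Lemma open_gauge4_gt0 : open [set q | 0 < N q].
Proof. by apply: open_superlevel; exact: continuous_gauge4. Qed.

Lemma C1on_sqrt (O : set H) h : open O -> C1on O h -> (forall q, O q -> 0 < h q) ->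
  C1on O (fun q => Num.sqrt (h q)).
Proof.
move=> oO C1 h0.
exact: (@C1on_comp_der R _ O [set x | 0 < x] Num.sqrt (fun y => (2 * Num.sqrt y)^-1) h
  oO (@open_gt R 0) C1 h0 is_derive_sqrt continuous_dsqrt).
Qed.

Lemma C1on_rad : C1on [set q | 0 < N q] rad.
Proof.
have oN := open_gauge4_gt0.
apply: C1on_sqrt => //; last by move=> q h; rewrite sqrtr_gt0.
apply: C1on_sqrt => //; exact: C1on_subset (@subsetT _ _) (C1on_gauge4 p).
Qed.

Lemma C1on_rho : C1on [set q | 0 < Z q] rho.
Proof.
apply: C1on_sqrt => //; first exact: open_zsq_gt0.
exact: C1on_subset (@subsetT _ _) (C1on_zsq p).
Qed.

Lemma dfield_rad i c q : 0 < N q ->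
  dfield i c rad q = dfield i c N q / (4 * rad q ^+ 3).
Proof.
move=> N0; have sN : 0 < Num.sqrt (N q) by rewrite sqrtr_gt0.
have dN := (@C1on_gauge4 R m p q Logic.I).1.
have d2 : differentiable (fun q => Num.sqrt (N q)) q.
  have := @C1on_sqrt _ N open_gauge4_gt0 (C1on_subset (@subsetT _ _) (C1on_gauge4 p)) (fun q h => h).
  by move=> /(_ q N0) [].
rewrite (is_derive_comp_dfield i c (is_derive_sqrt sN) d2).
rewrite (is_derive_comp_dfield i c (is_derive_sqrt N0) dN) -/(rad q).
have -> : Num.sqrt (N q) = rad q * rad q by rewrite -expr2 sqr_sqrtr// sqrtr_ge0.
by field; rewrite gt_eqF// rad_gt0E.
Qed.

Lemma dfield_rho i c q : 0 < Z q -> dfield i c rho q = dfield i c Z q / (2 * rho q).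
Proof.
move=> Z0; have dZ := (@C1on_zsq R m p q Logic.I).1.
by rewrite (is_derive_comp_dfield i c (is_derive_sqrt Z0) dZ) mulrC.
Qed.

Lemma gauge4_gt0 q : 0 < Z q -> 0 < N q.
Proof.
move=> Z0; apply: ltr_pwDl; first exact: mulr_gt0.
by rewrite -expr2 sqr_ge0.
Qed.

Variables (phi al al1 al2 : R -> R) (t0 T : R).
Hypothesis t0_gt0 : 0 < t0.
Hypothesis phi_derivable : forall t, 0 < t -> derivable phi t 1.
Hypothesis dphi_continuous : forall t, 0 < t -> {for t, continuous (derive1 phi)}.
Hypothesis dal : forall t : R, t0 < t -> t < T -> is_derive t 1 al (al1 t).
Hypothesis dal1 : forall t : R, t0 < t -> t < T -> is_derive t 1 al1 (al2 t).
Hypothesis cal2 : forall t, t0 < t -> t < T -> {for t, continuous al2}.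
Hypothesis al1_gt0 : forall t, t0 < t -> t < T -> 0 < al1 t.

Definition shell : set H := [set q | t0 < rad q /\ rad q < T].
Definition shell_off : set H := shell `&` [set q | 0 < Z q].

Lemma open_shell : open shell.
Proof.
rewrite (_ : shell = [set q | t0 < rad q] `&` [set q | rad q < T]).
  by apply: openI; [apply: open_superlevel|apply: open_sublevel]; exact: continuous_rad.
by [].
Qed.

Lemma open_shell_off : open shell_off.
Proof. by apply: openI; [exact: open_shell|exact: open_zsq_gt0]. Qed.

Lemma shell_gauge4 q : shell q -> 0 < N q.
Proof. by move=> [h _]; rewrite -rad_gt0E (lt_trans t0_gt0). Qed.

Let V : set R := [set t | t0 < t /\ t < T].

Let oV : open V.
Proof.
rewrite (_ : V = [set t | t0 < t] `&` [set t | t < T])//.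
by apply: openI; [exact: open_gt|exact: open_lt].
Qed.

Let cal1 t : V t -> {for t, continuous al1}.
Proof.
move=> [h1 h2]; apply/differentiable_continuous/derivable1_diffP.
by case: (dal1 h1 h2).
Qed.

Definition vfun q : R := al (rad q).

Let C1rad : C1on shell rad.
Proof. exact: C1on_subset shell_gauge4 C1on_rad. Qed.

Lemma C1on_vfun : C1on shell vfun.
Proof.
apply: (@C1on_comp_der R _ shell V al al1 rad open_shell oV C1rad (fun q h => h)
  _ cal1).
by move=> y [h1 h2]; exact: dal.
Qed.

Lemma dfield_vfun i c q : shell q ->
  dfield i c vfun q = al1 (rad q) * (dfield i c N q / (4 * rad q ^+ 3)).
Proof.
move=> sq; rewrite (is_derive_comp_dfield i c (dal sq.1 sq.2) (C1rad sq).1).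
by rewrite dfield_rad// shell_gauge4.
Qed.

(** The length of the horizontal gradient of [vfun] off the axis ([hgrad_norm_vfun]): [al1] times
    the length [rho / rad] of the gradient of the gauge. *)
Definition kap q : R := rho q * (al1 (rad q) * (rad q)^-1).

Lemma kap_gt0 q : shell_off q -> 0 < kap q.
Proof.
move=> [[h1 h2] Z0]; rewrite !mulr_gt0 ?sqrtr_gt0 ?al1_gt0// invr_gt0.
exact: lt_trans h1.
Qed.

Let sO : shell_off `<=` shell. Proof. by move=> q []. Qed.

Let C1rad' : C1on shell_off rad.
Proof. exact: C1on_subset sO C1rad. Qed.

Let C1rho' : C1on shell_off rho.
Proof. by apply: C1on_subset C1on_rho => q []. Qed.

Let C1al1 : C1on shell_off (fun q => al1 (rad q)).
Proof.
apply: (@C1on_comp_der R _ shell_off V al1 al2 rad open_shell_off oV C1rad'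
  (fun q h => h.1)) => y [h1 h2].
  exact: dal1.
exact: cal2.
Qed.

Let rad_pos q : shell_off q -> 0 < rad q.
Proof. by move=> [[h _] _]; exact: lt_trans h. Qed.

Let rho_pos q : shell_off q -> 0 < rho q.
Proof. by move=> [_ h]; rewrite sqrtr_gt0. Qed.

Let C1radV : C1on shell_off (fun q => (rad q)^-1).
Proof. by apply: C1on_inv => //; exact: open_shell_off. Qed.

Lemma C1on_kap : C1on shell_off kap.
Proof.
exact: (C1on_M open_shell_off C1rho' (C1on_M open_shell_off C1al1 C1radV)).
Qed.

Let C1phi : C1on shell_off (fun q => phi (kap q)).
Proof.
apply: (@C1on_comp_der R _ shell_off [set x | 0 < x] phi (derive1 phi) kap open_shell_off
  (@open_gt R 0) C1on_kap kap_gt0).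
  by move=> y y0; split; [exact: phi_derivable|rewrite derive1E].
exact: dphi_continuous.
Qed.

Let rrr q := rad q * rad q * rho q.

Let C1rrr : C1on shell_off rrr.
Proof.
exact: (C1on_M open_shell_off (C1on_M open_shell_off C1rad' C1rad') C1rho').
Qed.

Let rrr_pos q : shell_off q -> 0 < rrr q.
Proof. by move=> h; rewrite !mulr_gt0// ?rad_pos ?rho_pos. Qed.

(** In $kap^{-1}\varphi(kap)\nabla v$ the factor [al1] of the gradient cancels against the one in
    [kap]; what remains is this coefficient times a quarter of the gradient of the polynomial
    [gauge4]. *)
Definition flux_coef q : R := phi (kap q) * (rad q * rad q * rho q)^-1.

Lemma C1on_flux_coef : C1on shell_off flux_coef.
Proof.
exact: (C1on_M open_shell_off C1phi (C1on_inv open_shell_off C1rrr rrr_pos)).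
Qed.

Lemma dfield_inv i c (h : H -> R) q : h q != 0 -> differentiable h q ->
  dfield i c (fun x => (h x)^-1) q = - h q ^- 2 * dfield i c h q.
Proof. by move=> h0 dh; rewrite (is_derive_comp_dfield i c (is_derive_inv h0) dh). Qed.

Lemma dfield_kap i c q : shell_off q ->
  dfield i c kap q = al1 (rad q) / rad q * (dfield i c Z q / (2 * rho q)) +
   rho q * (al2 (rad q) / rad q - al1 (rad q) / (rad q) ^+ 2) * (dfield i c N q / (4 * rad q ^+ 3)).
Proof.
move=> sq; have [[h1 h2] Z0] := sq; have r0 := rad_pos sq.
have dr := (C1rad' sq).1.
rewrite /kap dfieldM; [|exact: (C1rho' sq).1|exact: (C1on_M open_shell_off C1al1 C1radV sq).1].
rewrite dfieldM; [|exact: (C1al1 sq).1|exact: (C1radV sq).1].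
rewrite (is_derive_comp_dfield i c (dal1 h1 h2) dr) dfield_inv ?gt_eqF//.
rewrite dfield_rad ?gauge4_gt0// dfield_rho//.
field; rewrite !gt_eqF//; exact: rho_pos.
Qed.

Lemma dfield_flux_coef i c q : shell_off q ->
  dfield i c flux_coef q = derive1 phi (kap q) * dfield i c kap q / (rad q ^+ 2 * rho q) -
   phi (kap q) * (2 * (dfield i c N q / (4 * rad q ^+ 3)) / (rad q ^+ 3 * rho q) +
                  dfield i c Z q / (2 * rho q) / (rad q ^+ 2 * rho q ^+ 2)).
Proof.
move=> sq; have [[h1 h2] Z0] := sq; have r0 := rad_pos sq; have rh0 := rho_pos sq.
have dr := (C1rad' sq).1; have dh := (C1rho' sq).1.
have k0 := kap_gt0 sq.
have dphi : is_derive (kap q) 1 phi (derive1 phi (kap q)).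
  by split; [exact: phi_derivable|rewrite derive1E].
rewrite /flux_coef dfieldM; [|exact: (C1phi sq).1|exact: (C1on_inv open_shell_off C1rrr rrr_pos sq).1].
rewrite (is_derive_comp_dfield i c dphi (C1on_kap sq).1).
rewrite dfield_inv; [|by rewrite gt_eqF//; exact: rrr_pos|exact: (C1rrr sq).1].
rewrite dfieldM; [|exact: (C1on_M open_shell_off C1rad' C1rad' sq).1|exact: dh].
rewrite dfieldM// dfield_rad ?gauge4_gt0// dfield_rho//.
by field; rewrite !gt_eqF.
Qed.

Definition fluxx j q : R := flux_coef q * (4^-1 * Xfield j N q).
Definition fluxy j q : R := flux_coef q * (4^-1 * Yfield j N q).

Lemma C1on_XN j : C1on setT (Xfield j N).
Proof.
rewrite (funext (X_gauge4 p j)); apply: (C1on_M openT (C1on_cst _)).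
exact: (C1on_D openT (C1on_M openT (C1on_zsq p) (C1on_zx p j))
  (C1on_M openT (C1on_zt p) (C1on_zy p j))).
Qed.

Lemma C1on_YN j : C1on setT (Yfield j N).
Proof.
rewrite (funext (Y_gauge4 p j)); apply: (C1on_M openT (C1on_cst _)).
exact: (C1on_B openT (C1on_M openT (C1on_zsq p) (C1on_zy p j))
  (C1on_M openT (C1on_zt p) (C1on_zx p j))).
Qed.

Let C1on4 h : C1on setT h -> C1on setT (fun q => 4^-1 * h q).
Proof. by move=> C1; exact: (C1on_M openT (C1on_cst _) C1). Qed.

Lemma C1on_fluxx j : C1on shell_off (fluxx j).
Proof.
exact: (C1on_M open_shell_off C1on_flux_coef (C1on_subset (@subsetT _ _) (C1on4 (C1on_XN j)))).
Qed.

Lemma C1on_fluxy j : C1on shell_off (fluxy j).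
Proof.
exact: (C1on_M open_shell_off C1on_flux_coef (C1on_subset (@subsetT _ _) (C1on4 (C1on_YN j)))).
Qed.

Lemma X_vfun j q : shell q -> Xfield j vfun q = al1 (rad q) * (Xfield j N q / (4 * rad q ^+ 3)).
Proof. by move=> sq; rewrite !XfieldE dfield_vfun. Qed.

Lemma Y_vfun j q : shell q -> Yfield j vfun q = al1 (rad q) * (Yfield j N q / (4 * rad q ^+ 3)).
Proof. by move=> sq; rewrite !YfieldE dfield_vfun. Qed.

Lemma fluxxE j q : shell_off q ->
  fluxx j q = (kap q)^-1 * phi (kap q) * Xfield j vfun q.
Proof.
move=> sq; have [[h1 h2] Z0] := sq; have a0 := al1_gt0 h1 h2.
rewrite X_vfun ?(sO sq)// /fluxx /flux_coef; set P := phi _; rewrite /kap.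
by field; rewrite !gt_eqF ?rad_pos ?rho_pos.
Qed.

Lemma fluxyE j q : shell_off q ->
  fluxy j q = (kap q)^-1 * phi (kap q) * Yfield j vfun q.
Proof.
move=> sq; have [[h1 h2] Z0] := sq; have a0 := al1_gt0 h1 h2.
rewrite Y_vfun ?(sO sq)// /fluxy /flux_coef; set P := phi _; rewrite /kap.
by field; rewrite !gt_eqF ?rad_pos ?rho_pos.
Qed.

Lemma hgrad_norm_vfun q : shell_off q -> hgrad_norm vfun q = kap q.
Proof.
move=> sq; have r0 := rad_pos sq.
rewrite /hgrad_norm -[RHS]gtr0_norm ?kap_gt0// -sqrtr_sqr; congr Num.sqrt.
rewrite /hgrad_dot (eq_bigr (fun j => (al1 (rad q) / (4 * rad q ^+ 3)) ^+ 2 *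
  (Xfield j N q * Xfield j N q + Yfield j N q * Yfield j N q))).
  rewrite -mulr_sumr sum_gauge4_gauge4 -rad4 -rho2 /kap.
  by field; rewrite gt_eqF.
by move=> j _; rewrite (X_vfun j (sO sq)) (Y_vfun j (sO sq)); ring.
Qed.

(** With [s = rho / rad] this is $s^2\varphi'\,al''+(2m+1)\,s\,\varphi/rad$, the radial form of the
    operator; the homogeneous dimension of the group is $2m+2$. *)
Definition radial_lap q : R := (rho q / rad q) ^+ 2 * derive1 phi (kap q) * al2 (rad q) +
  (2 * m%:R + 1) * (rho q / rad q ^+ 2) * phi (kap q).

Lemma div_flux q : shell_off q ->
  \sum_(j < m) (Xfield j (fluxx j) q + Yfield j (fluxy j) q) = radial_lap q.
Proof.
move=> sq; have r0 := rad_pos sq; have rh0 := rho_pos sq.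
(* [flux_coef] varies through [zsq] and [gauge4] alone, and [a], [b] are its derivatives with
   respect to them. The divergence then reduces to the three summed identities for these two
   polynomials. *)
pose a := derive1 phi (kap q) * (al1 (rad q) / rad q / (2 * rho q)) / (rad q ^+ 2 * rho q) -
  phi (kap q) / (2 * rho q) / (rad q ^+ 2 * rho q ^+ 2).
pose b := derive1 phi (kap q) * (rho q * (al2 (rad q) / rad q - al1 (rad q) / rad q ^+ 2) / (4 * rad q ^+ 3)) /
   (rad q ^+ 2 * rho q) - phi (kap q) * 2 / (4 * rad q ^+ 3) / (rad q ^+ 3 * rho q).
have dE i c : dfield i c flux_coef q = a * dfield i c Z q + b * dfield i c N q.
  rewrite dfield_flux_coef// dfield_kap// /a /b.
  by field; rewrite !gt_eqF.
have dXN j : differentiable (Xfield j N) q := (@C1on_XN j q Logic.I).1.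
have dYN j : differentiable (Yfield j N) q := (@C1on_YN j q Logic.I).1.
have dX j := (C1on4 (C1on_XN j) Logic.I).1 : differentiable _ q.
have dY j := (C1on4 (C1on_YN j) Logic.I).1 : differentiable _ q.
have df := (C1on_flux_coef sq).1.
have EX j : Xfield j (fluxx j) q = flux_coef q * (4^-1 * Xfield j (Xfield j N) q) +
    4^-1 * (a * (Xfield j Z q * Xfield j N q) + b * (Xfield j N q * Xfield j N q)).
  rewrite XfieldE (dfieldM _ _ df (dX j)) dE (dfieldZ _ _ _ (dXN j)).
  by rewrite -!XfieldE; ring.
have EY j : Yfield j (fluxy j) q = flux_coef q * (4^-1 * Yfield j (Yfield j N) q) +
    4^-1 * (a * (Yfield j Z q * Yfield j N q) + b * (Yfield j N q * Yfield j N q)).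
  rewrite YfieldE (dfieldM _ _ df (dY j)) dE (dfieldZ _ _ _ (dYN j)).
  by rewrite -!YfieldE; ring.
rewrite (eq_bigr (fun j => flux_coef q * 4^-1 * (Xfield j (Xfield j N) q + Yfield j (Yfield j N) q) +
   (4^-1 * a * (Xfield j Z q * Xfield j N q + Yfield j Z q * Yfield j N q) +
    4^-1 * b * (Xfield j N q * Xfield j N q + Yfield j N q * Yfield j N q)))); last first.
  by move=> j _; rewrite EX EY; ring.
rewrite !big_split /= -!mulr_sumr sublaplacian_gauge4 sum_zsq_gauge4 sum_gauge4_gauge4.
rewrite -rad4 -rho2 /radial_lap /flux_coef /a /b.
by field; rewrite !gt_eqF.
Qed.

End radial.

(** * The length of the horizontal gradient *)

Lemma le_sqrt_sum (R : rcfType) (I : finType) (a b : I -> R) j :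
  `|a j| <= Num.sqrt (\sum_k (a k * a k + b k * b k)) /\
  `|b j| <= Num.sqrt (\sum_k (a k * a k + b k * b k)).
Proof.
have h : a j ^+ 2 + b j ^+ 2 <= \sum_k (a k * a k + b k * b k).
  rewrite (bigD1 j)//= !expr2 lerDl; apply: sumr_ge0 => k _.
  by rewrite -!expr2 addr_ge0 ?sqr_ge0.
split; rewrite -sqrtr_sqr ler_wsqrtr//; apply: le_trans h.
  by rewrite lerDl sqr_ge0.
by rewrite lerDr sqr_ge0.
Qed.

Section horizontal_gradient.
Context {R : realType} {m : nat}.
Local Notation H := 'rV[R]_(m + m + 1).
Implicit Types (u v : H -> R) (q : H).

Lemma hgrad_dot_ge0 u q : 0 <= hgrad_dot u u q.
Proof. by apply: sumr_ge0 => j _; rewrite addr_ge0// -expr2 sqr_ge0. Qed.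

Lemma hgrad_norm_ge0 u q : 0 <= hgrad_norm u q.
Proof. exact: sqrtr_ge0. Qed.

Lemma hgrad_norm2 u q : hgrad_norm u q * hgrad_norm u q = hgrad_dot u u q.
Proof. by rewrite -expr2 sqr_sqrtr// hgrad_dot_ge0. Qed.

Lemma Xfield_le_norm u q j : `|Xfield j u q| <= hgrad_norm u q.
Proof. exact: (le_sqrt_sum (fun k => Xfield k u q) (fun k => Yfield k u q) j).1. Qed.

Lemma Yfield_le_norm u q j : `|Yfield j u q| <= hgrad_norm u q.
Proof. exact: (le_sqrt_sum (fun k => Xfield k u q) (fun k => Yfield k u q) j).2. Qed.

(** Cauchy-Schwarz, by expanding the sum of the squared components of $b\nabla u-a\nabla v$. The
    cases [a = 0] and [b = 0] are separate because [a * b] is divided out. *)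
Lemma hgrad_dot_le u v q : hgrad_dot u v q <= hgrad_norm u q * hgrad_norm v q.
Proof.
set a := hgrad_norm u q; set b := hgrad_norm v q.
have a0 : 0 <= a by exact: hgrad_norm_ge0.
have b0 : 0 <= b by exact: hgrad_norm_ge0.
have norm0 w : hgrad_norm w q = 0 -> (forall j, Xfield j w q = 0 /\ Yfield j w q = 0).
  move=> w0 j; split; apply/eqP; rewrite -normr_le0 -w0.
    exact: Xfield_le_norm.
  exact: Yfield_le_norm.
have [a00|a00] := eqVneq a 0.
  rewrite a00 mul0r /hgrad_dot big1// => j _.
  by have [-> ->] := norm0 u a00 j; rewrite !mul0r addr0.
have [b00|b00] := eqVneq b 0.
  rewrite b00 mulr0 /hgrad_dot big1// => j _.
  by have [-> ->] := norm0 v b00 j; rewrite !mulr0 addr0.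
have ab0 : 0 < a * b by rewrite mulr_gt0// lt0r ?a00 ?b00.
have E : \sum_(j < m) ((b * Xfield j u q - a * Xfield j v q) ^+ 2 +
    (b * Yfield j u q - a * Yfield j v q) ^+ 2) = 2 * (a * b) * (a * b - hgrad_dot u v q).
  rewrite (eq_bigr (fun j => b ^+ 2 * (Xfield j u q * Xfield j u q + Yfield j u q * Yfield j u q) +
   (a ^+ 2 * (Xfield j v q * Xfield j v q + Yfield j v q * Yfield j v q) +
    - (2 * a * b) * (Xfield j u q * Xfield j v q + Yfield j u q * Yfield j v q)))).
    rewrite !big_split /= -!mulr_sumr -/(hgrad_dot u u q) -/(hgrad_dot v v q) -/(hgrad_dot u v q).
    by rewrite -!hgrad_norm2 -/a -/b; ring.
  by move=> j _; ring.
rewrite -subr_ge0 -(pmulr_rge0 _ (mulr_gt0 (ltr0n _ 2) ab0)) -E.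
by apply: sumr_ge0 => j _; rewrite addr_ge0// sqr_ge0.
Qed.

Lemma continuous_hgrad_norm u : C1on setT u -> continuous (hgrad_norm u).
Proof.
move=> C1; have cd : continuous (hgrad_dot u u).
  apply: continuous_sum => j.
  have cX := @continuous_Xfield _ _ j _ C1; have cY := @continuous_Yfield _ _ j _ C1.
  exact: (continuousD_fun (continuousM_fun cX cX) (continuousM_fun cY cY)).
by move=> q; exact: (continuous_comp (cd q) (@sqrt_continuous R _)).
Qed.

End horizontal_gradient.

(** * Comparison with a strict supersolution *)

Section strict_comparison.
Context {R : realType} {m : nat}.
Local Notation H := 'rV[R]_(m + m + 1).
Implicit Types (h : H -> R) (q : H).

Lemma Rintegral_sum0 n B (I : Type) (r : seq I) (h : I -> 'rV[R]_n -> R) :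
  (forall j, continuous (h j)) -> (forall j, box_supported B (h j)) ->
  (forall j, \int[lebesgue_rV]_x h j x = 0) ->
  \int[lebesgue_rV]_x (\sum_(j <- r) h j x) = 0.
Proof.
move=> ch sh h0; elim: r => [|j r IH].
  by under eq_Rintegral do rewrite big_nil; rewrite /Rintegral integral0.
under eq_Rintegral do rewrite big_cons.
have s2 : box_supported B (fun x => \sum_(j <- r) h j x).
  by move=> x i Bx; apply: big1 => k _; exact: (sh k x i Bx).
have i1 := box_supported_integrable (ch j) (sh j).
have i2 := box_supported_integrable (@continuous_sum _ _ _ r h ch) s2.
by rewrite (RintegralD measurableT i1 i2) h0 add0r; exact: IH.
Qed.

Lemma Rintegral_partial_eq0 (i : 'I_(m + m + 1)) B h : C1on setT h -> box_supported B h ->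
  \int[lebesgue_rV]_q partial i h q = 0.
Proof.
move=> C1 sh; rewrite /Rintegral (@integral_partial_eq0 _ _ i (B + 1) h)//.
- by move=> q; apply: diff_derivable; exact: (C1 q Logic.I).1.
- by move=> q; exact: C1on_continuous C1 Logic.I.
- by move=> q; exact: (C1 q Logic.I).2.
- by apply: box_supportedS => q; exact: box_supported_off_cube.
- by apply: box_supportedS => q; exact: box_supported_partial.
Qed.

(** The coefficient of $\partial_t$ does not involve [t], so it can be moved under the derivative:
    the horizontal fields are divergence free. *)
Lemma Rintegral_dfield_eq0 (i k : 'I_(m + m + 1)) (a : R) B h : k != idx_t ->
  C1on setT h -> box_supported B h ->
  \int[lebesgue_rV]_q dfield i (a * q ord0 k) h q = 0.
Proof.
move=> kt C1 sh.
pose g q := (a * q ord0 k) * h q.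
have Ca : C1on setT (fun q : H => a * q ord0 k).
  exact: (C1on_M openT (C1on_cst _) (C1on_coord _)).
have C1g : C1on setT g by exact: (C1on_M openT Ca C1).
have sg : box_supported B g by move=> q j Bq; rewrite /g (sh _ _ Bq) mulr0.
have E q : dfield i (a * q ord0 k) h q = partial i h q + partial idx_t g q.
  rewrite /dfield /g partialM; [|exact: (Ca q Logic.I).1|exact: (C1 q Logic.I).1].
  congr (_ + _); rewrite partialM; [|exact: differentiable_cst|exact: differentiable_coordinate].
  by rewrite partial_cst partial_coord eq_sym (negbTE kt) !mulr0 addr0 mulr0 addr0.
under eq_Rintegral do rewrite E.
have int_p (j : 'I_(m + m + 1)) (f : H -> R) : C1on setT f -> box_supported B f ->
    lebesgue_rV.-integrable setT (EFin \o partial j f).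
  move=> Cf sf; apply: (@box_supported_integrable _ _ (B + 1)).
    by move=> q; exact: (Cf q Logic.I).2.
  by apply: box_supportedS => q; exact: box_supported_partial.
rewrite (RintegralD measurableT (int_p i h C1 sh) (int_p idx_t g C1g sg)).
by rewrite (Rintegral_partial_eq0 i C1 sh) (Rintegral_partial_eq0 idx_t C1g sg) addr0.
Qed.

Lemma Rintegral_Xfield_eq0 j B h : C1on setT h -> box_supported B h ->
  \int[lebesgue_rV]_q Xfield j h q = 0.
Proof. by apply: Rintegral_dfield_eq0; rewrite idx_yt. Qed.

Lemma Rintegral_Yfield_eq0 j B h : C1on setT h -> box_supported B h ->
  \int[lebesgue_rV]_q Yfield j h q = 0.
Proof.
move=> C1 sh; have := @Rintegral_dfield_eq0 (idx_y j) (idx_x j) (- 2) B h _ C1 sh.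
rewrite idx_xt => /(_ isT) <-; apply: eq_Rintegral => q _.
by rewrite YfieldE mulNr.
Qed.

Lemma flat1_der_ge0 (x : R) : 0 <= flat ('X^2 * (1 - deriv 1)) x.
Proof.
rewrite /flat; case: ifP => // x0.
by rewrite mulr_ge0 ?expR_ge0// derivC subr0 mulr1 hornerXn exprn_ge0// invr_ge0 ltW.
Qed.

Lemma flat1_le0 (x : R) : x <= 0 -> flat 1 x = 0.
Proof. by move=> x0; rewrite /flat ltNge x0. Qed.

Lemma flat1_gt0 (x : R) : 0 < x -> 0 < flat 1 x.
Proof. by move=> x0; rewrite /flat x0 hornerC mul1r expR_gt0. Qed.

Variables (Fx Fy : 'I_m -> H -> R) (w u v : H -> R) (gx gy : 'I_m -> H -> R).
Variables (O F : set H) (B c : R) (q0 : H).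
Hypothesis cFx : forall j, continuous (Fx j).
Hypothesis cFy : forall j, continuous (Fy j).
Hypothesis cw : continuous w.
Hypothesis weak : forall B zeta, 0 < B -> C1on setT zeta -> (forall q, 0 <= zeta q) ->
  box_supported B zeta -> \int[lebesgue_rV]_q pairing Fx Fy w zeta q <= 0.
Hypothesis C1u : C1on setT u.
Hypothesis oO : open O.
Hypothesis C1v : C1on O v.
Hypothesis C1gx : forall j, C1on O (gx j).
Hypothesis C1gy : forall j, C1on O (gy j).
Hypothesis closedF : closed F.
Hypothesis FO : F `<=` O.
Hypothesis B_gt0 : 0 < B.
Hypothesis F_cube : F `<=` cube _ B.
Hypothesis F_super : forall q, O q -> ~ F q -> u q - v q <= c.
Hypothesis mono : forall q, O q -> 0 <= \sum_(j < m)
  ((Fx j q - gx j q) * (Xfield j u q - Xfield j v q) +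
   (Fy j q - gy j q) * (Yfield j u q - Yfield j v q)).
Hypothesis strict : forall q, O q ->
  \sum_(j < m) (Xfield j (gx j) q + Yfield j (gy j) q) < w q.
Hypothesis Oq0 : O q0.
Hypothesis q0c : c < u q0 - v q0.

(* Tests the weak inequality with a smooth nonnegative nondecreasing function of
   [u - v - c]; the divergence of the flux of [v] is moved back by integration by parts. *)
Lemma strict_comparison : False.
Proof.
pose z q := flat 1 (u q - v q - c).
(* [v] is C^1 on [O] only, so the test function is cut off at [F]. This creates no jump, since on
   [O] outside [F] the argument of [flat 1] is nonpositive. *)
pose zeta q := if q \in F then z q else 0.
have zE q : O q -> zeta q = z q.
  move=> Oq; rewrite /zeta; case: ifPn => // /negP nF.
  rewrite /z flat1_le0// subr_le0; apply: F_super => // Fq; apply: nF; exact: mem_set.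
have z_ge0 q : 0 <= zeta q by rewrite /zeta; case: ifP => // _; exact: flat1_ge0.
have zF q : ~ F q -> zeta q = 0.
  by rewrite /zeta; case: ifPn => // /set_mem.
have C1w : C1on O (fun q => u q - v q - c).
  exact: (C1on_B oO (C1on_B oO (C1on_subset (@subsetT _ _) C1u) C1v) (C1on_cst _)).
have dz (y : R) : is_derive y 1 (flat 1) (flat ('X^2 * (1 - deriv 1)) y) by exact: is_derive_flat.
have C1zO : C1on O zeta.
  apply: (C1on_eq oO zE).
  apply: (@C1on_comp_der R _ O setT (flat 1) (flat ('X^2 * (1 - deriv 1))) _ oO openT C1w) => // y _.
  by apply/differentiable_continuous/derivable1_diffP; case: (is_derive_flat ('X^2 * (1 - deriv 1)) y).
have C1z : C1on setT zeta by exact: (C1on_glue oO closedF FO zF C1zO).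
have C1h (g : H -> R) : C1on O g -> C1on setT (fun q => g q * zeta q).
  move=> Cg; apply: (C1on_glue oO closedF FO _ (C1on_M oO Cg C1zO)) => q nF.
  by rewrite zF ?mulr0.
have bF h : (forall q, ~ F q -> h q = 0) -> box_supported (B + 1) h.
  by move=> h0; apply: box_supportedS => q nc; apply: h0 => /F_cube.
have sz : box_supported (B + 1) zeta by exact: bF zF.
have sh (g : H -> R) : box_supported (B + 1) (fun q => g q * zeta q).
  by apply: bF => q nF; rewrite zF ?mulr0.
have dF (g : H -> R) i k q : ~ F q -> dfield i k (fun q => g q * zeta q) q = 0.
  move=> nF; have gF q' : ~ F q' -> g q' * zeta q' = 0 by move=> nF'; rewrite zF ?mulr0.
  by rewrite /dfield !(partial_eq0 _ closedF gF nF) mulr0 addr0.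
have dzF i k q : ~ F q -> dfield i k zeta q = 0.
  by move=> nF; rewrite /dfield !(partial_eq0 _ closedF zF nF) mulr0 addr0.
pose hx j q := gx j q * zeta q; pose hy j q := gy j q * zeta q.
have C1hx j : C1on setT (hx j) by exact: C1h.
have C1hy j : C1on setT (hy j) by exact: C1h.
(* The divergence of [zeta] times the flux of [v]. Its integral is 0, so subtracting it in [P] does
   not change the integral of the pairing. *)
pose Q q := \sum_(j < m) (Xfield j (hx j) q + Yfield j (hy j) q).
pose P q := pairing Fx Fy w zeta q - Q q.
have cXY j : continuous (fun q => Xfield j (hx j) q + Yfield j (hy j) q).
  exact: (continuousD_fun (continuous_Xfield (C1hx j)) (continuous_Yfield (C1hy j))).
have cQ : continuous Q by exact: continuous_sum.
have cp : continuous (pairing Fx Fy w zeta) by exact: continuous_pairing.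
have cP : continuous P by exact: (continuousD_fun cp (continuousN_fun cQ)).
have QF q : ~ F q -> Q q = 0.
  by move=> nF; apply: big1 => j _; rewrite XfieldE YfieldE !dF// addr0.
have pF q : ~ F q -> pairing Fx Fy w zeta q = 0.
  move=> nF; rewrite /pairing zF// mulr0 addr0; apply: big1 => j _.
  by rewrite XfieldE YfieldE !dzF// !mulr0 addr0.
have PF q : ~ F q -> P q = 0 by move=> nF; rewrite /P QF// pF// subrr.
have sP : box_supported (B + 1) P by exact: bF.
have sp : box_supported (B + 1) (pairing Fx Fy w zeta) by exact: bF.
have sQ : box_supported (B + 1) Q by exact: bF.
have PO q : O q -> zeta q * (w q - \sum_(j < m) (Xfield j (gx j) q + Yfield j (gy j) q)) <= P q.
  move=> Oq.
  have du : differentiable u q by exact: (C1u Logic.I).1.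
  have dv : differentiable v q by exact: (C1v Oq).1.
  have dzt : differentiable zeta q by exact: (C1z q Logic.I).1.
  have duv : differentiable (fun q => u q - v q) q by exact: (differentiableB du dv).
  have dw : differentiable (fun q => u q - v q - c) q by exact: (C1w _ Oq).1.
  set k := flat ('X^2 * (1 - deriv 1)) (u q - v q - c).
  have dzE i e : dfield i e zeta q = k * (dfield i e u q - dfield i e v q).
    have pE j : partial j zeta q = partial j z q.
      by apply: near_eq_derive; apply: filterS (open_nbhs_nbhs (conj oO Oq)) => x; exact: zE.
    have -> : dfield i e zeta q = dfield i e z q by rewrite /dfield !pE.
    rewrite (is_derive_comp_dfield i e (dz _) dw) -/k; congr (_ * _).
    rewrite dfieldD//.
    by rewrite dfield_cst addr0 dfieldD ?dfieldN//; exact: differentiableN.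
  have hE i e (g : H -> R) : differentiable g q ->
      dfield i e (fun q => g q * zeta q) q = g q * dfield i e zeta q + zeta q * dfield i e g q.
    by move=> dg; rewrite dfieldM.
  (* On [O] the gradient of [zeta] is $k(\nabla u-\nabla v)$ with $k\ge 0$, so the difference is [k]
     times the monotonicity sum. *)
  rewrite -subr_ge0 (_ : P q - _ = k * \sum_(j < m)
     ((Fx j q - gx j q) * (Xfield j u q - Xfield j v q) +
      (Fy j q - gy j q) * (Yfield j u q - Yfield j v q))).
    by rewrite mulr_ge0// ?flat1_der_ge0// mono.
  have E : k * \sum_(j < m) ((Fx j q - gx j q) * (Xfield j u q - Xfield j v q) +
      (Fy j q - gy j q) * (Yfield j u q - Yfield j v q)) =
    \sum_(j < m) (Fx j q * Xfield j zeta q + Fy j q * Yfield j zeta q) - Q q +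
    zeta q * \sum_(j < m) (Xfield j (gx j) q + Yfield j (gy j) q).
    rewrite !mulr_sumr -sumrB -big_split /=; apply: eq_bigr => j _.
    rewrite !XfieldE !YfieldE (hE _ _ _ (C1gx j Oq).1) (hE _ _ _ (C1gy j Oq).1).
    by rewrite !dzE; ring.
  by rewrite E /P /pairing; ring.
have P_ge0 q : 0 <= P q.
  have [/FO Oq|nF] := pselect (F q); last by rewrite PF.
  by apply: le_trans (PO q Oq); rewrite mulr_ge0// subr_ge0 ltW// strict.
have P_gt0 : 0 < P q0.
  apply: lt_le_trans (PO q0 Oq0); rewrite mulr_gt0 ?subr_gt0 ?strict//.
  by rewrite zE// flat1_gt0// subr_gt0.
have := integral_gt0 cP sP P_ge0 P_gt0.
rewrite /P RintegralB//; [|exact: box_supported_integrable sp|exact: box_supported_integrable sQ].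
rewrite (_ : \int[lebesgue_rV]_q Q q = 0); last first.
  apply: (@Rintegral_sum0 _ (B + 1 + 1)) => // j.
    apply: box_supportedS => q nq.
    by rewrite (Xfield_off_cube _ (sh (gx j)) nq) (Yfield_off_cube _ (sh (gy j)) nq) addr0.
  have iX (g : H -> R) : continuous g -> (forall q, ~ cube _ (B + 1) q -> g q = 0) ->
      lebesgue_rV.-integrable setT (EFin \o g).
    by move=> cg g0; exact: box_supported_integrable cg (box_supportedS g0).
  have i1 := iX _ (@continuous_Xfield _ _ j _ (C1hx j)) (fun q nq => Xfield_off_cube _ (sh (gx j)) nq).
  have i2 := iX _ (@continuous_Yfield _ _ j _ (C1hy j)) (fun q nq => Yfield_off_cube _ (sh (gy j)) nq).
  rewrite (RintegralD measurableT i1 i2).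
  rewrite (Rintegral_Xfield_eq0 _ (C1hx j) (sh (gx j))).
  by rewrite (Rintegral_Yfield_eq0 _ (C1hy j) (sh (gy j))) addr0.
rewrite subr0 ltNge => /negP; apply; apply: (@weak (B + 1)) => //.
exact: addr_gt0.
Qed.

End strict_comparison.

Section rad_sublevel.
Context {R : realType}.

Lemma partial_max0 n (O : set 'rV[R]_n) (h : 'rV[R]_n -> R) q i : open O -> O q ->
  (forall x, O x -> differentiable h x) -> (forall x, O x -> h x <= h q) ->
  partial i h q = 0.
Proof.
move=> oO Oq dh hq; pose e : 'rV[R]_n := delta_mx ord0 i.
pose g (t : R) := t *: e + q.
have g0 : g 0 = q by rewrite /g scale0r add0r.
have cg : {for 0, continuous g}.
  apply: (@continuousD _ _ _ (fun t : R => t *: e) (fun=> q)); last exact: cst_continuous.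
  exact: scalel_continuous.
have : \forall t \near (0 : R), O (g t).
  by apply: cg; rewrite g0; exact: open_nbhs_nbhs.
move=> /nbhs_ballP[d /= d0 Hd].
have gO t : t \in `](- d), d[%R -> O (g t).
  move=> td; apply: Hd; rewrite /ball /= sub0r normrN ltr_norml.
  by move: td; rewrite in_itv.
have dg t : t \in `](- d), d[%R -> is_derive t 1 (h \o g) (partial i h (g t)).
  move=> /gO Ot; apply: (derivable_comp_affine (w := e)); last exact/diff_derivable/dh.
  move=> a; transitivity ((a * 1 + t) *: e + q); first by [].
  by rewrite mulr1 scalerDl addrA.
have d00 : (0 : R) \in `](- d), d[%R by rewrite in_itv/= oppr_lt0 d0.
have H0 : is_derive (0 : R) 1 (h \o g) 0.
  apply: (@derive1_at_max _ (h \o g) (- d) d).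
  - by rewrite -subr_ge0 opprK addr_ge0// ltW.
  - by move=> t /dg [].
  - exact: d00.
  - by move=> t /gO Ot /=; rewrite g0; exact: hq.
have [_ E1] := dg _ d00; have [_ E2] := H0.
by rewrite -E2 E1 g0.
Qed.

Lemma open_superlevel_on (T : topologicalType) (O : set T) (g : T -> R) : open O ->
  (forall q, O q -> {for q, continuous g}) -> open (O `&` [set q | 0 < g q]).
Proof.
move=> oO cg; rewrite openE => q [Oq gq]; apply: filterI; first exact: open_nbhs_nbhs.
by apply: (cvgr_gt _ (cg q Oq)).
Qed.

Variable m : nat.
Local Notation H := 'rV[R]_(m + m + 1).

(** The gauge bounds the horizontal coordinates of $p^{-1}\circ q$ by $t$ and the vertical one by
    $t^2$. Passing from the latter to the Euclidean difference costs the twist of the group law, at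
    most $4mPt$. *)
Lemma rad_dist (P t : R) (p q : H) i : cube _ P p -> rad p q <= t ->
  `|q ord0 i - p ord0 i| <= t ^+ 2 + t + 4 * m%:R * P * t.
Proof.
move=> Pp rt.
have P0 : 0 <= P by apply: le_trans (Pp idx_t).
have t0 : 0 <= t by apply: le_trans rt; exact: rad_ge0.
have rho_t : rho p q <= t by apply: le_trans rt; exact: rho_le_rad.
have rho_zx j : `|zx p j q| <= t.
  exact: le_trans (le_sqrt_sum (zx p ^~ q) (zy p ^~ q) j).1 rho_t.
have rho_zy j : `|zy p j q| <= t.
  exact: le_trans (le_sqrt_sum (zx p ^~ q) (zy p ^~ q) j).2 rho_t.
have zt_t : `|zt p q| <= t ^+ 2.
  apply: (@le_trans _ _ (rad p q ^+ 2)); last by rewrite lerXn2r ?nnegrE ?rad_ge0.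
  rewrite sqr_sqrtr ?sqrtr_ge0// -sqrtr_sqr ler_wsqrtr// /gauge4 -expr2 lerDr.
  exact: sqr_ge0.
have mPt : 0 <= 4 * m%:R * P * t by rewrite !mulr_ge0.
have t_le : t <= t ^+ 2 + t + 4 * m%:R * P * t.
  by rewrite -addrA addrCA lerDl addr_ge0// sqr_ge0.
case: (idx_cases i) => [[j ->]|[j ->]|->].
- by apply: le_trans (rho_zx j) t_le.
- by apply: le_trans (rho_zy j) t_le.
have -> : q ord0 idx_t - p ord0 idx_t = zt p q -
   2 * \sum_(j < m) (p ord0 (idx_x j) * zy p j q - p ord0 (idx_y j) * zx p j q).
  rewrite /zt -addrA -mulrBr -sumrB big1 ?mulr0 ?addr0// => j _.
  by rewrite /zx /zy; ring.
apply: (@le_trans _ _ (t ^+ 2 + 4 * m%:R * P * t)); last by rewrite lerD2r lerDl.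
rewrite (le_trans (ler_normB _ _))// lerD// normrM normr_nat.
have -> : 4 * m%:R * P * t = 2 * \sum_(j < m) (P * t + P * t).
  by rewrite sumr_const card_ord -mulr_natr; ring.
rewrite ler_wpM2l// (le_trans (ler_norm_sum _ _ _))// ler_sum// => j _.
by rewrite (le_trans (ler_normB _ _))// !normrM lerD// ler_pM// ?Pp.
Qed.

Lemma rad_le_cube (P t : R) : exists B, forall p : H, cube _ P p ->
  forall q, rad p q <= t -> cube _ B q.
Proof.
exists (t ^+ 2 + t + 4 * m%:R * P * t + P) => p Pp q rt i.
rewrite -[q ord0 i](subrK (p ord0 i)) (le_trans (ler_normD _ _))// lerD ?Pp//.
exact: rad_dist.
Qed.

End rad_sublevel.

(** * Maximum points on the vertical axis *)

Section axis_trick.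
Context {R : realType} {m : nat}.
Local Notation H := 'rV[R]_(m + m + 1).
Implicit Types (p q : H).

(** The two relative positions are inverse to each other, and the gauge is invariant under
    inversion. *)
Lemma radC p q : rad p q = rad q p.
Proof.
rewrite /rad; congr (Num.sqrt (Num.sqrt _)).
have Z : zsq p q = zsq q p by apply: eq_bigr => j _; rewrite /zx /zy; ring.
have S : \sum_(j < m) (p ord0 (idx_x j) * q ord0 (idx_y j) - p ord0 (idx_y j) * q ord0 (idx_x j)) =
  - \sum_(j < m) (q ord0 (idx_x j) * p ord0 (idx_y j) - q ord0 (idx_y j) * p ord0 (idx_x j)).
  by rewrite -sumrN; apply: eq_bigr => j _; ring.
by rewrite /gauge4 Z /zt S; ring.
Qed.

(* Moving the centre from [p] to [p'] changes the coordinates of a point of the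
   vertical axis through [p] by those of [p^-1 p']. *)
Lemma gauge4_axis p p' q : zsq p q = 0 ->
  gauge4 p' q = zsq p p' ^+ 2 + (zt p q - zt p p') ^+ 2.
Proof.
move=> Z0.
have qE j : q ord0 (idx_x j) = p ord0 (idx_x j) /\ q ord0 (idx_y j) = p ord0 (idx_y j).
  have nn k : true -> 0 <= zx p k q * zx p k q + zy p k q * zy p k q.
    by move=> _; rewrite addr_ge0// -expr2 sqr_ge0.
  have /(_ j isT)/eqP := (psumr_eq0P nn Z0).
  rewrite paddr_eq0 -?expr2 ?sqr_ge0// !sqrf_eq0 !subr_eq0 => /andP[/eqP ? /eqP ?].
  by split.
have Zp : zsq p' q = zsq p p'.
  by apply: eq_bigr => j _; rewrite /zx /zy !(qE j).1 !(qE j).2; ring.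
have t1 : zt p q = q ord0 idx_t - p ord0 idx_t.
  rewrite /zt big1 ?mulr0 ?addr0// => j _.
  by rewrite !(qE j).1 !(qE j).2 mulrC subrr.
have t2 : zt p' q = zt p q - zt p p'.
  have S : \sum_(j < m) (p' ord0 (idx_x j) * q ord0 (idx_y j) - p' ord0 (idx_y j) * q ord0 (idx_x j)) =
    - \sum_(j < m) (p ord0 (idx_x j) * p' ord0 (idx_y j) - p ord0 (idx_y j) * p' ord0 (idx_x j)).
    by rewrite -sumrN; apply: eq_bigr => j _; rewrite !(qE j).1 !(qE j).2; ring.
  by rewrite t1 /zt S; ring.
by rewrite /gauge4 Zp t2; ring.
Qed.

Section translated.
Variables (p : H) (j0 : 'I_m).

(** A Euclidean displacement, not a group translation: whether a step between two such points is
    horizontal has to be read off from [zt_translated]. *)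
Definition translated (a b c : R) : H := \row_i (p ord0 i + (i == idx_x j0)%:R * a +
  (i == idx_y j0)%:R * b + (i == idx_t)%:R * c).

Lemma translated0 : translated 0 0 0 = p.
Proof. by apply/rowP => i; rewrite mxE !mulr0 !addr0. Qed.

Lemma translated_x a b c j : translated a b c ord0 (idx_x j) = p ord0 (idx_x j) + (j == j0)%:R * a.
Proof. by rewrite mxE idx_xx idx_xy idx_xt !mul0r !addr0. Qed.

Lemma translated_y a b c j : translated a b c ord0 (idx_y j) = p ord0 (idx_y j) + (j == j0)%:R * b.
Proof. by rewrite mxE idx_yx idx_yy idx_yt !mul0r !addr0. Qed.

Lemma translated_t a b c : translated a b c ord0 idx_t = p ord0 idx_t + c.
Proof. by rewrite mxE idx_tx idx_ty eqxx !mul0r !addr0 mul1r. Qed.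

Lemma translated_dist a b c d : `|a| <= d -> `|b| <= d -> `|c| <= d ->
  forall i, `|translated a b c ord0 i - p ord0 i| <= d.
Proof.
move=> ad bd cd i; have d0 := le_trans (normr_ge0 _) ad.
case: (idx_cases i) => [[j ->]|[j ->]|->].
- rewrite translated_x addrC addKr; case: (j == j0); first by rewrite mul1r.
  by rewrite mul0r normr0.
- rewrite translated_y addrC addKr; case: (j == j0); first by rewrite mul1r.
  by rewrite mul0r normr0.
- by rewrite translated_t addrC addKr.
Qed.

Lemma zsq_translated a b c a' b' c' :
  zsq (translated a b c) (translated a' b' c') = (a' - a) ^+ 2 + (b' - b) ^+ 2.
Proof.
rewrite /zsq (bigD1 j0)//= big1 ?addr0.
  by rewrite /zx /zy !translated_x !translated_y eqxx !mul1r; ring.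
move=> j /negbTE jj; rewrite /zx /zy !translated_x !translated_y jj !mul0r; ring.
Qed.

Lemma zt_translated a b c a' b' c' : zt (translated a b c) (translated a' b' c') =
  c' - c + 2 * ((p ord0 (idx_x j0) + a) * (p ord0 (idx_y j0) + b') -
                (p ord0 (idx_y j0) + b) * (p ord0 (idx_x j0) + a')).
Proof.
rewrite /zt (bigD1 j0)//= big1 ?addr0.
  by rewrite !translated_t !translated_x !translated_y eqxx !mul1r; ring.
move=> j /negbTE jj; rewrite !translated_x !translated_y jj !mul0r; ring.
Qed.

End translated.

Variables (u : H -> R) (al al1 al2 : R -> R) (t0 s1 t1 T eta : R).
Hypothesis t0_gt0 : 0 < t0.
Hypothesis t0s1 : t0 < s1.
Hypothesis t1T : t1 < T.
Hypothesis dal : forall t : R, t0 < t -> t < T -> is_derive t 1 al (al1 t).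
Hypothesis dal1 : forall t : R, t0 < t -> t < T -> is_derive t 1 al1 (al2 t).
Hypothesis al1_gt0 : forall t, t0 < t -> t < T -> 0 < al1 t.
Hypothesis al2_ge0 : forall t, t0 < t -> t < T -> 0 <= al2 t.
Hypothesis al_eta : forall t, t0 < t -> t <= t1 -> al t <= eta.
Hypothesis al_blowup : forall B, exists2 T', t0 < T' < T &
  forall t, T' < t -> t < T -> B < al t.
Hypothesis cu : continuous u.
Hypothesis axis_max : forall p qb, s1 <= rad p qb -> rad p qb < T ->
  al (rad p qb) < u qb -> (forall q, rad p q <= s1 -> u q < u qb - al (rad p qb)) ->
  exists q, [/\ s1 < rad p q, rad p q < T, zsq p q = 0,
    u qb - al (rad p qb) <= u q - al (rad p q) &
    forall q', s1 <= rad p q' -> rad p q' < T -> u q' - al (rad p q') <= u q - al (rad p q)].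
Variables (p qb : H) (d : R) (j0 : 'I_m).
Hypothesis d_gt0 : 0 < d.
Hypothesis eta_gt0 : 0 < eta.
Hypothesis eta_lt : eta < u qb.
Hypothesis near_p : forall p', (forall i, `|p' ord0 i - p ord0 i| <= d) ->
  rad p' qb <= t1 /\ forall q, rad p' q <= s1 -> u q < u qb - eta.

Lemma MVT_bounds (g g1 : R -> R) a b : (forall t : R, t0 < t -> t < T -> is_derive t 1 g (g1 t)) ->
  t0 < a -> a < b -> b < T -> exists2 c, a < c < b & g b - g a = g1 c * (b - a).
Proof.
move=> dg ta ab bT.
have dab x : a <= x -> x <= b -> is_derive x 1 g (g1 x).
  by move=> ax xb; apply: dg; [exact: lt_le_trans ax|exact: le_lt_trans bT].
have [x||c cab E] := @MVT R g g1 a b ab.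
- by rewrite in_itv/= => /andP[/ltW ax /ltW xb]; exact: dab.
- apply: continuous_in_subspaceT => x; rewrite inE /= in_itv/= => /andP[ax xb].
  by apply/differentiable_continuous/derivable1_diffP; case: (dab x ax xb).
by exists c => //; move: cab; rewrite in_itv.
Qed.

Lemma al1_le a b : t0 < a -> a <= b -> b < T -> al1 a <= al1 b.
Proof.
move=> ta; rewrite le_eqVlt => /orP[/eqP ->//|ab] bT.
have [c /andP[ac cb] E] := MVT_bounds dal1 ta ab bT.
rewrite -subr_ge0 E mulr_ge0 ?subr_ge0 ?(ltW ab)// al2_ge0//; [exact: lt_trans ac|exact: lt_trans bT].
Qed.

Lemma al_secant a b : t0 < a -> a <= b -> b < T ->
  al1 a * (b - a) <= al b - al a /\ al b - al a <= al1 b * (b - a).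
Proof.
move=> ta; rewrite le_eqVlt => /orP[/eqP ->|ab] bT; first by rewrite !subrr !mulr0.
have [c /andP[ac cb] ->] := MVT_bounds dal ta ab bT.
split; rewrite ler_pM2r ?subr_gt0// al1_le ?(ltW ac) ?(ltW cb)//.
  exact: lt_trans bT.
exact: lt_trans ac.
Qed.

Definition close p' := forall i, `|p' ord0 i - p ord0 i| <= d.

(** As [al] is at most [eta] at [rad p' qb], the difference at [qb] is positive and exceeds [u] on
    the inner ball around every close centre, so [axis_max] applies to each of them. *)
Lemma close_axis p' : close p' -> exists q,
  [/\ s1 < rad p' q, rad p' q < T, zsq p' q = 0, 0 < u q - al (rad p' q) &
    forall q', s1 <= rad p' q' -> rad p' q' < T -> u q' - al (rad p' q') <= u q - al (rad p' q)].
Proof.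
move=> cp; have [h1 h2] := near_p cp.
have sqb : s1 <= rad p' qb.
  by rewrite leNgt; apply/negP => /ltW/h2; rewrite ltNge gerBl (ltW eta_gt0).
have tqb : t0 < rad p' qb by exact: lt_le_trans sqb.
have ale := al_eta tqb h1.
have [|q Hq|q [k1 k2 k3 k4 k5]] := axis_max sqb (le_lt_trans h1 t1T).
- exact: le_lt_trans eta_lt.
- by apply: lt_le_trans (h2 q Hq) _; rewrite lerD2l lerN2.
exists q; split => //; apply: lt_le_trans k4; rewrite subr_gt0.
exact: le_lt_trans eta_lt.
Qed.

(** A lower bound for the maximum of the difference around [p'], phrased so that it can be handed
    from one centre to the next. *)
Definition attains p' c := exists q,
  [/\ s1 <= rad p' q, rad p' q < T & c <= u q - al (rad p' q)].

Section horizontal_step.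
Variables (T1 T2 h : R).
Hypothesis T2T : T2 < T.
Hypothesis close_T1 : forall p' q, close p' -> rad p' q < T -> 0 < u q - al (rad p' q) ->
  rad p' q <= T1.
Hypothesis h_small : h ^+ 4 / s1 ^+ 3 <= T2 - T1.

Let s1_gt0 : 0 < s1. Proof. exact: lt_trans t0s1. Qed.

(** The bound may be transferred to a maximum point on the axis of [p'], where the fourth power of
    the gauge grows by exactly [h ^+ 4]. As the gauge is at least [s1] there, it grows by at most
    [h ^+ 4 / s1 ^+ 3], and convexity bounds the loss through the slope at [T2]. *)
Lemma horizontal_step p' p'' c : close p' -> zsq p' p'' = h ^+ 2 -> zt p' p'' = 0 ->
  attains p' c -> attains p'' (c - al1 T2 / s1 ^+ 3 * h ^+ 4).
Proof.
move=> cp Z0 t00 [q' [h1 h2 h3]].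
have [q [k1 k2 k3 k4 k5]] := close_axis cp.
have cq := le_trans h3 (k5 q' h1 h2).
have rT1 := close_T1 cp k2 k4.
set r := rad p' q in k1 k2 k4 cq rT1 *; set r' := rad p'' q.
have r0 : 0 <= r by exact: rad_ge0.
have r'0 : 0 <= r' by exact: rad_ge0.
have E : r' ^+ 4 - r ^+ 4 = h ^+ 4.
  by rewrite !rad4 (gauge4_axis p'' k3) Z0 t00 /gauge4 k3; ring.
have rr' : r <= r'.
  rewrite -(@ler_pXn2r _ 4)// -subr_ge0 E.
  by rewrite (exprM _ 2 2) sqr_ge0.
have step : r' - r <= h ^+ 4 / s1 ^+ 3.
  rewrite ler_pdivlMr ?exprn_gt0// -E.
  have -> : r' ^+ 4 - r ^+ 4 = (r' - r) * ((r' + r) * (r' ^+ 2 + r ^+ 2)) by ring.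
  rewrite ler_wpM2l ?subr_ge0//.
  have -> : s1 ^+ 3 = s1 * s1 ^+ 2 by ring.
  have s1r := ltW k1; rewrite ler_pM ?(ltW s1_gt0) ?sqr_ge0//.
    by rewrite ler_wpDl.
  by rewrite ler_wpDl ?sqr_ge0// lerXn2r ?nnegrE ?(ltW s1_gt0).
have r'T2 : r' <= T2.
  have := le_trans step h_small; rewrite lerBlDr => /le_trans; apply.
  by rewrite -lerBrDl opprB addrCA subrr addr0.
exists q; split; first exact: le_trans (ltW k1) rr'.
  exact: le_lt_trans T2T.
have tr : t0 < r by exact: lt_trans k1.
have [_ Hal] := al_secant tr rr' (le_lt_trans r'T2 T2T).
have loss : al r' - al r <= al1 T2 / s1 ^+ 3 * h ^+ 4.
  apply: le_trans Hal _; rewrite -mulrA [_^-1 * _]mulrC.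
  apply: ler_pM => //.
  - by rewrite ltW// al1_gt0//; [exact: lt_le_trans rr'|exact: le_lt_trans T2T].
  - by rewrite subr_ge0.
  - by apply: al1_le => //; exact: lt_le_trans rr'.
by move: loss cq; rewrite -/r'; lra.
Qed.

End horizontal_step.

Lemma small_step (A1 A2 A3 A4 : R) : 0 <= A1 -> 0 <= A2 -> 0 <= A3 -> 0 <= A4 ->
  exists h, [/\ 0 < h, h <= 1, h * A1 < 1, h * A2 < 1 & h * A3 < 1 /\ h * A4 < 1].
Proof.
move=> a1 a2 a3 a4; exists (1 + A1 + A2 + A3 + A4)^-1.
have S0 : 0 < 1 + A1 + A2 + A3 + A4 by lra.
rewrite invr_gt0 S0 invf_le1//; split => //; [lra| | |split];
  by rewrite mulrC ltr_pdivrMr// mul1r; lra.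
Qed.

(* The four horizontal steps around a square of side [h] return to the centre up to
   a vertical shift of size [4 h^2]. Undoing that shift first gains a multiple of
   [h^2], while each horizontal step only loses a multiple of [h^4]. *)
Lemma axis_trick : False.
Proof.
have s1_gt0 : 0 < s1 by exact: lt_trans t0s1.
have cp : close p by move=> i; rewrite subrr normr0 ltW.
have [q0 [k1 k2 k3 k4 k5]] := close_axis cp.
set r0 := rad p q0 in k1 k2 k4 k5; set s := zt p q0.
have r00 : 0 < r0 by exact: lt_trans k1.
have s2 : s ^+ 2 = r0 ^+ 4 by rewrite rad4 /gauge4 k3 -/s; ring.
(* On the axis the squared gauge is the absolute value of [zt]. The sign [sg] tells on which side of
   the centre [q0] lies; the centre will be shifted towards it. *)
have [sg sg2 sE] : exists2 sg : R, sg ^+ 2 = 1 & s = sg * r0 ^+ 2.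
  have : (s - r0 ^+ 2) * (s + r0 ^+ 2) = 0.
    by rewrite -subr_sqr s2 -exprM subrr.
  move=> /eqP; rewrite mulf_eq0 => /orP[|] /eqP E.
    by exists 1; rewrite ?expr1n// mul1r; apply/eqP; rewrite -subr_eq0 E.
  by exists (- 1); rewrite ?sqrrN ?expr1n// mulN1r; apply/eqP; rewrite -addr_eq0 E.
have sgn : `|sg| = 1.
  by apply/eqP; rewrite -(@eqrXn2 _ 2)// expr1n real_normK ?num_real// sg2.
have [T1 tT1 close_T1] : exists2 T1, t0 < T1 < T & forall p' q, close p' ->
    rad p' q < T -> 0 < u q - al (rad p' q) -> rad p' q <= T1.
  have [B HB] := @rad_le_cube R m (`|p| + d) T.
  have [M M0 HM] := cube_bounded B cu.
  have [T1 tT1 HT1] := al_blowup M.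
  exists T1 => // p' q cp' rT; rewrite subr_gt0 => au; rewrite leNgt; apply/negP => Tr.
  have := lt_trans (HT1 _ Tr rT) au; rewrite ltNge => /negP; apply.
  apply: le_trans (ler_norm _) _; apply: HM; apply: (HB p'); last exact: ltW.
  move=> i; rewrite -[p' ord0 i](subrK (p ord0 i)) (le_trans (ler_normD _ _))//.
  by rewrite addrC lerD ?coord_le_norm.
have /andP[tT1' T1T] := tT1.
(* [T1] bounds the gauge wherever the difference is positive, for all close centres at once; the
   midpoint [T2] leaves room for the horizontal steps before the blow-up. *)
have [T12 T2T] := midf_lt T1T; set T2 := (T1 + T) / 2 in T12 T2T.
have tT2 : t0 < T2 by exact: lt_trans T12.
pose K := al1 T2 / s1 ^+ 3.
have K0 : 0 < K by rewrite divr_gt0 ?exprn_gt0// al1_gt0.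
have s1T : s1 < T by exact: lt_trans k2.
(* The vertical shift lowers the squared gauge of [q0] by [4 * h ^+ 2], hence the gauge by at least
   [2 * h ^+ 2 / r0], and the slope of [al] is at least [al1 s1] there. The gain is thus at least
   [g * h ^+ 2]. *)
pose g := al1 s1 * 2 / r0.
have g0 : 0 < g by rewrite !mulr_gt0 ?invr_gt0 ?al1_gt0.
have rs : 0 < r0 ^+ 2 - s1 ^+ 2.
  by rewrite subr_gt0 ltrXn2r// ltW.
set x := p ord0 (idx_x j0); set y := p ord0 (idx_y j0).
have x0 := normr_ge0 x; have y0 := normr_ge0 y.
(* The four conditions on [h] keep the corners close to [p], keep [q0] outside the inner radius [s1]
   after the shift, keep the steps below [T2], and make the gain exceed the four losses. *)
have [|||| h [h0 h1 ha1 ha2 [ha3 ha4]]] := @small_step ((4 + 2 * `|x| + 2 * `|y|) / d)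
  (4 / (r0 ^+ 2 - s1 ^+ 2)) (((s1 ^+ 3) * (T2 - T1))^-1) (4 * K / g).
- by rewrite divr_ge0 ?(ltW d_gt0)//; lra.
- by rewrite divr_ge0// ltW.
- by rewrite invr_ge0 mulr_ge0 ?exprn_ge0 ?(ltW s1_gt0)// subr_ge0 ltW.
- by rewrite divr_ge0 ?(ltW g0)// mulr_ge0// ltW.
have hd : h * (4 + 2 * `|x| + 2 * `|y|) <= d.
  by move: ha1; rewrite mulrA ltr_pdivrMr// mul1r => /ltW.
have h2h : h ^+ 2 <= h by rewrite expr2 ler_piMr// ltW.
have h4h : h ^+ 4 <= h.
  by rewrite (exprM _ 2 2) (le_trans _ h2h)// expr2 ler_piMr ?sqr_ge0// (le_trans h2h).
have hv : 4 * h ^+ 2 <= r0 ^+ 2 - s1 ^+ 2.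
  move: ha2; rewrite mulrA ltr_pdivrMr// mul1r mulrC => /ltW; apply: le_trans.
  by rewrite ler_wpM2l.
have hT : h ^+ 4 / s1 ^+ 3 <= T2 - T1.
  rewrite ler_pdivrMr ?exprn_gt0// mulrC (le_trans h4h)//.
  by move: ha3; rewrite ltr_pdivrMr ?mul1r ?mulr_gt0 ?exprn_gt0 ?subr_gt0// => /ltW.
have hK : 4 * K * h ^+ 2 < g.
  have := ha4; rewrite mulrA ltr_pdivrMr// mul1r; apply: le_lt_trans.
  by rewrite [leRHS]mulrC ler_wpM2l// mulr_ge0// ltW.
have hh : 0 < h ^+ 2 by rewrite exprn_gt0.
pose tr a b c := translated p j0 a b c.
(* The vertical offsets solve [zt = 0] for consecutive corners. The factor [sg] in the second
   horizontal coordinate orients the square so that its vertical displacement brings [p1] back to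
   [p]. *)
pose p1 := tr 0 0 (4 * sg * h ^+ 2).
pose p2 := tr h 0 (4 * sg * h ^+ 2 + 2 * y * h).
pose p3 := tr h (sg * h) (2 * y * h - 2 * x * sg * h + 2 * sg * h ^+ 2).
pose p4 := tr 0 (sg * h) (- (2 * x * sg * h)).
have trp : tr 0 0 0 = p by exact: translated0.
have nh : `|h| = h by rewrite gtr0_norm.
have nh2 : `|h ^+ 2| = h ^+ 2 by rewrite gtr0_norm.
have hx0 : 0 <= h * `|x| by rewrite mulr_ge0// ltW.
have hy0 : 0 <= h * `|y| by rewrite mulr_ge0// ltW.
have d0 : `|0 : R| <= d by rewrite normr0 ltW.
have dh : `|h| <= d by rewrite nh; move: hd hx0 hy0; lra.
have dsh : `|sg * h| <= d by rewrite normrM sgn mul1r.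
have n1 : `|4 * sg * h ^+ 2| = 4 * h ^+ 2 by rewrite !normrM sgn nh normr_nat; ring.
have n2 : `|2 * y * h| = 2 * (h * `|y|) by rewrite !normrM nh normr_nat; ring.
have n3 : `|2 * x * sg * h| = 2 * (h * `|x|) by rewrite !normrM nh sgn normr_nat; ring.
have n4 : `|2 * sg * h ^+ 2| = 2 * h ^+ 2 by rewrite !normrM sgn nh normr_nat; ring.
have c1 : close p1.
  by apply: translated_dist => //; rewrite n1; move: hd hx0 hy0 h2h; lra.
have c2 : close p2.
  apply: translated_dist => //; rewrite (le_trans (ler_normD _ _))// n1 n2.
  by move: hd hx0 hy0 h2h; lra.
have c3 : close p3.
  apply: translated_dist => //; rewrite (le_trans (ler_normD _ _))//.
  rewrite (le_trans (lerD (ler_normB _ _) (lexx _)))// n2 n3 n4.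
  by move: hd hx0 hy0 h2h; lra.
have c4 : close p4.
  apply: translated_dist => //; rewrite normrN n3.
  by move: hd hx0 hy0 h2h; lra.
have a1 : attains p1 (u q0 - al r0 + g * h ^+ 2).
  have Z1 : zsq p p1 = 0 by rewrite -trp zsq_translated; ring.
  have t1E : zt p p1 = 4 * sg * h ^+ 2 by rewrite -[X in zt X _]trp zt_translated; ring.
  set r1 := rad p1 q0.
  have r10 : 0 <= r1 by exact: rad_ge0.
  have v0 : 0 <= r0 ^+ 2 - 4 * h ^+ 2 by move: hv (sqr_ge0 s1); lra.
  have r1E : r1 ^+ 2 = r0 ^+ 2 - 4 * h ^+ 2.
    apply/eqP; rewrite -(@eqrXn2 _ 2)// ?sqr_ge0// -exprM rad4 (gauge4_axis p1 k3) Z1 t1E -/s sE.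
    apply/eqP; have -> : sg * r0 ^+ 2 - 4 * sg * h ^+ 2 = sg * (r0 ^+ 2 - 4 * h ^+ 2) by ring.
    by rewrite exprMn sg2; ring.
  have r1r0 : r1 <= r0.
    by rewrite -(@ler_pXn2r _ 2)// ?nnegrE ?(ltW r00)// r1E gerBl mulr_ge0// ltW.
  have s1r1 : s1 <= r1.
    by rewrite -(@ler_pXn2r _ 2)// ?nnegrE ?(ltW s1_gt0)// r1E; move: hv; lra.
  exists q0; split => //; first exact: le_lt_trans k2.
  have tr1 : t0 < r1 by exact: lt_le_trans s1r1.
  have [Hal _] := al_secant tr1 r1r0 k2.
  have diff : 2 / r0 * h ^+ 2 <= r0 - r1.
    rewrite mulrAC ler_pdivrMr//.
    have E : (r0 - r1) * (r0 + r1) = 4 * h ^+ 2 by rewrite -subr_sqr r1E; ring.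
    have : (r0 - r1) * (r0 + r1) <= (r0 - r1) * (r0 + r0).
      by rewrite ler_wpM2l ?subr_ge0// lerD2l.
    by rewrite E; lra.
  have gain : g * h ^+ 2 <= al r0 - al r1.
    apply: le_trans Hal; rewrite /g -!mulrA; apply: ler_pM.
    - by rewrite ltW// al1_gt0.
    - by rewrite !mulr_ge0 ?invr_ge0 ?(ltW r00)// ltW.
    - by apply: al1_le => //; exact: le_lt_trans r1r0 k2.
    - by rewrite mulrA.
  by move: gain; rewrite -/r1; lra.
have sgh : (sg * h) ^+ 2 = h ^+ 2 by rewrite exprMn sg2 mul1r.
have hs p' p'' c := @horizontal_step T1 T2 h T2T close_T1 hT p' p'' c.
have a2 z t := hs _ p2 _ c1 z t a1.
have a2' : attains p2 (u q0 - al r0 + g * h ^+ 2 - K * h ^+ 4).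
  by apply: a2; [rewrite zsq_translated; ring|rewrite zt_translated -/x -/y; ring].
have a3 z t := hs _ p3 _ c2 z t a2'.
have a3' : attains p3 (u q0 - al r0 + g * h ^+ 2 - K * h ^+ 4 - K * h ^+ 4).
  apply: a3; last by rewrite zt_translated -/x -/y; ring.
  by rewrite zsq_translated !subr0 subrr expr0n add0r.
have a4 z t := hs _ p4 _ c3 z t a3'.
have a4' : attains p4 (u q0 - al r0 + g * h ^+ 2 - K * h ^+ 4 - K * h ^+ 4 - K * h ^+ 4).
  by apply: a4; [rewrite zsq_translated; ring|rewrite zt_translated -/x -/y; ring].
have a5 z t := hs _ p _ c4 z t a4'.
have [||q [b1 b2 b3]] := a5.
- rewrite -[X in zsq _ X]trp zsq_translated subrr expr0n add0r.
  by rewrite sub0r sqrrN.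
- by rewrite -[X in zt _ X]trp zt_translated -/x -/y; ring.
have := le_trans b3 (k5 q b1 b2); rewrite -/K -/r0.
have -> : h ^+ 4 = h ^+ 2 * h ^+ 2 by ring.
have : 4 * K * h ^+ 2 * h ^+ 2 < g * h ^+ 2 by rewrite ltr_pM2r.
have -> : 4 * K * h ^+ 2 * h ^+ 2 = 4 * (K * (h ^+ 2 * h ^+ 2)) by ring.
by lra.
Qed.

End axis_trick.

(** * The barrier and the comparison argument *)

Section keller_osserman.
Context {R : realType}.
Variables (phi f l : R -> R) (C D Lambda tau : R).
Hypothesis phi_continuous : {within `[0, +oo[, continuous phi}.
Hypothesis phi_derivable : forall t, 0 < t -> derivable phi t 1.
Hypothesis dphi_continuous : forall t, 0 < t -> {for t, continuous (derive1 phi)}.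
Hypothesis phi0 : phi 0 = 0.
Hypothesis dphi_gt0 : forall t, 0 < t -> 0 < derive1 phi t.
Hypothesis f_continuous : {within `[0, +oo[, continuous f}.
Hypothesis f_incr : forall s t, 0 <= s -> s < t -> f s < f t.
Hypothesis f_gt0 : forall t, 0 < t -> 0 < f t.
Hypothesis l_continuous : {within `[0, +oo[, continuous l}.
Hypothesis l_gt0 : forall t, 0 < t -> 0 < l t.
Hypothesis C_ge1 : 1 <= C.
Hypothesis l_mono : C_monotone C l.
Hypothesis K_int0 : L1_0plus (fun t => t * derive1 phi t / l t).
Hypothesis K_nintoo : ~ L1_pinfty (fun t => t * derive1 phi t / l t).
Hypothesis phi_o : phi t / l t @[t --> 0^'+] --> 0.
Hypothesis D_gt0 : 0 < D.
Hypothesis Lambda_gt0 : 0 < Lambda.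
Hypothesis phi_structure : forall s t, 0 < s <= 1 -> 0 < t ->
  s * derive1 phi (s * t) <= D * s `^ tau * derive1 phi t.
Hypothesis l_structure : forall s t, 0 <= s <= 1 -> 0 <= t ->
  s `^ (1 + tau) * l t <= Lambda * l (s * t).
Hypothesis KO : L1_pinfty (fun t => (Kinv phi l (Ffun f t))^-1).

Lemma continuous_comp_ge0 (T : topologicalType) (g : R -> R) (h : T -> R) :
  {within `[0, +oo[, continuous g} -> (forall x, 0 <= h x) -> continuous h ->
  continuous (fun x => g (h x)).
Proof.
move=> /subspace_continuousP cg h0 ch x.
have hx : `[0, +oo[%classic (h x) by rewrite /= in_itv/= h0.
apply: cvg_trans (cg _ hx) => A /= wA.
have : \forall y \near x, `[0, +oo[%classic (h y) -> A (g (h y)) by exact: (ch x _ wA).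
by apply: filterS => y; apply; rewrite /= in_itv/= h0.
Qed.

Lemma within_pos_continuous (g : R -> R) t :
  {within `[0, +oo[, continuous g} -> 0 < t -> {for t, continuous g}.
Proof.
by move=> /continuous_within_itvcyP[cg _] t0; apply: cg; rewrite in_itv/= t0.
Qed.

Section barrier.

(** [sup] bounds its set only if the set is bounded above, which follows from the continuity of [l]
    on the compact interval. *)
Lemma l_le s t : 0 <= s -> s <= t -> l s <= C * l t.
Proof.
move=> s0 st; have t0 := le_trans s0 st.
apply: le_trans (l_mono t0); apply: ub_le_sup; last first.
  by exists s => //; rewrite /= in_itv/= s0.
have cl : compact (l @` `[0, t]).
  apply: continuous_compact; last exact: segment_compact.
  apply: continuous_subspaceW l_continuous => x.
  by rewrite /= !in_itv/= => /andP[-> _].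
have [M [Mr HM]] := compact_bounded cl.
exists (M + 1) => y hy; apply: le_trans (ler_norm _) _.
by apply: (HM (M + 1)) => //; rewrite ltrDl.
Qed.

Lemma f_le s t : 0 <= s -> s <= t -> f s <= f t.
Proof.
move=> s0; rewrite le_eqVlt => /orP[/eqP->//|st]; exact/ltW/f_incr.
Qed.

Definition Kden (s : R) : R := s * derive1 phi s / l s.

Lemma Kden_gt0 t : 0 < t -> 0 < Kden t.
Proof. by move=> t0; rewrite divr_gt0// ?mulr_gt0 ?dphi_gt0 ?l_gt0. Qed.

Lemma Kden_continuous t : 0 < t -> {for t, continuous Kden}.
Proof.
move=> t0; apply: cvgM.
  by apply: cvgM; [exact: cvg_id|exact: dphi_continuous].
by apply: cvgV; [rewrite gt_eqF// l_gt0|exact: (within_pos_continuous l_continuous t0)].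
Qed.

(** The hypothesis covers a right neighbourhood of 0 without its endpoint and continuity covers the
    rest; the singleton 0 is added separately. *)
Lemma Kden_int b : 0 < b -> lebesgue_measure.-integrable `[0, b] (EFin \o Kden).
Proof.
move=> b0; have [d d0 id] := K_int0.
have ic : lebesgue_measure.-integrable `[(d / 2), (Num.max b d)] (EFin \o Kden).
  apply: continuous_compact_integrable; first exact: segment_compact.
  apply: continuous_in_subspaceT => x; rewrite inE /= in_itv/= => /andP[dx _].
  by apply: Kden_continuous; rewrite (lt_le_trans _ dx)// divr_gt0.
have i0 : lebesgue_measure.-integrable [set 0 : R] (EFin \o Kden).
  rewrite -set_itv1; apply: continuous_compact_integrable; first exact: segment_compact.
  rewrite set_itv1; exact: continuous_subspace1.
have iU : lebesgue_measure.-integrable ([set 0 : R] `|` `]0, d[) (EFin \o Kden).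
  by apply: integrable_setU.
have iV : lebesgue_measure.-integrable
    (([set 0 : R] `|` `]0, d[) `|` `[(d / 2), (Num.max b d)]) (EFin \o Kden).
  by apply: integrable_setU => //; apply: measurableU.
apply: integrableS iV => //.
  by apply: measurableU => //; apply: measurableU.
move=> x; rewrite /= in_itv/= => /andP[x0 xb].
have [->|xn0] := eqVneq x 0; first by left; left.
have xgt0 : 0 < x by rewrite lt_neqAle eq_sym xn0.
have [xd|dx] := ltP x d; first by left; right; rewrite /= in_itv/= xgt0.
right; rewrite /= in_itv/= le_max xb andbT (le_trans _ dx)//.
by rewrite ler_pdivrMr// ler_pMr// ler1n.
Qed.

Lemma Kden_left : 0 <= Kden 0. Proof. by rewrite /Kden !mul0r. Qed.

Local Notation K := (Kfun phi l).
Local Notation F := (Ffun f).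
(** The slope function of the barrier; the generalized Keller-Osserman condition is the
    integrability of [1 / G] at infinity. *)
Definition Gfun (y : R) : R := Kinv phi l (F y).
Local Notation G := Gfun.

Lemma KinvK t : 0 <= t -> Kinv phi l (K t) = t.
Proof.
move=> t0; rewrite /Kinv (_ : K = prim Kden 0)// pinvKV//.
  exact: prim_inj Kden_gt0 Kden_continuous Kden_int.
by rewrite inE /= in_itv/= t0.
Qed.

(** Surjectivity of [K] onto the half-line. The non-integrability at infinity enters here, making
    [K] unbounded. *)
Lemma K_ex y : 0 <= y -> exists2 t, 0 <= t & K t = y.
Proof.
move=> y0.
have nint : ~ lebesgue_measure.-integrable `]1, +oo[ (EFin \o Kden).
  by move=> h; apply: K_nintoo; exists 1.
have [b b0 yb] := prim_unbounded Kden_gt0 Kden_continuous Kden_int Kden_left ltr01 nint y.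
have [|t /andP[t0 _] E] := prim_surj Kden_gt0 Kden_continuous Kden_int (ltW b0) (y := y).
  by rewrite y0 ltW.
by exists t.
Qed.

Lemma f_cont t : 0 < t -> {for t, continuous f}.
Proof. exact: within_pos_continuous. Qed.

Lemma f_int b : 0 < b -> lebesgue_measure.-integrable `[0, b] (EFin \o f).
Proof.
move=> b0; apply: continuous_compact_integrable; first exact: segment_compact.
apply: continuous_subspaceW f_continuous => x.
by rewrite /= !in_itv/= => /andP[-> _].
Qed.

Lemma F_gt0 y : 0 < y -> 0 < F y.
Proof.
move=> y0; have := prim_lt f_gt0 f_cont f_int (lexx 0) y0.
by rewrite prim_left.
Qed.

Lemma F_ge0 y : 0 <= y -> 0 <= F y.
Proof.
rewrite le_eqVlt => /orP[/eqP <-|/F_gt0/ltW//].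
by rewrite -[F 0]/(prim f 0 0) prim_left.
Qed.

Lemma G_spec y : 0 <= y -> 0 <= G y /\ K (G y) = F y.
Proof.
move=> y0; have [t t0 E] := K_ex (F_ge0 y0).
by rewrite /Gfun -E KinvK.
Qed.

Lemma K_lt s t : 0 <= s -> s < t -> K s < K t.
Proof. exact: (prim_lt Kden_gt0 Kden_continuous Kden_int). Qed.

Lemma K_le s t : 0 <= s -> s <= t -> K s <= K t.
Proof. exact: (prim_le Kden_gt0 Kden_continuous Kden_int). Qed.

Lemma G_gt0 y : 0 < y -> 0 < G y.
Proof.
move=> y0; have [g0 E] := G_spec (ltW y0).
rewrite lt_neqAle g0 andbT; apply/eqP => g00.
have := F_gt0 y0; rewrite -E -g00.
by rewrite -[K 0]/(prim Kden 0 0) prim_left ltxx.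
Qed.

Lemma G_lt x y : 0 <= x -> x < y -> G x < G y.
Proof.
move=> x0 xy; have [gx Ex] := G_spec x0; have [gy Ey] := G_spec (le_trans x0 (ltW xy)).
rewrite ltNge; apply/negP => /(K_le gy); rewrite Ex Ey leNgt.
by rewrite (prim_lt f_gt0 f_cont f_int).
Qed.

Lemma G_le x y : 0 <= x -> x <= y -> G x <= G y.
Proof.
move=> x0; rewrite le_eqVlt => /orP[/eqP->//|xy]; exact/ltW/G_lt.
Qed.

(** For $y<1$ one has $F(y)\le f(1)\,y$, which is below [K e] as soon as [y < K e / f 1]; then
    [G y < e] because [K] is monotone. *)
Lemma G_small e : 0 < e -> exists2 d, 0 < d & forall y, 0 <= y -> y < d -> G y < e.
Proof.
move=> e0; have Ke : 0 < K e.
  by have := K_lt (lexx 0) e0; rewrite -[K 0]/(prim Kden 0 0) prim_left.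
have f1 := f_gt0 ltr01.
exists (Num.min 1 (K e / f 1)); first by rewrite lt_min ltr01 divr_gt0.
move=> y y0; rewrite lt_min => /andP[y1 yK].
have [gy Ey] := G_spec y0.
rewrite ltNge; apply/negP => /(K_le (ltW e0)); rewrite Ey leNgt => /negP; apply.
move: y0; rewrite le_eqVlt => /orP[/eqP <-|y0].
  by rewrite -[F 0]/(prim f 0 0) prim_left.
have [c /andP[c0 cy]] := prim_mvt f_cont f_int (lexx 0) y0.
rewrite prim_left !subr0 => E; rewrite -[F y]/(prim f 0 y) E.
rewrite ltr_pdivlMr// in yK; apply: le_lt_trans yK.
rewrite [leRHS]mulrC ler_wpM2r ?(ltW y0)//; apply: f_le; first exact: ltW.
exact: ltW (lt_trans cy y1).
Qed.

(** Differentiating [K (G y) = F y] gives $G\,G'\varphi'(G)=f\,l(G)$, the identity behind the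
    differential equation of the barrier. *)
Lemma is_derive_G (y : R) : 0 < y -> is_derive y 1 G (f y / Kden (G y)).
Proof.
move=> y0; have [_ E] := G_spec (ltW y0).
have dF : is_derive y 1 F (f y) by exact: (is_derive_prim f_cont f_int y0).
have dK := is_derive_prim_inv Kden_gt0 Kden_continuous Kden_int
  (inv := Kinv phi l) (fun t t0 => KinvK (ltW t0)) (G_gt0 y0).
rewrite -[prim Kden 0 _]/(K _) E in dK.
by have := is_derive1_comp dK dF; rewrite mulrC.
Qed.

Lemma G_continuous y : 0 < y -> {for y, continuous G}.
Proof.
move=> y0; apply/differentiable_continuous/derivable1_diffP.
by have [] := is_derive_G y0.
Qed.

Definition Gden (y : R) : R := (G y)^-1.

Lemma Gden_gt0 y : 0 < y -> 0 < Gden y.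
Proof. by move=> y0; rewrite invr_gt0 G_gt0. Qed.

Lemma Gden_continuous y : 0 < y -> {for y, continuous Gden}.
Proof.
by move=> y0; apply: cvgV; [rewrite gt_eqF// G_gt0|exact: G_continuous].
Qed.

Lemma Gden_int a b : 0 < a -> lebesgue_measure.-integrable `[a, b] (EFin \o Gden).
Proof.
move=> a0; apply: continuous_compact_integrable; first exact: segment_compact.
apply: continuous_in_subspaceT => x; rewrite inE /= in_itv/= => /andP[ax _].
by apply: Gden_continuous; exact: lt_le_trans ax.
Qed.

(** * The blow-up time of the equation $Y'=G(Y)$ *)

Section theta.
Variable y0 : R.
Hypothesis y0_gt0 : 0 < y0.

Local Notation Th := (prim Gden y0).

Let Gd_gt0 t : y0 < t -> 0 < Gden t.
Proof. by move=> h; apply: Gden_gt0; exact: lt_trans h. Qed.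

Let Gd_cont t : y0 < t -> {for t, continuous Gden}.
Proof. by move=> h; apply: Gden_continuous; exact: lt_trans h. Qed.

Let Gd_int b : y0 < b -> lebesgue_measure.-integrable `[y0, b] (EFin \o Gden).
Proof. by move=> _; exact: Gden_int. Qed.

Let Gd_left : 0 <= Gden y0. Proof. exact/ltW/Gden_gt0. Qed.

(** [Th y] is the time in which the solution of $Y'=G(Y)$ travels from [y0] to [y], and the supremum
    is its blow-up time. *)
Definition theta_sup : R := sup (range Th).

(** The generalized Keller-Osserman condition enters here, as finiteness of the blow-up time. *)
Lemma theta_has_sup : has_sup (range Th).
Proof.
split; first by exists (Th 0), 0.
have [M M0 iM] := KO.
have yM : y0 < Num.max M (y0 + 1) by rewrite lt_max ltrDl ltr01 orbT.
have [|S HS] := prim_bounded Gd_gt0 Gd_cont Gd_int Gd_left yM.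
  apply: integrableS iM => //; apply: subset_itvr.
  by rewrite bnd_simp le_max lexx.
by exists S => _ [t _ <-].
Qed.

Lemma theta_lt_sup y : y0 <= y -> Th y < theta_sup.
Proof.
move=> yy; apply: (@lt_le_trans _ _ (Th (y + 1))).
  by apply: (prim_lt Gd_gt0 Gd_cont Gd_int yy); rewrite ltrDl.
by apply: sup_upper_bound; [exact: theta_has_sup|exists (y + 1)].
Qed.

Definition theta_inv : R -> R := 'pinv_(fun=> 0) `[y0, +oo[ Th.

Lemma theta_invK y : y0 <= y -> theta_inv (Th y) = y.
Proof.
move=> yy; rewrite /theta_inv pinvKV//; first exact: prim_inj Gd_gt0 Gd_cont Gd_int.
by rewrite inE /= in_itv/= yy.
Qed.

Lemma theta_ex z : 0 < z -> z < theta_sup -> exists2 y, y0 < y & Th y = z.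
Proof.
move=> z0 /(sup_gt _)[|_ [x _ <-] zx]; first by exists (Th 0), 0.
have yx : y0 <= x.
  rewrite leNgt; apply/negP => /ltW/(prim_nondecreasing Gd_gt0 Gd_cont Gd_int).
  by rewrite prim_left leNgt (lt_trans z0).
have [|y /andP[yy _] E] := prim_surj Gd_gt0 Gd_cont Gd_int yx (y := z).
  by rewrite !ltW.
exists y => //; rewrite lt_neqAle yy andbT; apply/eqP => E'.
by move: z0; rewrite -E -E' prim_left ltxx.
Qed.

Lemma is_derive_theta_inv (y : R) : y0 < y -> is_derive (Th y) 1 theta_inv (G y).
Proof.
move=> yy.
have := is_derive_prim_inv Gd_gt0 Gd_cont Gd_int (fun t yt => theta_invK (ltW yt)) yy.
by rewrite invrK.
Qed.

(* Integrates d/dy phi(G y) = f(y) l(G y) / G y. *)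
Lemma phi_G_le y : y0 <= y -> phi (G y) <= phi (G y0) + C * f y * l (G y) * Th y.
Proof.
rewrite le_eqVlt => /orP[/eqP <-|yy]; first by rewrite prim_left mulr0 addr0.
have dphiG (x : R) : 0 < x -> is_derive x 1 (phi \o G) (f x * l (G x) / G x).
  move=> x0; have gx := G_gt0 x0.
  have dp : is_derive (G x) 1 phi (derive1 phi (G x)).
    by split; [exact: phi_derivable|rewrite derive1E].
  have := is_derive1_comp dp (is_derive_G x0); move/is_derive_eq; apply.
  rewrite /Kden; field.
  by rewrite !gt_eqF ?dphi_gt0 ?l_gt0.
have dTh (x : R) : y0 < x -> is_derive x 1 (fun x => C * f y * l (G y) * Th x) (C * f y * l (G y) / G x).
  by move=> yx; exact: (@is_deriveZ _ _ _ Th (C * f y * l (G y)) x 1 (Gden x) (is_derive_prim Gd_cont Gd_int yx)).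
pose h x := (phi \o G) x - C * f y * l (G y) * Th x.
have dh (x : R) : y0 < x -> is_derive x 1 h (f x * l (G x) / G x - C * f y * l (G y) / G x).
  by move=> yx; exact: is_deriveB (dphiG x (lt_trans y0_gt0 yx)) (dTh x yx).
have ch : {within `[y0, y], continuous h}.
  have cphi : {within `[y0, y], continuous (phi \o G)}.
    apply: derivable_within_continuous => x; rewrite in_itv/= => /andP[yx _].
    by have [] := dphiG x (lt_le_trans y0_gt0 yx).
  have cTh := prim_within Gd_int yy.
  move=> x; apply: cvgB; first exact: cphi.
  by apply: cvgM; [exact: cvg_cst|exact: cTh].
have : h y <= h y0.
  apply: (@ler0_derive1_le_cc _ h y0 y) => //.
  - by move=> x; rewrite in_itv/= => /andP[yx _]; have [] := dh x yx.
  - move=> x; rewrite in_itv/= => /andP[yx xy]; rewrite (is_derive_derive1 (dh x yx)).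
    have x0 := lt_trans y0_gt0 yx.
    rewrite -mulrBl mulr_le0_ge0 ?invr_ge0 ?(ltW (G_gt0 x0))//.
    rewrite subr_le0 mulrAC [leRHS]mulrC; apply: ler_pM.
    + exact/ltW/f_gt0.
    + exact/ltW/l_gt0/G_gt0.
    + by apply: f_le; exact: ltW.
    + apply: l_le; [exact/ltW/G_gt0|apply: G_le; exact: ltW].
  - by rewrite in_itv/= lexx ltW.
  - by rewrite in_itv/= lexx ltW.
  - exact: ltW.
rewrite /h prim_left mulr0 subr0 /=.
by rewrite lerBlDr.
Qed.

End theta.

(** The function is [al = Y / sg] with $Y'=sg\,G(Y)$, starting from [y0] at [t0], so that $al'=G(Y)$
    and $\varphi'(al')\,al''=sg\,f(Y)\,l(al')$. Small [sg] makes this a small fraction of the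
    right-hand side. The first-order term is estimated by [phi_G_le]: its initial value is absorbed
    through $\varphi=o(l)$ at 0, its growth again through [sg]. *)
Lemma barrier (N eps eta t0 t1 : R) :
  0 <= N -> 0 < eps -> 0 < eta -> 0 < t0 -> t0 < t1 ->
  exists T, exists al : R -> R, exists al1 : R -> R, exists al2 : R -> R,
  [/\ t1 < T,
    forall t : R, t0 < t -> t < T ->
      [/\ is_derive t 1 al (al1 t), is_derive t 1 al1 (al2 t),
         {for t, continuous al2}, 0 < al t & 0 < al1 t] /\
      0 <= al2 t /\
      derive1 phi (al1 t) * al2 t + N / t * phi (al1 t) <= eps * (f (al t) * l (al1 t)),
    forall t, t0 < t -> t <= t1 -> al t <= eta &
    forall B, exists2 T', t0 < T' < T & forall t, T' < t -> t < T -> B < al t].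
Proof.
move=> N0 eps0 eta0 t00 t01.
have C0 : 0 < C by exact: lt_le_trans ltr01 C_ge1.
have eta2 : 0 < eta / 2 by rewrite divr_gt0.
(* Chosen so that [N / t * phi (G y0)] uses at most half of [eps]: [C] pays for the monotonicity of
   [l], [f (eta / 2)] bounds [f (al t)] from below, and [t0 / t <= 1]. *)
pose c0 := (eps / 2) * (t0 / (N + 1)) * f (eta / 2) / C.
have c00 : 0 < c0.
  by rewrite divr_gt0// mulr_gt0 ?f_gt0// mulr_gt0// divr_gt0// ltr_wpDl.
have [d1 d10 Hd1] : exists2 d1, 0 < d1 & forall s, 0 < s -> s < d1 -> phi s / l s < c0.
  have : \forall s \near 0^'+, phi s / l s < c0 by apply: (cvgr_lt _ phi_o).
  move=> /nbhs_ballP[d /= d0 Hd]; exists d => // s s0 sd; apply: (Hd s) => //.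
  by rewrite -ball_normE /= sub0r normrN gtr0_norm.
(* Slopes below [d1] are in the range of the estimate of $\varphi/l$; slopes below the second bound
   do not let [al] climb from [eta / 2] to [eta] before [t1]. *)
pose mu := Num.min d1 ((eta / 2) / (t1 - t0)).
have mu0 : 0 < mu by rewrite lt_min d10 divr_gt0// subr_gt0.
have [d d0 Hd] := G_small mu0.
(* The bound 1 gives [Y <= al], the second one puts [G y1] below [mu], and the third keeps the
   second-order term and the growth of the first-order term within the other half of [eps]. *)
pose sg := Num.min 1 (Num.min (d / (2 * eta)) (eps / (2 * (1 + N * C)))).
have NC0 : 0 < 1 + N * C by rewrite ltr_pwDl// mulr_ge0// ltW.
have sg0 : 0 < sg by rewrite !lt_min ltr01 !divr_gt0// mulr_gt0.
have sg1 : sg <= 1 by rewrite ge_min lexx.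
have sgd : sg * eta < d.
  have h : sg <= d / (2 * eta) by rewrite !ge_min lexx orbT.
  move: h; rewrite ler_pdivlMr ?mulr_gt0// => h; have := mulr_gt0 sg0 eta0; lra.
have sge : sg * (1 + N * C) <= eps / 2.
  have h : sg <= eps / (2 * (1 + N * C)) by rewrite !ge_min lexx !orbT.
  by move: h; rewrite ler_pdivlMr ?mulr_gt0// => h; rewrite ler_pdivlMr//; lra.
pose y0 := sg * (eta / 2); pose y1 := sg * eta.
have y00 : 0 < y0 by rewrite mulr_gt0.
have y10 : 0 < y1 by rewrite mulr_gt0.
have y01 : y0 < y1 by rewrite ltr_pM2l// ltr_pdivrMr// ltr_pMr// ltr1n.
have Gmu : G y1 < mu by apply: Hd => //; exact: ltW.
pose Th := prim Gden y0.
have Gd_gt0 t : y0 < t -> 0 < Gden t by move=> h; apply: Gden_gt0; exact: lt_trans h.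
have Gd_cont t : y0 < t -> {for t, continuous Gden}.
  by move=> h; apply: Gden_continuous; exact: lt_trans h.
have Gd_int b : y0 < b -> lebesgue_measure.-integrable `[y0, b] (EFin \o Gden).
  by move=> _; exact: Gden_int.
pose Y t := theta_inv y0 (sg * (t - t0)).
pose T := t0 + theta_sup y0 / sg.
have Y_ex t : t0 < t -> t < T -> exists2 y, y0 < y & Th y = sg * (t - t0) /\ Y t = y.
  move=> tt tT; have [||y yy E] := @theta_ex _ y00 (sg * (t - t0)).
  - by rewrite mulr_gt0// subr_gt0.
  - by rewrite -ltr_pdivlMl// mulrC ltrBlDl.
  by exists y => //; split=> //; rewrite /Y -E theta_invK// ltW.
have Th1 : sg * (t1 - t0) <= Th y1.
  have [c /andP[c0' c1]] := prim_mvt Gd_cont Gd_int (lexx y0) y01.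
  rewrite prim_left subr0 /Th => ->.
  have -> : y1 - y0 = sg * (eta / 2) by rewrite /y1 /y0; field.
  rewrite mulrCA ler_pM2l// /Gden.
  have gc : G c < (eta / 2) / (t1 - t0).
    apply: (@lt_le_trans _ _ mu); last by rewrite ge_min lexx orbT.
    by apply: lt_trans Gmu; apply: G_lt => //; exact/ltW/(lt_trans y00).
  have gc0 : 0 < G c by apply: G_gt0; exact: lt_trans y00 c0'.
  rewrite -ler_pdivrMl ?invr_gt0// invrK.
  by move: gc; rewrite ltr_pdivlMr ?subr_gt0// => /ltW.
have dY (t : R) : t0 < t -> t < T -> is_derive t 1 Y (sg * G (Y t)).
  move=> tt tT; have [y yy [E1 E2]] := Y_ex t tt tT.
  have da : is_derive t 1 (fun t : R => sg * (t - t0)) sg.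
    have := is_deriveZ sg (is_deriveB (is_derive_id t (1:R)) (is_derive_cst t0 t (1:R))).
    by move/is_derive_eq; apply; rewrite subr0 /GRing.scale /= mulr1.
  have dt := is_derive_theta_inv y00 yy.
  rewrite -/Th E1 -E2 in dt.
  by have := @is_derive1_comp _ (theta_inv y0) (fun t : R => sg * (t - t0)) t _ _ dt da; rewrite mulrC.
have Y_gt t : t0 < t -> t < T -> y0 < Y t.
  by move=> tt tT; have [y yy [_ ->]] := Y_ex t tt tT.
exists T, (fun t => Y t / sg), (fun t => G (Y t)),
  (fun t => sg * f (Y t) * l (G (Y t)) / derive1 phi (G (Y t))).
split.
- have h : Th y1 < theta_sup y0 by apply: theta_lt_sup => //; exact: ltW.
  by rewrite /T -ltrBlDl ltr_pdivlMr// mulrC (le_lt_trans Th1).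
- move=> t tt tT; have yy := Y_gt t tt tT; have [y _ [E1 E2]] := Y_ex t tt tT.
  have Yp : 0 < Y t := lt_trans y00 yy.
  have gp := G_gt0 Yp; have fp := f_gt0 Yp; have lp := l_gt0 gp; have pp := dphi_gt0 gp.
  have dYt := dY t tt tT.
  have cY : {for t, continuous Y}.
    by apply/differentiable_continuous/derivable1_diffP; case: dYt.
  have cGY : {for t, continuous (fun t => G (Y t))}.
    by apply: (continuous_comp cY); exact: G_continuous.
  have YS : Y t <= Y t / sg by rewrite ler_pdivlMr// ler_piMr// ltW.
  split; first split.
  + have := is_deriveM dYt (is_derive_cst (sg^-1) t (1:R)).
    by move/is_derive_eq; apply; rewrite scaler0 add0r /GRing.scale /= mulrA mulVf ?mul1r ?gt_eqF.
  + have := is_derive1_comp (is_derive_G Yp) dYt; move/is_derive_eq; apply.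
    by rewrite /Kden; field; rewrite !gt_eqF.
  + apply: cvgM; first apply: cvgM; first apply: cvgM.
    * exact: cvg_cst.
    * exact: (continuous_comp cY (f_cont Yp)).
    * exact: (continuous_comp cGY (within_pos_continuous l_continuous gp)).
    * apply: cvgV; first by rewrite gt_eqF.
      exact: (continuous_comp cGY (dphi_continuous gp)).
  + by rewrite divr_gt0.
  + by [].
  split; first by rewrite divr_ge0 ?(ltW pp)// !mulr_ge0 ?(ltW sg0) ?(ltW fp) ?(ltW lp).
  have -> : derive1 phi (G (Y t)) * (sg * f (Y t) * l (G (Y t)) / derive1 phi (G (Y t))) =
    sg * f (Y t) * l (G (Y t)) by field; rewrite gt_eqF.
  have fY : f (Y t) <= f (Y t / sg) by apply: f_le => //; exact: ltW.
  set fa := f (Y t / sg) in fY *; set la := l (G (Y t)) in lp *.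
  have fe : f (eta / 2) <= fa.
    apply: f_le; first exact: ltW.
    by rewrite ler_pdivlMr// mulrC ltW.
  have t0p : 0 < t by exact: lt_trans t00 tt.
  have Nt : 0 <= N / t by rewrite divr_ge0// ltW.
  have P := phi_G_le y00 (ltW yy).
  rewrite -E2 in E1; rewrite -/Th E1 -/la in P.
  have gy0 := G_gt0 y00.
  have p0 : phi (G y0) <= c0 * (C * la).
    have : phi (G y0) / l (G y0) < c0.
      apply: Hd1 => //; apply: (lt_trans (G_lt (ltW y00) y01)).
      by apply: (lt_le_trans Gmu); rewrite ge_min lexx.
    rewrite ltr_pdivrMr ?l_gt0// => /ltW/le_trans; apply.
    rewrite ler_pM2l//; apply: l_le; first exact: ltW.
    by apply: G_le; exact: ltW.
  have P1 : N / t * phi (G (Y t)) <= N / t * (c0 * (C * la)) + N / t * (C * f (Y t) * la * (sg * (t - t0))).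
    by rewrite -mulrDr ler_wpM2l// (le_trans P)// lerD2r.
  have Q1 : N / t * (c0 * (C * la)) <= (eps / 2) * (fa * la).
    have -> : N / t * (c0 * (C * la)) = (eps / 2) * ((N / (N + 1)) * (t0 / t) * f (eta / 2) * la).
      by rewrite /c0; field; rewrite !gt_eqF// ltr_wpDl.
    rewrite ler_pM2l ?divr_gt0// ler_pM2r//.
    apply: le_trans fe; rewrite ler_piMl ?(ltW (f_gt0 eta2))//.
    rewrite mulr_ile1 ?divr_ge0 ?addr_ge0 ?(ltW t00) ?(ltW t0p)//.
      by rewrite ler_pdivrMr ?mul1r ?lerDl// ltr_wpDl.
    by rewrite ler_pdivrMr ?mul1r ?ltW.
  have Q2 : N / t * (C * f (Y t) * la * (sg * (t - t0))) <= sg * (N * C) * (fa * la).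
    have -> : N / t * (C * f (Y t) * la * (sg * (t - t0))) =
      sg * (N * C) * (f (Y t) * la) * ((t - t0) / t) by field; rewrite gt_eqF.
    have h : (t - t0) / t <= 1 by rewrite ler_pdivrMr// mul1r lerBlDr lerDl ltW.
    have h' : 0 <= sg * (N * C) by rewrite !mulr_ge0 ?(ltW sg0) ?(ltW C0).
    apply: le_trans (ler_piMr _ h) _.
      by rewrite mulr_ge0// mulr_ge0 ?(ltW fp) ?(ltW lp).
    by rewrite ler_wpM2l// ler_pM2r.
  have Q3 : sg * f (Y t) * la <= sg * (fa * la).
    by rewrite -mulrA ler_pM2l// ler_pM2r.
  have Q4 : sg * (1 + N * C) * (fa * la) <= eps / 2 * (fa * la).
    by rewrite ler_wpM2r// mulr_ge0 ?(ltW lp)// (le_trans _ fe)// ltW// f_gt0.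
  have -> : eps * (fa * la) = eps / 2 * (fa * la) + eps / 2 * (fa * la) by field.
  apply: le_trans (lerD Q3 (le_trans P1 (lerD Q1 Q2))) _.
  rewrite addrCA lerD2l -mulrDl; apply: le_trans Q4.
  by rewrite mulrDr mulr1.
- move=> t tt tt1; rewrite ler_pdivrMr// mulrC -/y1 leNgt; apply/negP => yY.
  have tT : t < T.
    have h : Th y1 < theta_sup y0 by apply: theta_lt_sup => //; exact: ltW.
    rewrite /T -ltrBlDl ltr_pdivlMr// mulrC (le_lt_trans _ h)// (le_trans _ Th1)//.
    by rewrite ler_pM2l// lerD2r.
  have [y yy [E1 E2]] := Y_ex t tt tT.
  have := prim_lt Gd_gt0 Gd_cont Gd_int (ltW y01) yY.
  rewrite E2 -/Th E1 ltNge => /negP; apply; apply: le_trans Th1.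
  by rewrite ler_pM2l// lerD2r.
move=> B; pose y := Num.max (sg * B) y0 + 1.
have yy : y0 < y.
  by rewrite (@le_lt_trans _ _ (Num.max (sg * B) y0)) ?le_max ?lexx ?orbT// ltrDl.
have By : sg * B < y.
  by rewrite (@le_lt_trans _ _ (Num.max (sg * B) y0)) ?le_max ?lexx// ltrDl.
have Thy : 0 < Th y.
  by have := prim_lt Gd_gt0 Gd_cont Gd_int (lexx y0) yy; rewrite prim_left.
have Ths := theta_lt_sup y00 (ltW yy).
exists (t0 + Th y / sg).
  by rewrite ltrDl divr_gt0//= ltrD2l ltr_pM2r ?invr_gt0.
move=> t Tt tT; have tt : t0 < t by apply: lt_trans Tt; rewrite ltrDl divr_gt0.
have [z zz [E1 E2]] := Y_ex t tt tT.
rewrite E2 ltr_pdivlMr// mulrC; apply: lt_le_trans By _.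
rewrite leNgt; apply/negP => zy.
have := prim_lt Gd_gt0 Gd_cont Gd_int (ltW zz) zy.
rewrite -/Th E1 ltNge => /negP; apply; apply/ltW.
by move: Tt; rewrite -ltrBrDl ltr_pdivrMr// mulrC.
Qed.

End barrier.

(** * Monotonicity of [phi] and the structure conditions *)

Lemma within_pos_subspace (g : R -> R) (t : R) :
  {within `[0, +oo[, continuous g} -> {within `[0, t], continuous g}.
Proof.
by apply: continuous_subspaceW => x; rewrite /= !in_itv/= => /andP[->].
Qed.

Lemma phi_lt s t : 0 <= s -> s < t -> phi s < phi t.
Proof.
move=> s0 st.
have [x||c cst E] := @MVT R phi (derive1 phi) s t st.
- rewrite in_itv/= => /andP[sx _]; have x0 := le_lt_trans s0 sx.
  by split; [exact: phi_derivable|rewrite derive1E].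
- apply: continuous_subspaceW phi_continuous => x.
  by rewrite /= !in_itv/= => /andP[/(le_trans s0) ->].
rewrite -subr_gt0 E mulr_gt0 ?subr_gt0//; apply: dphi_gt0.
by move: cst; rewrite in_itv/= => /andP[/(le_lt_trans s0)].
Qed.

Lemma phi_ge0 t : 0 <= t -> 0 <= phi t.
Proof.
rewrite le_eqVlt => /orP[/eqP <-|t0]; first by rewrite phi0.
by have := phi_lt (lexx 0) t0; rewrite phi0 => /ltW.
Qed.

(** The condition on $\varphi'$ says that $D s^\tau\varphi(x)-\varphi(sx)$ has a nonnegative
    derivative for $x>0$. It vanishes at 0, where mere continuity suffices for the mean value
    theorem. *)
Lemma phi_scale s t : 0 < s <= 1 -> 0 < t -> phi (s * t) <= D * s `^ tau * phi t.
Proof.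
move=> /andP[s0 s1] t0.
have dps (x : R) : 0 < x -> is_derive x 1 phi (derive1 phi x).
  by move=> x0; split; [exact: phi_derivable|rewrite derive1E].
have dg (x : R) : 0 < x -> is_derive x 1 (fun x => D * s `^ tau * phi x - phi (s * x))
    (D * s `^ tau * derive1 phi x - s * derive1 phi (s * x)).
  move=> x0; have d1 := dps _ x0; have d2 := dps _ (mulr_gt0 s0 x0).
  have d3 : is_derive x 1 (fun x : R => s * x) s.
    have := is_deriveM (is_derive_cst s x 1) (is_derive_id x 1).
    by move/is_derive_eq; apply; rewrite scaler0 addr0 /GRing.scale /= mulr1.
  have d4 := @is_derive1_comp _ phi (fun x => s * x) x _ _ d2 d3.
  have d5 := is_deriveB (is_deriveM (is_derive_cst (D * s `^ tau) x 1) d1) d4.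
  move: d5 => /is_derive_eq; apply.
  by rewrite scaler0 addr0 /GRing.scale /= mulrC [s * _]mulrC [derive1 phi x * _]mulrC.
have cg : {within `[0, t], continuous (fun x => D * s `^ tau * phi x - phi (s * x))}.
  have w := @within_pos_subspace phi t phi_continuous; move=> x.
  apply: (@continuousB _ _ _ (fun x : subspace `[0, t] => D * s `^ tau * phi x)
    (fun x : subspace `[0, t] => phi (s * x))).
    by apply: (@continuousM _ _ (fun=> D * s `^ tau)); [exact: cst_continuous|exact: w].
  move: x; apply/subspace_continuousP => x; rewrite /= in_itv/= => /andP[x0 xt].
  move/subspace_continuousP : phi_continuous => cp.
  have sx : `[0, +oo[%classic (s * x) by rewrite /= in_itv/= mulr_ge0// ltW.
  apply: cvg_trans (cp _ sx) => A /= wA.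
  have ch : {for x, continuous (fun x : R => s * x)}.
    by apply: (@continuousM _ _ (fun=> s)); [exact: cst_continuous|].
  have : \forall y \near x, `[0, +oo[%classic (s * y) -> A (phi (s * y)) by exact: (ch _ wA).
  apply: filterS => y /[swap]; rewrite /= !in_itv/= andbT => /andP[y0 _]; apply.
  by rewrite mulr_ge0// ltW.
have [x||c cst E] := @MVT R (fun x => D * s `^ tau * phi x - phi (s * x))
  (fun x => D * s `^ tau * derive1 phi x - s * derive1 phi (s * x)) 0 t t0.
- by rewrite in_itv/= => /andP[x0 _]; exact: dg.
- exact: cg.
move: cst; rewrite in_itv/= => /andP[c0 _].
move: E; rewrite !mulr0 phi0 mulr0 subr0 subr0 => E.
rewrite -subr_ge0 E mulr_ge0//.
  by rewrite subr_ge0 phi_structure// s0.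
by rewrite subr0 ltW.
Qed.

(* Off the vertical axis the operator applied to the barrier picks up the factor
   [s ^ (1 + tau)], which [l_structure] converts into the smaller argument of [l]. *)
Lemma structure_bound (s a b c d : R) : 0 < s <= 1 -> 0 < a -> 0 <= b -> 0 <= c ->
  derive1 phi a * b + c * phi a <= (D * Lambda)^-1 * (d * l a) -> 0 <= d ->
  s ^+ 2 * derive1 phi (s * a) * b + c * s * phi (s * a) <= d * l (s * a).
Proof.
move=> s01 a0 b0 c0 H d0; have /andP[s0 s1] := s01.
have h1 := phi_structure s01 a0; have h2 := phi_scale s01 a0.
have st : s `^ (1 + tau) = s * s `^ tau.
  by rewrite powRD ?powRr1 ?ltW// (gt_eqF s0) implybT.
have h3 : s `^ (1 + tau) * l a <= Lambda * l (s * a) by rewrite l_structure// ?(ltW s0)// ltW.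
have p0 : 0 <= s `^ tau by exact: powR_ge0.
apply: (@le_trans _ _ (D * s `^ (1 + tau) * (derive1 phi a * b + c * phi a))).
  have -> : s ^+ 2 * derive1 phi (s * a) * b = s * (s * derive1 phi (s * a)) * b by ring.
  have -> : D * s `^ (1 + tau) * (derive1 phi a * b + c * phi a) =
    s * (D * s `^ tau * derive1 phi a) * b + c * s * (D * s `^ tau * phi a).
    by rewrite st; ring.
  by rewrite lerD// ?ler_wpM2r ?ler_wpM2l ?mulr_ge0 ?(ltW s0).
apply: (@le_trans _ _ (D * s `^ (1 + tau) * ((D * Lambda)^-1 * (d * l a)))).
  by rewrite ler_wpM2l// mulr_ge0 ?powR_ge0// ltW.
have -> : D * s `^ (1 + tau) * ((D * Lambda)^-1 * (d * l a)) =
  d * (Lambda^-1 * (s `^ (1 + tau) * l a)).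
  by field; rewrite !gt_eqF.
by rewrite ler_wpM2l// ler_pdivrMl.
Qed.

(** * The flux and the source of a solution *)

Variable m : nat.
Local Notation H := 'rV[R]_(m + m + 1).
Implicit Types (v : H -> R) (q : H).

Definition flux_scale u q : R := (hgrad_norm u q)^-1 * phi (hgrad_norm u q).

Lemma norm_flux_scale u q : hgrad_norm u q * flux_scale u q = phi (hgrad_norm u q).
Proof.
rewrite /flux_scale; have [->|n0] := eqVneq (hgrad_norm u q) 0; first by rewrite mul0r phi0.
by rewrite mulVKf.
Qed.

Lemma flux_scale_ge0 u q : 0 <= flux_scale u q.
Proof.
rewrite mulr_ge0 ?invr_ge0 ?hgrad_norm_ge0//.
exact/phi_ge0/hgrad_norm_ge0.
Qed.

(** By Cauchy-Schwarz the sum is at least $(\varphi(a)-\varphi(b))(a-b)$, with [a], [b] the lengths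
    of the two gradients, and $\varphi$ is increasing. A vanishing gradient does no harm, since
    [phi 0 = 0] ([norm_flux_scale]). *)
Lemma flux_monotone u v q : 0 <= \sum_(j < m)
  ((flux_scale u q * Xfield j u q - flux_scale v q * Xfield j v q) * (Xfield j u q - Xfield j v q) +
   (flux_scale u q * Yfield j u q - flux_scale v q * Yfield j v q) * (Yfield j u q - Yfield j v q)).
Proof.
set A := flux_scale u q; set B := flux_scale v q.
have A0 : 0 <= A by exact: flux_scale_ge0.
have B0 : 0 <= B by exact: flux_scale_ge0.
set a := hgrad_norm u q; set b := hgrad_norm v q.
rewrite (eq_bigr (fun j => A * (Xfield j u q * Xfield j u q + Yfield j u q * Yfield j u q) +
   (B * (Xfield j v q * Xfield j v q + Yfield j v q * Yfield j v q) +
    - (A + B) * (Xfield j u q * Xfield j v q + Yfield j u q * Yfield j v q)))); last first.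
  by move=> j _; ring.
rewrite !big_split /= -!mulr_sumr -/(hgrad_dot u u q) -/(hgrad_dot v v q) -/(hgrad_dot u v q).
rewrite -!hgrad_norm2 -/a -/b.
apply: (@le_trans _ _ ((a * A - b * B) * (a - b))).
  rewrite !norm_flux_scale -/a -/b; have [ab|ab|->] := ltgtP a b; last by rewrite !subrr mulr0.
    rewrite mulr_le0// subr_le0; apply/ltW => //.
    exact: phi_lt (hgrad_norm_ge0 u q) ab.
  rewrite mulr_ge0// subr_ge0; apply/ltW => //.
  exact: phi_lt (hgrad_norm_ge0 v q) ab.
have h : (A + B) * hgrad_dot u v q <= (A + B) * (a * b).
  by rewrite ler_wpM2l ?addr_ge0// hgrad_dot_le.
have -> : (a * A - b * B) * (a - b) = A * (a * a) + (B * (b * b) - (A + B) * (a * b)) by ring.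
by rewrite lerD2l lerD2l mulNr lerN2.
Qed.

(** Near a zero of the gradient [flux_scale] may be unbounded, but the product is dominated by
    $\varphi(|\nabla u|)$, which tends to 0. *)
Lemma continuous_flux u (F : H -> R) : C1on setT u -> continuous F ->
  (forall q, `|F q| <= hgrad_norm u q) -> continuous (fun q => flux_scale u q * F q).
Proof.
move=> C1 cF Fn q.
have cn := continuous_hgrad_norm C1.
have cp : continuous (fun q => phi (hgrad_norm u q)).
  exact: (continuous_comp_ge0 phi_continuous (hgrad_norm_ge0 u) cn).
have [n0|n0] := eqVneq (hgrad_norm u q) 0; last first.
  exact: (cvgM (cvgM (cvgV n0 (cn q)) (cp q)) (cF q)).
have F0 : F q = 0 by apply/eqP; rewrite -normr_le0 -n0.
suff H1 : (flux_scale u x * F x) @[x --> q] --> (0 : R) by rewrite /prop_for /continuous_at F0 mulr0.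
have H0 : phi (hgrad_norm u q0) @[q0 --> q] --> 0 by rewrite -[X in _ --> X]phi0 -n0; exact: cp.
have HN := cvgN H0; rewrite oppr0 in HN.
have fq : Filter (nbhs q) by exact: nbhs_filter.
refine (@squeeze_cvgr _ _ fq R _ _ _ _ 0 (HN fq) H0).
apply: nearW => x; rewrite -ler_norml.
have p0 : 0 <= phi (hgrad_norm u x).
  exact/phi_ge0/hgrad_norm_ge0.
rewrite -norm_flux_scale normrM (ger0_norm (flux_scale_ge0 u x)).
by rewrite mulrC ler_wpM2r// flux_scale_ge0.
Qed.

Variable u : H -> R.
Hypothesis u_ge0 : forall q, 0 <= u q.
Hypothesis u_weak : weak_solution phi f l u.

Lemma solution_C1 : C1on setT u.
Proof. by apply/C1onTP; case: u_weak. Qed.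

Let C1u := solution_C1.

Definition source q : R := f (u q) * l (hgrad_norm u q).

Lemma continuous_source : continuous source.
Proof.
apply: continuousM_fun.
  by apply: continuous_comp_ge0 => // q; exact: C1on_continuous C1u Logic.I.
exact: (continuous_comp_ge0 l_continuous (hgrad_norm_ge0 u) (continuous_hgrad_norm C1u)).
Qed.

Lemma continuous_fluxX j : continuous (fun q => flux_scale u q * Xfield j u q).
Proof.
apply: continuous_flux => //; first exact: continuous_Xfield.
by move=> q; exact: Xfield_le_norm.
Qed.

Lemma continuous_fluxY j : continuous (fun q => flux_scale u q * Yfield j u q).
Proof.
apply: continuous_flux => //; first exact: continuous_Yfield.
by move=> q; exact: Yfield_le_norm.
Qed.

Lemma test_box_supported (h : H -> R) : test_function h -> exists2 B, 0 < B & box_supported B h.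
Proof.
move=> [_ /compact_bounded[M [_ HM]]].
pose M' := Num.max (M + 1) 1.
have MM' : M < M' by rewrite lt_max ltrDl ltr01.
exists (M' + 1); first by rewrite ltr_wpDl// le_max ler01 orbT.
move=> q i Bq; apply: contrapT => /eqP hq.
have : `|q| <= M' by apply: HM => //; exact: subset_closure.
apply/negP; rewrite -ltNge; apply: lt_le_trans (coord_le_norm q i).
by apply: lt_le_trans Bq; rewrite ltrDl.
Qed.

(** For a smooth test function the flux and source parts are integrable separately, which turns the
    inequality between extended reals into one between reals; [pairing_extend] then reaches C^1 test
    functions. *)
Lemma weak_pairing B (zeta : H -> R) : 0 < B -> C1on setT zeta ->
  (forall q, 0 <= zeta q) -> box_supported B zeta ->
  \int[lebesgue_rV]_q pairing (fun j q => flux_scale u q * Xfield j u q)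
    (fun j q => flux_scale u q * Yfield j u q) source zeta q <= 0.
Proof.
have cX := continuous_fluxX; have cY := continuous_fluxY; have cs := continuous_source.
move=> B0 C1 z0 sz; apply: (pairing_extend cX cY cs B0) => // h th h0.
have [b b0 sb] := test_box_supported th.
have C1h : C1on setT h by apply/C1onTP; exact: (th.1 1%N).
have c0 (T : topologicalType) : continuous (fun _ : T => 0 : R) by exact: cst_continuous.
have cX0 (j : 'I_m) : continuous (fun _ : H => 0 : R) by exact: c0.
pose P1 := pairing (fun j q => flux_scale u q * Xfield j u q)
    (fun j q => flux_scale u q * Yfield j u q) (fun=> 0) h.
pose P2 := pairing (fun (j : 'I_m) (q : H) => 0) (fun j q => 0) source h.
have i1 : lebesgue_rV.-integrable setT (EFin \o P1).
  exact: (pairing_integrable cX cY (@c0 H) C1h sb).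
have i2 : lebesgue_rV.-integrable setT (EFin \o P2).
  exact: (pairing_integrable cX0 cX0 cs C1h sb).
rewrite (_ : pairing _ _ _ h = fun q => P1 q + P2 q); last first.
  apply/funext => q; rewrite /P1 /P2 /pairing mul0r addr0; congr (_ + _).
  by rewrite [X in X + _]big1 ?add0r// => j _; rewrite !mul0r addr0.
rewrite (RintegralD measurableT i1 i2).
have := u_weak.2 h th h0.
have -> : (fun q => ((hgrad_norm u q)^-1 * phi (hgrad_norm u q) * hgrad_dot u h q)%:E) = EFin \o P1.
  apply/funext => q /=; rewrite /P1 /pairing mul0r addr0 -/(flux_scale u q) /hgrad_dot mulr_sumr.
  by congr (_%:E); apply: eq_bigr => j _; ring.
have -> : (fun q => (f (u q) * l (hgrad_norm u q) * h q)%:E) = EFin \o P2.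
  apply/funext => q /=; rewrite /P2 /pairing big1 ?add0r// => j _.
  by rewrite !mul0r addr0.
rewrite /Rintegral -[X in (X <= _)%E]fineK; last exact: integrable_fin_num.
rewrite -[X in (_ <= - X)%E]fineK; last exact: integrable_fin_num.
by rewrite -EFinN lee_fin -subr_ge0 -opprD oppr_ge0 addrC.
Qed.

(** * Comparison of the solution with the barrier around one centre *)

Section barrier_centre.
Variables (al al1 al2 : R -> R) (t0 T : R).
Hypothesis t0_gt0 : 0 < t0.
Hypothesis bar : forall t : R, t0 < t -> t < T ->
  [/\ is_derive t 1 al (al1 t), is_derive t 1 al1 (al2 t),
     {for t, continuous al2}, 0 < al t & 0 < al1 t] /\
  0 <= al2 t /\
  derive1 phi (al1 t) * al2 t + (2 * m%:R + 1) / t * phi (al1 t) <=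
    (D * Lambda)^-1 * (f (al t) * l (al1 t)).
Hypothesis al_blowup : forall B, exists2 T', t0 < T' < T &
  forall t, T' < t -> t < T -> B < al t.

Let dal t : t0 < t -> t < T -> is_derive t 1 al (al1 t).
Proof. by move=> h1 h2; have [[]] := bar h1 h2. Qed.
Let dal1 t : t0 < t -> t < T -> is_derive t 1 al1 (al2 t).
Proof. by move=> h1 h2; have [[]] := bar h1 h2. Qed.
Let cal2 t : t0 < t -> t < T -> {for t, continuous al2}.
Proof. by move=> h1 h2; have [[]] := bar h1 h2. Qed.
Let al_gt0 t : t0 < t -> t < T -> 0 < al t.
Proof. by move=> h1 h2; have [[]] := bar h1 h2. Qed.
Let al1_gt0 t : t0 < t -> t < T -> 0 < al1 t.
Proof. by move=> h1 h2; have [[]] := bar h1 h2. Qed.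

Variable p : H.

(** The constant [(D * Lambda)^-1] in the barrier inequality is what [structure_bound] consumes,
    applied with [s = rho / rad]. *)
Lemma radial_lap_le q : shell_off p t0 T q ->
  radial_lap p phi al1 al2 q <= f (al (rad p q)) * l (kap p al1 q).
Proof.
move=> sq; have [[h1 h2] Z0] := sq; have [[_ _ _ a0 a1] [b0 H1]] := bar h1 h2.
have r0 : 0 < rad p q by exact: lt_trans h1.
have rh0 : 0 < rho p q by rewrite sqrtr_gt0.
pose s := rho p q / rad p q.
have s01 : 0 < s <= 1 by rewrite divr_gt0//= ler_pdivrMr// mul1r rho_le_rad.
have kE : kap p al1 q = s * al1 (rad p q) by rewrite /kap /s; ring.
have c0 : 0 <= (2 * m%:R + 1) / rad p q by rewrite divr_ge0 ?addr_ge0 ?mulr_ge0// ltW.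
have d0 : 0 <= f (al (rad p q)) by rewrite ltW// f_gt0.
have := structure_bound s01 a1 b0 c0 H1 d0.
rewrite /radial_lap kE; apply: le_trans; rewrite /s le_eqVlt; apply/orP; left; apply/eqP.
by field; rewrite gt_eqF.
Qed.

Let v := vfun p al.
Let C1v : C1on (shell p t0 T) v.
Proof. exact: (C1on_vfun t0_gt0 dal dal1). Qed.

(** The difference is larger at [qb] than on the inner sphere and negative near the outer one, so
    its maximum is attained inside the shell. If no maximum point lay on the axis, all would lie in
    the open set [O] where the source of [u] strictly exceeds the bound for the barrier; a
    superlevel set slightly below the maximum would then be a closed bounded part of [O], to which
    [strict_comparison] applies. *)
Lemma axis_maximizer s1 qb : t0 < s1 -> s1 <= rad p qb -> rad p qb < T ->
  v qb < u qb -> (forall q, rad p q <= s1 -> u q < u qb - v qb) ->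
  exists q, [/\ s1 < rad p q, rad p q < T, zsq p q = 0,
    u qb - v qb <= u q - v q &
    forall q', s1 <= rad p q' -> rad p q' < T -> u q' - v q' <= u q - v q].
Proof.
move=> s10 sqb qbT vub u_s1.
pose w q := u q - v q.
have [P Pp] : exists P, cube _ P p.
  by exists `|p| => i; exact: coord_le_norm.
have [B HB] := @rad_le_cube R m P T.
have cu : continuous u by move=> q; exact: C1on_continuous C1u Logic.I.
have [M M0 HM] := cube_bounded B cu.
have [T' /andP[tT' T'T] HT'] := al_blowup M.
(* Beyond [T1] the barrier exceeds the bound [M] of [u]; the maximum with [rad p qb] keeps [qb] in
   the compact shell [S]. *)
pose T1 := Num.max T' (rad p qb).
have T1T : T1 < T by rewrite gt_max T'T.
have w_out q : T1 < rad p q -> rad p q < T -> w q < 0.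
  rewrite gt_max => /andP[h1 _] h2; rewrite subr_lt0.
  by apply: le_lt_trans (HT' _ h1 h2); rewrite (le_trans (ler_norm _))// HM//; apply: (HB p Pp); exact: ltW.
pose S := [set q : H | s1 <= rad p q] `&` [set q | rad p q <= T1].
have cS : closed S.
  apply: closedI; [apply: closed_superlevel|apply: closed_sublevel]; exact: continuous_rad.
have S_cube : S `<=` cube _ B.
  by move=> q [_ /= h]; apply: (HB p Pp); rewrite (le_trans h)// ltW.
have kS : compact S by exact: subclosed_compact cS (@compact_cube R _ B) S_cube.
have S_shell : S `<=` shell p t0 T.
  by move=> q [/= h1 h2]; split; [exact: lt_le_trans h1|exact: le_lt_trans T1T].
have cw q : shell p t0 T q -> {for q, continuous w}.
  by move=> sq; apply: (continuousB (cu q)); exact: C1on_continuous C1v sq.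
have cwS A : A `<=` S -> {within A, continuous w}.
  move=> AS; apply: continuous_in_subspaceT => q /set_mem Aq; exact/cw/S_shell/AS.
have Sqb : S qb by split => //=; rewrite le_max lexx orbT.
have [q1 /set_mem Sq1 Hq1] := compact_EVT_max (ex_intro _ qb Sqb) kS (cwS _ (@subset_refl _ S)).
have wb : w qb <= w q1 by apply: Hq1; exact: mem_set.
have w1_gt0 : 0 < w q1 by apply: lt_le_trans wb; rewrite subr_gt0.
have max1 q : s1 <= rad p q -> rad p q < T -> w q <= w q1.
  move=> h1 h2; have [h3|h3] := leP (rad p q) T1; first by apply: Hq1; exact: mem_set.
  by apply: ltW; apply: lt_trans w1_gt0; exact: w_out.
have inner q : s1 <= rad p q -> rad p q < T -> w q = w q1 -> s1 < rad p q.
  rewrite le_eqVlt => /orP[/eqP E|//] qT wE; exfalso.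
  have : w q < w q1.
    apply: lt_le_trans wb; apply: le_lt_trans (u_s1 q _); last by rewrite -E.
    by rewrite gerBl ltW// al_gt0// -E.
  by rewrite wE ltxx.
have [[q [h1 h2 h3 h4]]|noaxis] :=
    pselect (exists q, [/\ s1 <= rad p q, rad p q < T, w q = w q1 & zsq p q = 0]).
  exists q; split => //; first exact: inner.
    by rewrite -/(w q) h3.
  by move=> q' h5 h6; rewrite -/(w q) h3; exact: max1.
exfalso.
have zpos q : s1 <= rad p q -> rad p q < T -> w q = w q1 -> 0 < zsq p q.
  move=> h1 h2 h3; rewrite lt0r zsq_ge0 andbT; apply/eqP => h4; apply: noaxis.
  by exists q; split.
pose al_ q := al (rad p q).
pose G q := source q - f (al_ q) * l (kap p al1 q).
have sub_off : shell_off p s1 T `<=` shell_off p t0 T.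
  by move=> q [[h1 h2] h3]; split => //; split => //; exact: lt_trans h1.
have cG q : shell_off p s1 T q -> {for q, continuous G}.
  move=> /sub_off sq; have [[h1 h2] Z0] := sq.
  have cs0 : {for q, continuous (source)}.
    exact: continuous_source.
  have ck : {for q, continuous (kap p al1)}.
    exact: C1on_continuous (C1on_kap t0_gt0 dal1 cal2) sq.
  have ca : {for q, continuous al_} by exact: C1on_continuous C1v sq.1.
  have cf := continuous_comp ca (within_pos_continuous f_continuous (al_gt0 h1 h2)).
  have cl := continuous_comp ck (within_pos_continuous l_continuous (kap_gt0 t0_gt0 al1_gt0 sq)).
  exact: (continuousB cs0 (continuousM cf cl)).
pose O := shell_off p s1 T `&` [set q | 0 < G q].
have oO : open O by exact: open_superlevel_on (@open_shell_off _ _ p s1 T) cG.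
have Oshell : O `<=` shell_off p t0 T by move=> q [/sub_off].
have max_O q : s1 <= rad p q -> rad p q < T -> w q = w q1 -> O q.
  move=> h1 h2 h3; have h0 := inner q h1 h2 h3; have Z0 := zpos q h1 h2 h3.
  have sq : shell_off p s1 T q by [].
  split => //=; have sq' := sub_off _ sq.
  have dw x : shell p s1 T x -> differentiable w x.
    move=> [k1 k2]; apply: (differentiableB (C1u Logic.I).1); apply: (C1v _).1.
    by split => //; exact: lt_trans k1.
  (* At an interior maximum the partial derivatives of [u] and [v] agree, so the same positive value
     of [l] occurs on both sides and the strict monotonicity of [f] decides. *)
  have pE i : partial i u q = partial i v q.
    apply/eqP; rewrite -subr_eq0 -partialN; last exact: (C1v sq'.1).1.
    rewrite -partialD; [|exact: (C1u Logic.I).1|exact: differentiableN (C1v sq'.1).1].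
    apply/eqP; have := @partial_max0 _ _ _ w q i (@open_shell _ _ p s1 T) sq.1 dw; apply=> x [k1 k2].
    by rewrite -/(w q) h3; apply: max1 => //; exact: ltW.
  have nE : hgrad_norm u q = kap p al1 q.
    rewrite -(hgrad_norm_vfun t0_gt0 dal al1_gt0 sq') /hgrad_norm /hgrad_dot; congr Num.sqrt.
    by apply: eq_bigr => j _; rewrite /Xfield /Yfield !pE.
  rewrite /G /source nE -mulrBl mulr_gt0 ?l_gt0 ?(kap_gt0 t0_gt0 al1_gt0 sq')//.
  rewrite subr_gt0 f_incr//; first by rewrite ltW// al_gt0// (sq'.1.1).
  by rewrite -subr_gt0 -/(w q) h3.
(* By compactness the difference stays below its maximum by a fixed amount on the part of [S]
   outside [O]. *)
have [c0 c0w Hc0] : exists2 c0, c0 < w q1 & forall q, S q -> ~ O q -> w q <= c0.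
  pose E := S `&` ~` O.
  have kE : compact E.
    apply: subclosed_compact kS (@subIsetl _ _ _).
    by apply: closedI => //; exact: open_closedC.
  have [[x Ex]|nE] := pselect (exists x, E x); last first.
    by exists (w q1 - 1) => [|q Sq nO]; [rewrite gtrBl|exfalso; apply: nE; exists q].
  have [q2 /set_mem Eq2 Hq2] := compact_EVT_max (ex_intro _ x Ex) kE (cwS _ (@subIsetl _ _ _)).
  exists (w q2); last by move=> q Sq nO; apply: Hq2; apply: mem_set.
  have [[k1 k2] nO] := Eq2; have k3 := le_lt_trans k2 T1T.
  rewrite lt_neqAle max1// andbT; apply/eqP => E2; apply: nO; exact: max_O.
(* The level is also made positive, so that the region beyond [T1], where the difference is
   negative, lies below it. *)
pose c := (Num.max c0 0 + w q1) / 2.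
have cmax : Num.max c0 0 < w q1 by rewrite gt_max c0w.
have [c1 c2] := midf_lt cmax.
pose F := S `&` [set q | c <= w q].
have FO : F `<=` O.
  move=> q [Sq /= cq]; apply: contrapT => nO.
  have := le_trans cq (Hc0 q Sq nO); rewrite leNgt => /negP; apply.
  by apply: le_lt_trans c1; rewrite le_max lexx.
have cF : closed F.
  rewrite -openC openE => q nF; have [Sq|nS] := pselect (S q).
    have wc : w q < c by rewrite ltNge; apply/negP => h; apply: nF.
    have nb : nbhs q [set x | w x < c] by exact: (cvgr_lt _ (cw q (S_shell q Sq)) _ wc).
    by apply: filterS nb => x /= xc [_ /=]; rewrite leNgt xc.
  have : nbhs q (~` S) by apply: open_nbhs_nbhs; split => //; exact: closed_openC.
  by apply: filterS => x nSx [].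
have cX := continuous_fluxX.
have cY := continuous_fluxY.
have cs := continuous_source.
have wk b z := @weak_pairing b z.
have C1vO : C1on O v by apply: C1on_subset C1v => q /Oshell [].
have C1gx j : C1on O (fluxx p phi al1 j).
  exact: C1on_subset Oshell (C1on_fluxx t0_gt0 phi_derivable dphi_continuous dal1 cal2 al1_gt0 j).
have C1gy j : C1on O (fluxy p phi al1 j).
  exact: C1on_subset Oshell (C1on_fluxy t0_gt0 phi_derivable dphi_continuous dal1 cal2 al1_gt0 j).
have c_gt0 : 0 < c by apply: le_lt_trans c1; rewrite le_max lexx orbT.
pose B' := Num.max B 1.
have B'0 : 0 < B' by rewrite lt_max ltr01 orbT.
have FB : F `<=` cube _ B'.
  by move=> q [/S_cube h _] i; rewrite le_max h.
have Fs q : O q -> ~ F q -> u q - v q <= c.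
  move=> [[[k1 k2] _] _] nF; have [k3|k3] := leP (rad p q) T1.
    by apply/ltW; rewrite ltNge; apply/negP => h; apply: nF; split => //; split => //=; exact: ltW.
  by apply/ltW/(lt_trans (w_out q k3 k2)).
have mono q : O q -> 0 <= \sum_(j < m)
  ((flux_scale u q * Xfield j u q - fluxx p phi al1 j q) * (Xfield j u q - Xfield j v q) +
   (flux_scale u q * Yfield j u q - fluxy p phi al1 j q) * (Yfield j u q - Yfield j v q)).
  move=> /Oshell sq.
  have := flux_monotone u v q.
  rewrite [flux_scale v q](_ : _ = (kap p al1 q)^-1 * phi (kap p al1 q)); last first.
    by rewrite /flux_scale (hgrad_norm_vfun t0_gt0 dal al1_gt0 sq).
  move=> h; rewrite (eq_bigr _ (fun j _ => congr2 _ (congr2 _ (congr2 _ erefl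
    (congr1 _ (fluxxE phi t0_gt0 dal al1_gt0 j sq))) erefl) (congr2 _ (congr2 _ erefl
    (congr1 _ (fluxyE phi t0_gt0 dal al1_gt0 j sq))) erefl))).
  exact: h.
have strict q : O q ->
  \sum_(j < m) (Xfield j (fluxx p phi al1 j) q + Yfield j (fluxy p phi al1 j) q) < source q.
  move=> Oq; have sq := Oshell q Oq.
  rewrite (div_flux t0_gt0 phi_derivable dphi_continuous dal1 cal2 al1_gt0 sq).
  apply: le_lt_trans (radial_lap_le sq) _.
  by rewrite -subr_gt0; exact: Oq.2.
have Oq1 : O q1 by apply: max_O => //; [exact: Sq1.1|exact: le_lt_trans Sq1.2 T1T].
exact: (strict_comparison cX cY cs wk C1u oO C1vO C1gx C1gy cF FO B'0 FB Fs mono strict Oq1 c2).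
Qed.

End barrier_centre.

Lemma nbhs_rV_coord n (p : 'rV[R]_n) (A : set 'rV[R]_n) : nbhs p A ->
  exists2 e, 0 < e & forall q : 'rV[R]_n, (forall i, `|q ord0 i - p ord0 i| < e) -> A q.
Proof.
move=> /nbhs_ballP[e /= e0 He]; exists e => // q qe; apply: He.
rewrite -ball_normE /=; apply: norm_lt_coord => // i.
by rewrite !mxE distrC.
Qed.

Hypothesis m_gt0 : (1 <= m)%N.

Lemma solution_const p qb : u qb <= u p.
Proof.
rewrite leNgt; apply/negP => upq.
have cu : continuous u by move=> q; exact: C1on_continuous C1u Logic.I.
(* A quarter of the gap leaves [u] below [u qb - eta] near [p], and [eta < u qb] because [u p] is
   nonnegative. *)
pose eta := (u qb - u p) / 4.
have eta0 : 0 < eta by rewrite divr_gt0// subr_gt0.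
have etaE : u qb - u p = 4 * eta by rewrite /eta; field.
have [e e0 He] : exists2 e, 0 < e & forall q : H, (forall i, `|q ord0 i - p ord0 i| < e) ->
    u q < u qb - eta.
  apply: (@nbhs_rV_coord _ p [set q | u q < u qb - eta]).
  by apply: (cvgr_lt _ (cu p)); move: etaE eta0; lra.
have [d1 d10 Hd1] : exists2 d, 0 < d & forall p' : H, (forall i, `|p' ord0 i - p ord0 i| < d) ->
    rad p' qb < rad p qb + 1.
  apply: (@nbhs_rV_coord _ p [set p' | rad p' qb < rad p qb + 1]).
  under eq_set => p' do rewrite [rad p' qb]radC.
  by apply: (cvgr_lt _ (@continuous_rad _ _ qb p)); rewrite radC ltrDl.
(* The centre will move by at most 1 in each coordinate, so [P] bounds the coordinates of all
   centres involved. *)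
pose P := `|p| + 1 : R.
pose e' := Num.min 1 (e / 4).
have e'0 : 0 < e' by rewrite lt_min ltr01 divr_gt0.
have e'1 : e' <= 1 by rewrite ge_min lexx.
have e'e : e' <= e / 4 by rewrite ge_min lexx orbT.
(* By [rad_dist] the gauge ball of radius [s1] around any of these centres stays within [e'] of its
   centre. *)
pose s1 := e' / (2 + 4 * m%:R * P).
have mP : 0 <= 4 * m%:R * P by rewrite !mulr_ge0// addr_ge0.
have s10 : 0 < s1 by rewrite divr_gt0// ltr_wpDr.
have s1E : s1 * (2 + 4 * m%:R * P) = e' by rewrite divfK// gt_eqF// ltr_wpDr.
have s1h : s1 * 2 <= 1.
  by apply: le_trans e'1; rewrite -s1E ler_pM2l// lerDl.
have s1_dist : s1 ^+ 2 + s1 + 4 * m%:R * P * s1 <= e'.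
  rewrite -s1E (_ : s1 * _ = s1 + s1 + 4 * m%:R * P * s1); last by ring.
  by rewrite !lerD2r expr2 ler_piMr ?(ltW s10)//; move: s1h s10; lra.
pose t1 := rad p qb + 1.
have t01 : s1 / 2 < t1.
  by rewrite /t1; move: s1h s10 (rad_ge0 p qb); lra.
have N0 : 0 <= 2 * m%:R + 1 :> R by rewrite addr_ge0// mulr_ge0.
have eps0 : 0 < (D * Lambda)^-1 by rewrite invr_gt0 mulr_gt0.
(* Starting at [s1 / 2] puts the inner sphere of radius [s1] strictly inside the domain of the
   barrier, and [t1] exceeds [rad p qb] to allow for moved centres. *)
have [T [al [al1 [al2 [t1T bar al_eta blow]]]]] :=
  barrier N0 eps0 eta0 (divr_gt0 s10 (ltr0n _ 2)) t01.
have t0s1 : s1 / 2 < s1 by move: s10; lra.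
pose d := Num.min (Num.min 1 (e / 4)) (d1 / 2).
have d0 : 0 < d by rewrite !lt_min ltr01 !divr_gt0.
have dle : [/\ d <= 1, d <= e / 4 & d <= d1 / 2].
  by rewrite !ge_min !lexx !orbT.
apply: (@axis_trick R m u al al1 al2 (s1 / 2) s1 t1 T eta (divr_gt0 s10 (ltr0n _ 2)) t0s1 t1T
  _ _ _ _ al_eta blow cu _ p qb d (Ordinal m_gt0) d0 eta0).
- by move=> t h1 h2; have [[]] := bar t h1 h2.
- by move=> t h1 h2; have [[]] := bar t h1 h2.
- by move=> t h1 h2; have [[]] := bar t h1 h2.
- by move=> t h1 h2; have [_ []] := bar t h1 h2.
- move=> p' q' h1 h2 h3 h4.
  exact: (axis_maximizer (divr_gt0 s10 (ltr0n _ 2)) bar blow t0s1 h1 h2 h3 h4).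
- by move: etaE eta0 (u_ge0 p); lra.
move=> p' cp'; have [dl1 dl2 dl3] := dle; split.
  apply/ltW/Hd1 => i; apply: le_lt_trans (cp' i) _; move: dl3 d10; lra.
move=> q rq; apply: He => i.
have Pp' : cube _ P p'.
  move=> k; rewrite -[p' ord0 k](subrK (p ord0 k)) (le_trans (ler_normD _ _))//.
  by rewrite addrC lerD ?coord_le_norm// (le_trans (cp' k)).
have := rad_dist i Pp' rq => /le_trans/(_ s1_dist) qp'.
rewrite -[q ord0 i](subrK (p' ord0 i)) -addrA (le_lt_trans (ler_normD _ _))//.
by apply: le_lt_trans (lerD qp' (cp' i)) _; move: e'e dl2 e0; lra.
Qed.

(** For a constant the flux side of the weak inequality is zero, while the source side, tested with
    a bump, would be positive if [c] were. *)
Lemma constant_solution_eq0 c : (forall q, u q = c) -> 0 < l 0 -> c = 0.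
Proof.
move=> uc l0; apply/eqP; rewrite eq_le -{2}(uc 0) u_ge0 andbT leNgt; apply/negP => c0.
have E : u = fun=> c by exact/funext.
pose b : H -> R := bump 1.
have sb : box_supported 1 b by move=> q i; exact: bump_eq0.
have tb : test_function b.
  by split; [move=> k; exact: Ck_bump|exact: box_supported_compact sb].
have cb : continuous b by exact: (tb.1 0%N).
have X0 j q : Xfield j u q = 0 by rewrite /Xfield E !partial_cst mulr0 addr0.
have Y0 j q : Yfield j u q = 0 by rewrite /Yfield E !partial_cst mulr0 subr0.
have dot0 v q : hgrad_dot u v q = 0.
  by apply: big1 => j _; rewrite X0 Y0 !mul0r addr0.
have k0 : 0 < f c * l 0 by rewrite mulr_gt0// f_gt0.
have := u_weak.2 b tb (@bump_ge0 _ _ 1).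
have -> : (fun q => ((hgrad_norm u q)^-1 * phi (hgrad_norm u q) * hgrad_dot u b q)%:E) = cst 0%E.
  by apply/funext => q; rewrite dot0 mulr0.
rewrite integral0 oppe0.
pose h q := f c * l 0 * b q.
have -> : (fun q => (f (u q) * l (hgrad_norm u q) * b q)%:E) = EFin \o h.
  by apply/funext => q /=; rewrite uc /hgrad_norm dot0 sqrtr0.
have ch : continuous h by apply: continuousM_fun cb; exact: cst_continuous.
have sh : box_supported 1 h by move=> q i Bq; rewrite /h (sb q i Bq) mulr0.
have ih := box_supported_integrable ch sh.
have h_ge0 q : 0 <= h q by rewrite mulr_ge0 ?(ltW k0)// bump_ge0.
have h0 : 0 < h 0 by rewrite mulr_gt0//; apply: bump_gt0 => i; rewrite mxE normr0.
rewrite -[X in (X <= _)%E]fineK; last exact: integrable_fin_num.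
rewrite lee_fin leNgt => /negP; apply.
exact: integral_gt0 ch sh h_ge0 h0.
Qed.

End keller_osserman.

Theorem theorem1p1 (R : realType) (m : nat) (phi f l : R -> R)
    (C D Lambda tau : R) :
  (1 <= m)%N ->
  {within `[0, +oo[, continuous phi} ->
  (forall t, 0 < t -> derivable phi t 1) ->
  (forall t, 0 < t -> {for t, continuous (derive1 phi)}) ->
  phi 0 = 0 ->
  (forall t, 0 < t -> 0 < derive1 phi t) ->
  {within `[0, +oo[, continuous f} ->
  (forall s t, 0 <= s -> s < t -> f s < f t) ->
  (forall t, 0 < t -> 0 < f t) ->
  {within `[0, +oo[, continuous l} ->
  (forall t, 0 < t -> 0 < l t) ->
  1 <= C ->
  C_monotone C l ->
  L1_0plus (fun t => t * derive1 phi t / l t) ->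
  ~ L1_pinfty (fun t => t * derive1 phi t / l t) ->
  phi t / l t @[t --> 0^'+] --> 0 ->
  0 < D -> 0 < Lambda -> 0 <= tau ->
  (forall s t, 0 < s <= 1 -> 0 < t ->
     s * derive1 phi (s * t) <= D * s `^ tau * derive1 phi t) ->
  (forall s t, 0 <= s <= 1 -> 0 <= t ->
     s `^ (1 + tau) * l t <= Lambda * l (s * t)) ->
  L1_pinfty (fun t => (Kinv phi l (Ffun f t))^-1) ->
  forall u : 'rV[R]_(m + m + 1) -> R,
    (forall q, 0 <= u q) ->
    weak_solution phi f l u ->
    (exists c, forall q, u q = c) /\ (0 < l 0 -> forall q, u q = 0).
Proof.
move=> m0 cp dp cdp phi0 dp0 cf fi f0 cl l0 C1 lm K0 Koo po D0 L0 tau0 ps ls KO u u0 uw.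
have uc q : u q = u 0.
  by apply/eqP; rewrite eq_le; apply/andP; split;
     apply: (solution_const cp dp cdp phi0 dp0 cf fi f0 cl l0 C1 lm K0 Koo po D0 L0 ps ls KO u0 uw m0).
split=> [|ll q]; first by exists (u 0).
by rewrite uc; exact: (constant_solution_eq0 f0 u0 uw uc ll).
Qed.
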